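(* Let $q=-1$ (so $N=2$). Let $V$ be an irreducible $\mathrm{Der}\,\mathbb{C}_q$-module of the intermediate series. Then there exist $a\in\{0,1\}$, $\alpha\in\mathbb{C}^2$ and $b\in\mathbb{C}$ such that $V$ is isomorphic to a sub-quotient module of the $\mathrm{Der}\,\mathbb{C}_q$-module $A_{a,\alpha,b}$.
   Context: All vector spaces are over $\mathbb{C}$. Let $q$ be a primitive $N$-th root of unity, $N>1$. $\mathbb{C}_q=\mathbb{C}_q[x_1,x_2,x_1^{-1},x_2^{-1}]$ is the associative algebra of noncommutative Laurent polynomials with relation $x_2x_1=qx_1x_2$; it has basis $x^{m}=x_1^{m_1}x_2^{m_2}$, $m=(m_1,m_2)\in\mathbb{Z}^2$. Under the commutator it is a Lie algebra with $[x^m,x^n]=(q^{m_2n_1}-q^{m_1n_2})x^{m+n}$. Its center is $Z(\mathbb{C}_q)=\mathrm{span}\{x^m : m\in N\mathbb{Z}^2\}$ and its derived Lie subalgebra is $\mathbb{C}'_q=\mathrm{span}\{x^m: m\in\mathbb{Z}^2\setminus N\mathbb{Z}^2\}$. Let $\partial_1,\partial_2$ be the degree derivations of $\mathbb{C}_q$, $\partial_s(x^m)=m_sx^m$, and put $H=\mathbb{C}\partial_1\oplus\mathbb{C}\partial_2$. $\mathrm{Der}\,\mathbb{C}_q$ denotes the Lie algebra of derivations of the associative algebra $\mathbb{C}_q$. One has $\mathrm{Der}\,\mathbb{C}_q=\mathrm{ad}\,\mathbb{C}'_q\oplus(Z(\mathbb{C}_q)\partial_1\oplus Z(\mathbb{C}_q)\partial_2)$.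 Identifying $\mathrm{ad}\,\mathbb{C}'_q$ with $\mathbb{C}'_q$, it has basis $\{x^m,\ x^n\partial_s : m\in\mathbb{Z}^2\setminus N\mathbb{Z}^2,\ n\in N\mathbb{Z}^2,\ s=1,2\}$. For $\partial=a_1\partial_1+a_2\partial_2\in H$ and $\lambda=(\lambda_1,\lambda_2)\in\mathbb{C}^2$ put $\langle\partial,\lambda\rangle=a_1\lambda_1+a_2\lambda_2$. The brackets are: - $[x^m,x^{m'}]=(q^{m_2m'_1}-q^{m_1m'_2})x^{m+m'}$ for $m,m'\in\mathbb{Z}^2\setminus N\mathbb{Z}^2$ (the coefficient vanishes if $m+m'\in N\mathbb{Z}^2$); - $[x^n\partial,x^m]=\langle\partial,m\rangle x^{m+n}$ for $n\in N\mathbb{Z}^2$, $m\in\mathbb{Z}^2\setminus N\mathbb{Z}^2$; - $[x^n\partial,x^{n'}\partial']=x^{n+n'}(\langle\partial,n'\rangle\partial'-\langle\partial',n\rangle\partial)$ for $n,n'\in N\mathbb{Z}^2$, $\partial,\partial'\in H$. A $\mathrm{Der}\,\mathbb{C}_q$-module $V$ is a weight module if $V=\bigoplus_{\lambda\in H^*}V_\lambda$, where $V_\lambda=\{v\in V: hv=\lambda(h)v\ \forall h\in H\}$ and $\dim V_\lambda<\infty$ for all $\lambda\in H^*$. A module of the intermediate series is a weight module with $\dim V_\lambda\le 1$ for all $\lambda\in H^*$. For $a\in\{0,1\}$, $\alpha\in\mathbb{C}^2$, $b\in\mathbb{C}$, the $\mathrm{Der}\,\mathbb{C}_q$-module $A_{a,\alpha,b}$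 has basis $\{v_k: k\in\mathbb{Z}^2\}$ and action $$x^m v_k=(q^{m_2k_1}-a\,q^{m_1k_2})v_{m+k},\qquad (x^n\partial)v_k=\langle\partial,\alpha+k+bn\rangle v_{n+k}$$ for $m\in\mathbb{Z}^2\setminus N\mathbb{Z}^2$, $n\in N\mathbb{Z}^2$, $k\in\mathbb{Z}^2$, $\partial\in H$. *)

(* Defs.v *)
From HB Require Import structures.
From mathcomp Require Import all_boot all_order all_algebra.
From mathcomp Require Import finmap.
From mathcomp Require Import boolp functions reals.
From mathcomp Require Import complex.
From mathcomp Require Import freeg.

Set Implicit Arguments.
Unset Strict Implicit.
Unset Printing Implicit Defensive.

Import GRing.Theory.

Local Open Scope ring_scope.

Section Derivations.
Variables (F : fieldType) (A : algType F).

Definition derivation : {pred A -> A} :=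
  [pred D | `[< linear D /\ forall u w, D (u * w) = D u * w + u * D w >]].

Lemma derivation_submod_closed : submod_closed derivation.
Proof.
split=> [|a D E].
  apply/asboolP; split=> [c u v|u w]; rewrite -[0]/(fun=> 0).
    by rewrite scaler0 addr0.
  by rewrite mul0r mulr0 addr0.
move=> /asboolP[linD LD] /asboolP[linE LE]; apply/asboolP.
rewrite -[a *: D + E]/(fun u => a *: D u + E u); split=> [c u v|u w].
  rewrite linD linE !scalerDr !scalerA (mulrC a c).
  exact: addrACA.
rewrite LD LE !mulrDl !mulrDr scalerDr.
by rewrite scalerAl scalerAr addrACA.
Qed.

HB.instance Definition _ :=
  GRing.isSubmodClosed.Build F (A -> A) derivation derivation_submod_closed.

Record der := Der { der_fun :> A -> A; _ : der_fun \in derivation }.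

HB.instance Definition _ := [isSub for der_fun].
HB.instance Definition _ := [Choice of der by <:].
HB.instance Definition _ := [SubChoice_isSubLmodule of der by <:].

Lemma der_linear (D : der) : linear D.
Proof. by case: D => D /= /asboolP[]. Qed.

Lemma derM (D : der) u w : D (u * w) = D u * w + u * D w.
Proof. by case: D => D /= /asboolP[]. Qed.

HB.instance Definition _ (D : der) :=
  GRing.isLinear.Build F A A *:%R (der_fun D) (der_linear D).

Lemma bracket_subproof (D E : der) :
  (fun u => D (E u) - E (D u)) \in derivation.
Proof.
apply/asboolP; split=> [c u v|u w].
  by rewrite !(linearD, linearZ) /= addrACA.
rewrite !derM [D (_ + _)]linearD [E (_ + _)]linearD /= !derM mulrBl mulrBr.
apply/eqP.
rewrite subr_eq [eqbRHS](AC ((2*2)*(2*2)) ((1*2*5)*7*(6*(3*4*8)))) /=.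
by rewrite !subrK addrA.
Qed.

Definition bracket (D E : der) : der := Der (bracket_subproof D E).

Lemma ad_subproof (u : A) : (fun w => u * w - w * u) \in derivation.
Proof.
apply/asboolP; split=> [c v w|v w].
  by rewrite mulrDr mulrDl -scalerAr -scalerAl scalerBr opprD addrACA.
by rewrite mulrBl mulrBr !mulrA addrA subrK.
Qed.

Definition ad (u : A) : der := Der (ad_subproof u).

Lemma central_mul_subproof (z : A) (hz : forall u, z * u = u * z) (D : der) :
  (fun u => z * D u) \in derivation.
Proof.
apply/asboolP; split=> [c u v|u w].
  by rewrite linearD linearZ mulrDr -scalerAr.
by rewrite derM mulrDr !mulrA (hz u).
Qed.

Definition central_mul (z : A) (hz : forall u, z * u = u * z) (D : der) : der :=
  Der (central_mul_subproof hz D).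

End Derivations.

Section DerModules.
Variables (F : fieldType) (A : algType F).

Record derModule := DerModule {
  dm_sort :> lmodType F;
  dm_act : der A -> dm_sort -> dm_sort;
  dm_act_linear : forall D, linear (dm_act D);
  dm_act_linearl : forall v, linear (dm_act^~ v);
  dm_act_bracket : forall D E v,
    dm_act (bracket D E) v = dm_act D (dm_act E v) - dm_act E (dm_act D v)
}.

Definition isomorphic (M M' : derModule) : Prop :=
  exists f : {linear M -> M'},
    bijective f /\ forall D v, f (dm_act D v) = dm_act D (f v).

Record submodule (M : derModule) := Submodule {
  sm_pred : {pred M};
  sm_closed : submod_closed sm_pred;
  sm_stable : forall D v, v \in sm_pred -> dm_act D v \in sm_pred
}.

Definition irreducible (M : derModule) : Prop :=
  (exists v : M, v != 0) /\
  forall U : submodule M,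
    (forall v, v \in sm_pred U -> v = 0) \/ (forall v, v \in sm_pred U).

HB.instance Definition _ (M : derModule) (U : submodule M) :=
  GRing.isSubmodClosed.Build F M (sm_pred U) (sm_closed U).

Section SubModule.
Variables (M : derModule) (U : submodule M).

Record sub_sort := SubSort { sub_val : M; _ : sub_val \in sm_pred U }.

HB.instance Definition _ := [isSub for sub_val].
HB.instance Definition _ := [Choice of sub_sort by <:].
HB.instance Definition _ := [SubChoice_isSubLmodule of sub_sort by <:].

Definition sub_act (D : der A) (u : sub_sort) : sub_sort :=
  SubSort (sm_stable D (valP u)).

Lemma sub_act_linear D : linear (sub_act D).
Proof.
by move=> c u v; apply: val_inj; rewrite /= dm_act_linear.
Qed.

Lemma sub_act_linearl u : linear (sub_act^~ u).
Proof.
by move=> c D E; apply: val_inj; rewrite /= (dm_act_linearl (val u)).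
Qed.

Lemma sub_act_bracket D E u :
  sub_act (bracket D E) u = sub_act D (sub_act E u) - sub_act E (sub_act D u).
Proof. by apply: val_inj; rewrite /= dm_act_bracket. Qed.

Definition subModule : derModule :=
  DerModule sub_act_linear sub_act_linearl sub_act_bracket.

End SubModule.

Section QuotientModule.
Variables (M : derModule) (U : submodule M).
Local Open Scope quotient_scope.

Definition quot_sort := Quotient.quot (sm_pred U).

HB.instance Definition _ := GRing.Zmodule.on quot_sort.
HB.instance Definition _ := EqQuotient.on quot_sort.

Definition quot_pi (v : M) : quot_sort := \pi v.
Definition quot_repr (x : quot_sort) : M := repr x.

Lemma quot_piK x : quot_pi (quot_repr x) = x.
Proof. exact: reprK. Qed.

Lemma quot_eqP (u v : M) :
  (quot_pi u = quot_pi v) <-> (u - v \in sm_pred U).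
Proof. by rewrite Quotient.idealrBE; split=> [/eqP|/eqP]. Qed.

Definition quot_scale (c : F) (x : quot_sort) : quot_sort :=
  quot_pi (c *: quot_repr x).

Lemma quot_scaleE c v : quot_scale c (quot_pi v) = quot_pi (c *: v).
Proof.
apply/quot_eqP; rewrite -scalerBr rpredZ //.
by apply/quot_eqP; rewrite quot_piK.
Qed.

Lemma quot_addE u v :
  quot_pi u + quot_pi v = quot_pi (u + v).
Proof. by rewrite /quot_pi !piE. Qed.

Lemma quot_scaleA a b x : quot_scale a (quot_scale b x) = quot_scale (a * b) x.
Proof. by rewrite -[x]quot_piK !quot_scaleE scalerA. Qed.

Lemma quot_scale1 : left_id 1 quot_scale.
Proof. by move=> x; rewrite -[x]quot_piK quot_scaleE scale1r. Qed.

Lemma quot_scaleDr : right_distributive quot_scale +%R.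
Proof.
move=> c x y; rewrite -[x]quot_piK -[y]quot_piK.
by rewrite quot_addE !quot_scaleE scalerDr quot_addE.
Qed.

Lemma quot_scaleDl x : {morph quot_scale^~ x : a b / a + b}.
Proof. by move=> a b; rewrite -[x]quot_piK !quot_scaleE scalerDl quot_addE. Qed.

HB.instance Definition _ := GRing.Zmodule_isLmodule.Build F quot_sort
  quot_scaleA quot_scale1 quot_scaleDr quot_scaleDl.

Lemma quot_piZ c v : c *: quot_pi v = quot_pi (c *: v).
Proof. exact: quot_scaleE. Qed.

Definition quot_act (D : der A) (x : quot_sort) : quot_sort :=
  quot_pi (dm_act D (quot_repr x)).

Lemma quot_actE D v : quot_act D (quot_pi v) = quot_pi (dm_act D v).
Proof.
apply/quot_eqP; rewrite -[X in X - _]scale1r addrC -scaleN1r.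
rewrite scale1r -dm_act_linear sm_stable // scaleN1r addrC.
by apply/quot_eqP; rewrite quot_piK.
Qed.

Lemma quot_act_linear D : linear (quot_act D).
Proof.
move=> c x y; rewrite -[x]quot_piK -[y]quot_piK.
by rewrite !(quot_piZ, quot_addE, quot_actE) dm_act_linear.
Qed.

Lemma quot_act_linearl x : linear (quot_act^~ x).
Proof.
move=> c D E; rewrite -[x]quot_piK !quot_actE (dm_act_linearl (quot_repr x)).
by rewrite quot_piZ quot_addE.
Qed.

Lemma quot_oppE u : - quot_pi u = quot_pi (- u).
Proof. by rewrite /quot_pi !piE. Qed.

Lemma quot_act_bracket D E x :
  quot_act (bracket D E) x =
  quot_act D (quot_act E x) - quot_act E (quot_act D x).
Proof.
rewrite -[x]quot_piK !quot_actE dm_act_bracket.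
by rewrite -quot_addE -quot_oppE.
Qed.

Definition quotientModule : derModule :=
  DerModule quot_act_linear quot_act_linearl quot_act_bracket.

End QuotientModule.
End DerModules.

Section Lift.
Variables (F : fieldType) (K : choiceType) (V : lmodType F) (f : K -> V).

Lemma fglift_linear : linear (fglift f : {freeg K / F} -> V).
Proof.
have fD u v : fglift f (u + v) = fglift f u + fglift f v.
  have fB := lift_is_additive f.
  have fN w : fglift f (- w) = - fglift f w.
    by rewrite -sub0r fB -(subrr 0) fB subrr sub0r.
  by rewrite -[v in LHS]opprK fB fN opprK.
have f0 : fglift f 0 = 0 by apply: (addrI (fglift f 0)); rewrite -fD !addr0.
have f_sum (s : seq K) (E : K -> {freeg K / F}) :
    fglift f (\sum_(m <- s) E m) = \sum_(m <- s) fglift f (E m).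
  exact: (big_morph _ fD f0).
move=> c u v; rewrite fD; congr (_ + _).
have -> : c *: u = \sum_(m <- dom u) << c * coeff m u *g m >> by [].
rewrite -[in RHS](freeg_sumE u) !f_sum scaler_sumr.
by apply: eq_bigr => m _; rewrite !liftU scalerA.
Qed.

HB.instance Definition _ :=
  GRing.isLinear.Build F {freeg K / F} V *:%R (fglift f) fglift_linear.

End Lift.

Section QuantumTorus.
Variables (F : fieldType) (N : nat) (q : F) (hq : N.-primitive_root q).

(* The type depends on hq because its product is associative only if q != 0. *)
Definition qtorus : Type := let _ := hq in {freeg (int * int)%type / F}.

HB.instance Definition _ := GRing.Lmodule.on qtorus.

(* x^m = x_1^{m_1} x_2^{m_2} *)
Definition xmon (m : int * int) : qtorus := << m >>.

Lemma qlift_linear (V : lmodType F) (f : int * int -> V) :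
  linear (fglift f : qtorus -> V).
Proof. exact: fglift_linear. Qed.

HB.instance Definition _ (V : lmodType F) (f : int * int -> V) :=
  GRing.isLinear.Build F qtorus V *:%R (fglift f : qtorus -> V)
    (qlift_linear f).

Lemma qlift_xmon (V : lmodType F) (f : int * int -> V) m :
  fglift f (xmon m) = f m.
Proof. by rewrite liftU scale1r. Qed.

Lemma qtorus_ind (P : qtorus -> Prop) :
  (forall c u w, P u -> P w -> P (c *: u + w)) -> P 0 ->
  (forall m, P (xmon m)) -> forall u, P u.
Proof.
move=> PD P0 Px u; rewrite -(freeg_sumE u).
elim: (dom u) => [|m s ih]; first by rewrite big_nil.
rewrite big_cons; have -> : << coeff m u *g m >> = coeff m u *: xmon m.
  by apply/eqP/freeg_eqP => k; rewrite coeffZ !coeffU mul1r.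
exact: PD.
Qed.

(* x^m x^n = q^{m_2 n_1} x^{m+n} follows from x_2 x_1 = q x_1 x_2. *)
Definition qmul (u w : qtorus) : qtorus :=
  fglift (fun m => fglift (fun n => q ^ (m.2 * n.1) *: xmon (m + n)) w) u.

Lemma q_neq0 : q != 0.
Proof.
apply: contraTneq (oner_neq0 F) => q0.
by rewrite -(prim_expr_order hq) q0 expr0n eqn0Ngt (prim_order_gt0 hq) eqxx.
Qed.

Lemma qmul_linearl w : linear (qmul^~ w).
Proof. by move=> c u v; rewrite /qmul linearP. Qed.

Lemma qmul_linearr u : linear (qmul u).
Proof.
move=> c v w; elim/qtorus_ind: u => [d u u' ihu ihu'||m].
- have E x : qmul (d *: u + u') x = d *: qmul u x + qmul u' x.
    exact: qmul_linearl.
  by rewrite !E ihu ihu' !scalerDr !scalerA [d * c]mulrC addrACA.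
- by rewrite /qmul !linear0 addr0.
by rewrite /qmul !qlift_xmon linearP.
Qed.

HB.instance Definition _ u :=
  GRing.isLinear.Build F qtorus qtorus *:%R (qmul u) (qmul_linearr u).

Lemma qmul_xmon m n : qmul (xmon m) (xmon n) = q ^ (m.2 * n.1) *: xmon (m + n).
Proof. by rewrite /qmul !qlift_xmon. Qed.

Lemma qmulDl : left_distributive qmul +%R.
Proof. by move=> u v w; have := qmul_linearl w 1 u v; rewrite !scale1r. Qed.

Lemma qmulDr : right_distributive qmul +%R.
Proof. by move=> u v w; rewrite linearD. Qed.

Lemma qmul0l w : qmul 0 w = 0.
Proof. by rewrite /qmul linear0. Qed.

Lemma qmulZl c u w : c *: qmul u w = qmul (c *: u) w.
Proof. by have := qmul_linearl w c u 0; rewrite addr0 qmul0l addr0. Qed.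

Lemma qmulZr c u w : c *: qmul u w = qmul u (c *: w).
Proof. by rewrite linearZ. Qed.

Lemma qmulPl c u v w : qmul (c *: u + v) w = c *: qmul u w + qmul v w.
Proof. exact: qmul_linearl. Qed.

Lemma qmulPr c u v w : qmul u (c *: v + w) = c *: qmul u v + qmul u w.
Proof. exact: qmul_linearr. Qed.

Lemma qmul0r u : qmul u 0 = 0.
Proof. exact: linear0. Qed.

Lemma qmulA : associative qmul.
Proof.
move=> u v w; elim/qtorus_ind: u => [c u u' ihu ihu'||m].
- by rewrite (qmulPl c u u' (qmul v w)) (qmulPl c u u' v)
    (qmulPl c (qmul u v) (qmul u' v)) ihu ihu'.
- by rewrite (qmul0l (qmul v w)) (qmul0l v) (qmul0l w).
elim/qtorus_ind: v => [c v v' ihv ihv'||n].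
- by rewrite (qmulPl c v v' w) (qmulPr c (xmon m) (qmul v w))
    (qmulPr c (xmon m) v v') (qmulPl c (qmul (xmon m) v)) ihv ihv'.
- by rewrite (qmul0l w) (qmul0r (xmon m)) (qmul0l w).
elim/qtorus_ind: w => [c w w' ihw ihw'||k].
- by rewrite (qmulPr c (xmon n) w w') (qmulPr c (xmon m) (qmul (xmon n) w))
    (qmulPr c (qmul (xmon m) (xmon n)) w w') ihw ihw'.
- by rewrite (qmul0r (xmon n)) (qmul0r (xmon m)) qmul0r.
rewrite (qmul_xmon n k) (qmul_xmon m n) -(qmulZr _ (xmon m)).
rewrite -(qmulZl _ (xmon (m + n))) !qmul_xmon !scalerA addrA.
rewrite -!expfzDr ?q_neq0 //=; congr (q ^ _ *: _).
by rewrite mulrDr mulrDl addrCA; congr (_ + _); rewrite addrC.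
Qed.

Lemma qmul1l : left_id (xmon 0) qmul.
Proof.
elim/qtorus_ind=> [c u w ihu ihw||m].
- by rewrite (qmulPr c (xmon 0) u w) ihu ihw.
- exact: qmul0r.
by rewrite qmul_xmon mul0r expr0z scale1r add0r.
Qed.

Lemma qmul1r : right_id (xmon 0) qmul.
Proof.
elim/qtorus_ind=> [c u w ihu ihw||m].
- by rewrite (qmulPl c u w (xmon 0)) ihu ihw.
- exact: qmul0l.
by rewrite qmul_xmon mulr0 expr0z scale1r addr0.
Qed.

Lemma xmon0_neq0 : xmon 0 != 0.
Proof. by rewrite freegU_eq0 oner_eq0. Qed.

HB.instance Definition _ := GRing.Zmodule_isNzRing.Build qtorus
  qmulA qmul1l qmul1r qmulDl qmulDr xmon0_neq0.
HB.instance Definition _ := GRing.Lmodule_isLalgebra.Build F qtorus qmulZl.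
HB.instance Definition _ := GRing.Lalgebra_isAlgebra.Build F qtorus qmulZr.

Lemma xmonM m n : xmon m * xmon n = q ^ (m.2 * n.1) *: xmon (m + n).
Proof. exact: qmul_xmon. Qed.

Definition in_NZ2 : {pred int * int} :=
  [pred n | (N %| n.1)%Z && (N %| n.2)%Z].

Lemma exp_NZ2 (i j : int) : (N %| i)%Z -> q ^ (i * j) = 1.
Proof.
move=> /dvdzP[k ->]; rewrite mulrAC mulrC -exprz_exp.
by rewrite -exprnP (prim_expr_order hq) exp1rz.
Qed.

Lemma xmon_central n (hn : n \in in_NZ2) (u : qtorus) :
  xmon n * u = u * xmon n.
Proof.
have /andP[h1 h2] := hn.
elim/qtorus_ind: u => [c u w ihu ihw||m].
- by rewrite mulrDr mulrDl -scalerAr -scalerAl ihu ihw.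
- by rewrite mulr0 mul0r.
by rewrite !xmonM exp_NZ2 // [m.2 * _]mulrC exp_NZ2 // addrC.
Qed.

Lemma degree_subproof (f : int * int -> F) :
  (forall m n, f (m + n) = f m + f n) ->
  (fglift (fun m => f m *: xmon m) : qtorus -> qtorus)
    \in derivation (A := qtorus).
Proof.
move=> fD; apply/asboolP; split=> [|u w]; first exact: fglift_linear.
elim/qtorus_ind: u => [c u u' ihu ihu'||m].
- rewrite mulrDl !linearD /= !mulrDl -!scalerAl !linearZ /= -!scalerAl ihu ihu'.
  by rewrite scalerDr addrACA.
- by rewrite mul0r linear0 !mul0r addr0.
elim/qtorus_ind: w => [c w w' ihw ihw'||n].
- rewrite mulrDr !linearD /= !mulrDr -!scalerAr !linearZ /= -!scalerAr ihw ihw'.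
  by rewrite scalerDr addrACA.
- by rewrite mulr0 linear0 !mulr0 addr0.
rewrite xmonM linearZ /= !qlift_xmon -scalerAl -scalerAr !xmonM !scalerA.
by rewrite -scalerDl fD mulrDr [f m * _]mulrC [f n * _]mulrC.
Qed.

Lemma degree1_additive (m n : int * int) :
  (m + n).1%:~R = m.1%:~R + n.1%:~R :> F.
Proof. by rewrite -intrD. Qed.

Lemma degree2_additive (m n : int * int) :
  (m + n).2%:~R = m.2%:~R + n.2%:~R :> F.
Proof. by rewrite -intrD. Qed.

Definition partial1 : der qtorus := Der (degree_subproof degree1_additive).
Definition partial2 : der qtorus := Der (degree_subproof degree2_additive).

(* H and H^* are both identified with F * F: (a_1, a_2) stands for
   a_1 partial_1 + a_2 partial_2, and (l_1, l_2) for the functional sending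
   partial_s to l_s. *)
Definition toral (a : F * F) : der qtorus := a.1 *: partial1 + a.2 *: partial2.

Definition pairing (a l : F * F) : F := a.1 * l.1 + a.2 * l.2.

Definition int2F (m : int * int) : F * F := (m.1%:~R, m.2%:~R).

Definition scale2 (b : F) (l : F * F) : F * F := (b * l.1, b * l.2).

(* x^n partial, for n in N Z^2 and partial in H *)
Definition xtoral n (hn : n \in in_NZ2) (a : F * F) : der qtorus :=
  central_mul (xmon_central hn) (toral a).

Local Notation module := (derModule qtorus).

Definition weight_space (M : module) (l : F * F) : {pred M} :=
  [pred v | `[< forall a, dm_act (toral a) v = pairing a l *: v >]].

Definition direct_sum_decomposition (V : lmodType F) (I : choiceType)
    (S : I -> {pred V}) : Prop :=
  forall v, exists! f : {fsfun I -> V with 0},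
    (forall i, f i \in S i) /\ v = \sum_(i <- finsupp f) f i.

Definition dim_le (V : lmodType F) (n : nat) (S : {pred V}) : Prop :=
  exists e : 'I_n -> V, (forall i, e i \in S) /\
    forall v, v \in S -> exists c : 'I_n -> F, v = \sum_i c i *: e i.

Definition weight_module (M : module) : Prop :=
  direct_sum_decomposition (weight_space (M := M)) /\
  forall l, exists n, dim_le n (weight_space (M := M) l).

Definition intermediate_series (M : module) : Prop :=
  weight_module M /\ forall l, dim_le 1 (weight_space (M := M) l).

Definition is_basis (V : lmodType F) (I : choiceType) (v : I -> V) : Prop :=
  forall w, exists! c : {fsfun I -> F with 0},
    w = \sum_(i <- finsupp c) c i *: v i.

(* "M is A_{a,alpha,b}", with basis v: these formulas determine the action,
   because the ad x^m and the x^n partial span the derivations of qtorus. *)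
Definition is_A (a : bool) (alpha : F * F) (b : F)
    (M : module) (v : int * int -> M) : Prop :=
  [/\ is_basis v,
      forall m k, m \notin in_NZ2 ->
        dm_act (ad (xmon m)) (v k) =
          (q ^ (m.2 * k.1) - a%:R * q ^ (m.1 * k.2)) *: v (m + k) &
      forall n (hn : n \in in_NZ2) k d,
        dm_act (xtoral hn d) (v k) =
          pairing d (alpha + int2F k + scale2 b (int2F n)) *: v (n + k)].

End QuantumTorus.

Definition isomorphic_to_subquotient (F : fieldType) (A : algType F)
    (V M : derModule A) : Prop :=
  exists (U : submodule M) (W : submodule (subModule U)),
    isomorphic V (quotientModule W).

(* Main.v *)
Require Import Defs.
From HB Require Import structures.
From mathcomp Require Import all_boot all_order all_algebra.
From mathcomp Require Import finmap.
From mathcomp Require Import boolp reals complex freeg.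
From mathcomp Require Import zify ring.

(** Let q = -1. Call a vector of Z^2 even if both its coordinates are. The
   weights of V lie in one coset lam + Z^2; with a vector v_k for the weight
   lam + k, the homogeneous derivations x^n d_s (n even) and ad x^m (m not even)
   act by scalars f_s(n, k) and g(m, k), subject to the bracket relations. These
   derivations span Der C_q: the logarithmic derivatives D(x_1) x_1^-1 and
   D(x_2) x_2^-1 determine D, and they split degree by degree into an inner and
   a central part (der_decomposition). So it is enough to find scalars rescaling
   the v_k which turn f and g into the coefficients of some A_{a,alpha,b}, on
   the set of indices k where v_k does not vanish (qrep_classification).

   The even part. The k in one class modulo 2 carry a module over the vector
   fields x^n d_s on a torus. On a row, that is for n = (i, 0), the operators
   x^n d_1 and x^n d_2 span the Witt algebra and its functions, and where d_2
   acts by a nonzero scalar the functions act invertibly and can be normalised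
   to constants; then x^n d_1 has to act as on densities of some weight b
   (row_lemma). Operators from one row to another commute suitably with these,
   which leaves so few of them that comparing rows with columns gives the same b
   everywhere, and x^n d_s acts on v_k as the s-th coordinate of lam + k + b n,
   away from the weight 0 (ws_normal_form).

   The odd part. The bracket of x^n d_s with ad x^m, solved for g by Cramer's
   rule, shows that b stays or grows by one along a nonzero g(m, k)
   (edge_weights). Irreducibility strongly connects the classes modulo 2
   (cosets_connected), so that b is the same on all of them, and then g(m, k)
   depends on the classes of m and k only (structure_constants).

   A finite problem. These numbers define a module over sl_2, spanned by
   the three classes that are not even, and graded by the Klein four-group with components of
   dimension at most one. The Casimir element and the squares of the three
   basis elements leave the trivial module, the adjoint module and the
   2 x 2 matrices under left multiplication (klein_classification). The first
   two occur in A_{1,alpha,b}, the third is A_{0,alpha,b}.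

   The weight 0. A product of two homogeneous operators passing through the
   vector of weight 0 is known up to a product which avoids it, because their
   commutator is homogeneous. Thus either that vector can be rescaled as well
   (zero_gauge), or it is absent from V although A_{a,alpha,b} contains it; all
   these products then vanish, which forces b to be 0 or 1 and V to be the
   functions modulo constants or the densities of total mass zero, with
   indices in a single class modulo 2. *)

Set Implicit Arguments.
Unset Strict Implicit.
Unset Printing Implicit Defensive.

Import GRing.Theory Num.Theory.
Local Open Scope ring_scope.

(** * Linear consequences of equations *)

Section LinearCombinations.
Variable F : fieldType.
Implicit Types a b c d l r : F.

(** The multipliers c certify that the equations imply a = b; the last
   hypothesis is a polynomial identity. *)
Lemma lincomb d c a b l r :
  l = r -> d != 0 -> d * (a - b) = c * (l - r) -> a = b.
Proof.
move=> -> d0 /eqP; rewrite subrr mulr0 mulf_eq0 (negPf d0) subr_eq0.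
by move/eqP.
Qed.

Lemma lincomb1 c a b l r : l = r -> a - b = c * (l - r) -> a = b.
Proof. by move=> E H; apply: (lincomb (d := 1) (c := c) E (oner_neq0 _)); rewrite mul1r. Qed.

Lemma lincomb2 c c' a b l r l' r' :
  l = r -> l' = r' -> a - b = c * (l - r) + c' * (l' - r') -> a = b.
Proof. by move=> -> -> /eqP; rewrite !subrr !mulr0 addr0 subr_eq0 => /eqP. Qed.

Lemma lincomb3 c c' c'' a b l r l' r' l'' r'' :
  l = r -> l' = r' -> l'' = r'' ->
  a - b = c * (l - r) + c' * (l' - r') + c'' * (l'' - r'') -> a = b.
Proof.
by move=> -> -> -> /eqP; rewrite !subrr !mulr0 !addr0 subr_eq0 => /eqP.
Qed.

Lemma lincomb4 c1 c2 c3 c4 a b l1 r1 l2 r2 l3 r3 l4 r4 :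
  l1 = r1 -> l2 = r2 -> l3 = r3 -> l4 = r4 ->
  a - b = c1 * (l1 - r1) + c2 * (l2 - r2) + c3 * (l3 - r3) + c4 * (l4 - r4) ->
  a = b.
Proof.
by move=> -> -> -> -> /eqP; rewrite !subrr !mulr0 !addr0 subr_eq0 => /eqP.
Qed.

End LinearCombinations.

(** * The Witt algebra and its functions on a row *)

Section Rows.
Variable F : numFieldType.
Implicit Types (e h : int -> int -> F).

Lemma int_step_affine (g : int -> F) (c : F) :
  (forall k, g (k + 1) = g k + c) -> forall k, g k = g 0 + c * k%:~R.
Proof.
move=> gS; elim/int_ind => [|n ih|n ih]; first by rewrite mulr0 addr0.
  by rewrite -addn1 PoszD gS ih intrD mulrDr mulr1 addrA.
have := gS (- n.+1%:Z); rewrite -addn1 PoszD opprD subrK ih => /eqP.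
by rewrite -subr_eq => /eqP <-; rewrite intrD mulrDr mulrN1 addrA.
Qed.

(** In applications e_i and h_i are x^(i,0) d_1 and x^(i,0) d_2 on a row of
   weight vectors. Commutation with h_1 = mu makes each h_j constant, and [e_i,
   h_1] = h_(i+1) makes e_i affine in k; the bracket [e_i, h_j] then reads h_j
   h_(i+1) = mu h_(i+j), so that h = mu. The remaining function f satisfies j
   f_j - i f_i = (j - i) f_(i+j), hence is linear. *)
Lemma row_normal_form e h (lam mu : F) :
  mu != 0 ->
  (forall i j k, h i (k + j) * h j k = h j (k + i) * h i k) ->
  (forall i j k, e i (k + j) * h j k - h j (k + i) * e i k
     = j%:~R * h (i + j) k) ->
  (forall i j k, e i (k + j) * e j k - e j (k + i) * e i k
     = (j - i)%:~R * e (i + j) k) ->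
  (forall k, h 0 k = mu) -> (forall k, e 0 k = lam + k%:~R) ->
  (forall k, h 1 k = mu) ->
  exists b, forall i k, h i k = mu /\ e i k = lam + k%:~R + b * i%:~R.
Proof.
move=> mu0 hh eh ee h0 e0 h1.
have hk j k : h j k = h j 0.
  rewrite (int_step_affine (c := 0) (g := h j)) ?mul0r ?addr0 // => l.
  by rewrite addr0; apply: (mulIf mu0); rewrite -{1}(h1 l) (hh j 1) h1 mulrC.
have ek i k : e i k = e i 0 + h (i + 1) 0 / mu * k%:~R.
  apply: int_step_affine => l; apply: (mulIf mu0).
  have := eh i 1 l; rewrite !h1 mul1r (hk (i + 1)) => <-.
  by field.
have hM i j : j != 0 -> h j 0 * h (i + 1) 0 = mu * h (i + j) 0.
  move=> j0; have jF : j%:~R != 0 :> F by rewrite intr_eq0.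
  apply: (mulfI jF); apply: (mulIf (invr_neq0 mu0)).
  have := eh i j 0; rewrite !add0r (hk j i) (ek i j) => E.
  have -> : j%:~R * (mu * h (i + j) 0) / mu = j%:~R * h (i + j) 0 by field.
  by rewrite -E; field.
have h2 : h 2 0 = mu.
  by apply: (mulIf mu0); have := hM (-1) 2 isT; rewrite h0 h1.
have hmu i k : h i k = mu.
  rewrite hk (int_step_affine (g := h^~ 0) (c := 0)) ?mul0r ?addr0 // => l.
  rewrite addr0; have hS l' : h (l' + 2) 0 = h (l' + 1) 0.
    by apply: (mulfI mu0); rewrite -hM // h2.
  by have := hS (l - 1); rewrite subrK => <-; congr h; ring.
have {}ek i k : e i k = e i 0 + k%:~R by rewrite ek hmu divff // mul1r.
pose f i := e i 0 - lam.
have f0 : f 0 = 0 by rewrite /f e0 addr0 subrr.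
have eq i j : j%:~R * f j - i%:~R * f i = (j - i)%:~R * f (i + j).
  have := ee i j 0; rewrite !add0r (ek i j) (ek j i) /f => E.
  by apply: (lincomb1 (c := 1) E); ring.
have fN i : f (- i) = - f i.
  have [->|i0] := eqVneq i 0; first by rewrite oppr0 f0 oppr0.
  apply: (mulfI (_ : i%:~R != 0)); first by rewrite intr_eq0.
  have := eq (- i) i; rewrite addNr f0 mulr0 => E.
  by apply: (lincomb1 (c := 1) E); ring.
have f2 : f 2 = 2 * f 1.
  have := eq 1 2; have := eq (-1) 3; rewrite fN.
  rewrite -[- 1 + 3]/(2 : int) -[1 + 2]/(3 : int) => E1 E2.
  apply: (mulfI (_ : 2 != 0)); first by rewrite pnatr_eq0.
  by apply: (lincomb2 (c := 1) (c' := 3) E1 E2); ring.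
have fn (n : nat) : f n.+1 = n.+1%:R * f 1.
  elim: n => [|[|n] ih]; rewrite ?mul1r //.
  have := eq 1 n.+2; rewrite ih => E.
  apply: (mulfI (_ : (n.+1)%:R != 0)); first by rewrite pnatr_eq0.
  have E3 : f (1 + n.+2) = f n.+3 by congr f; lia.
  have N1 : (n.+2%:Z - 1)%:~R = n.+1%:R :> F by rewrite -[n.+2]addn1 PoszD addrK.
  rewrite E3 N1 -[(Posz n.+2)%:~R]/(n.+2%:R) -[1%:~R]/(1 : F) mul1r in E.
  rewrite -E -[n.+3]addn1 -[n.+2]addn1 !natrD; move: (n.+1%:R : F) (f 1) => x y.
  ring.
exists (f 1) => i k; split=> //.
rewrite ek -[e i 0](subrK lam) -/(f i).
suff -> : f i = f 1 * i%:~R by ring.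
clearbody f; clear -fn fN f0; case: i => [[|n]|n].
- by rewrite f0 mulr0.
- by rewrite fn mulrC.
- by rewrite NegzE fN fn intrN mulrN mulrC.
Qed.

Lemma int_cocycle (c : int -> F) : (forall k, c k != 0) ->
  exists s : int -> F, (forall k, s k != 0) /\ forall k, s (k + 1) = c k * s k.
Proof.
move=> c0.
pose s (k : int) := match k with
  | Posz n => \prod_(i < n) c i%:Z
  | Negz n => (\prod_(i < n.+1) c (Negz i))^-1 end.
exists s; split=> [[n|n]|[n|[|n]]].
- by apply/prodf_neq0.
- by rewrite invr_eq0; apply/prodf_neq0.
- by rewrite /= addn1 big_ord_recr mulrC.
- by rewrite (_ : Negz 0 + 1 = Posz 0) //= big_ord0 big_ord1 divff.
have -> : Negz n.+1 + 1 = Negz n by rewrite !NegzE; lia.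
by rewrite /= [in RHS]big_ord_recr /= invfM mulrCA divff ?mulr1.
Qed.

(** The product h_1 h_-1 is constant along the row, and the brackets with e_1
   and e_-1 do not let it vanish since mu != 0. *)
Lemma row_full (p : pred int) e h (mu : F) k0 :
  mu != 0 ->
  (forall i j k, h i (k + j) * h j k = h j (k + i) * h i k) ->
  (forall i j k, e i (k + j) * h j k - h j (k + i) * e i k
     = j%:~R * h (i + j) k) ->
  (forall k, p k -> h 0 k = mu) ->
  (forall i k, ~~ (p k && p (k + i)) -> h i k = 0) ->
  p k0 -> forall k, h 1 k != 0.
Proof.
move=> mu0 hh eh h0 hS pk0.
have h1p k : h 1 k * h 0 k = mu * h 1 k.
  have [pk|npk] := boolP (p k); first by rewrite h0 // mulrC.
  by rewrite hS ?mulr0 ?mul0r // negb_and npk.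
have h1p' k : h 0 (k + 1) * h 1 k = mu * h 1 k.
  have [pk|npk] := boolP (p (k + 1)); first by rewrite h0.
  by rewrite (hS 1 k) ?mulr0 // negb_and npk orbT.
pose t k := h (-1) (k + 1) * h 1 k.
have tE k : h 1 (k - 1) * h (-1) k = t k by rewrite hh.
have tS k : t (k + 1) = t k by rewrite -tE addrK mulrC.
have tC k : t k = t 0.
  by rewrite (int_step_affine (c := 0) (g := t)) ?mul0r ?addr0 // => l;
     rewrite addr0.
have [t0|t0] := eqVneq (t 0) 0; last first.
  by move=> k; apply: contra_neq t0 => hk; rewrite -(tC k) /t hk mulr0.
(* the bracket of h_1 h_-1 = 0 with e_1 gives h_2 h_-1 = mu h_1; multiplied by
   h_1, it gives h_1 h_1 = 0, which e_-1 turns into 2 mu h_1 = 0; finally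
   [e_-1, h_1] = mu is absurd *)
have B1 k : h 2 (k - 1) * h (-1) k = mu * h 1 k.
  have E1 := eh 1 1 (k - 1); have E2 := eh 1 (-1) k.
  rewrite subrK in E1; rewrite addrN in E2; rewrite -[1 + 1]/(2 : int) in E1.
  have T1 : h 1 (k - 1) * h (-1) k = 0 by rewrite tE tC.
  have T2 : h 1 k * h (-1) (k + 1) = 0 by rewrite mulrC -/(t k) tC.
  have P := h1p k.
  rewrite -P; apply: (lincomb4 (c1 := - h (-1) k) (c2 := - h 1 k)
    (c3 := e 1 k) (c4 := - e 1 k) E1 E2 T1 T2).
  ring.
have B2 k : h 1 k * h 1 (k - 1) = 0.
  apply: (mulfI mu0); rewrite mulr0 mulrA -B1 -mulrA [_ * h 1 _]mulrC tE tC t0.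
  by rewrite mulr0.
have h1z k : h 1 k = 0.
  have E1 := eh (-1) 1 (k + 1); have E2 := eh (-1) 1 k.
  rewrite ?addrK -[-1 + 1]/(0 : int) in E1 E2.
  have T1 := B2 (k + 1); rewrite addrK in T1.
  have T2 := B2 k.
  have T3 : h 1 k * h 0 k + h 0 (k + 1) * h 1 k = 0.
    apply: (lincomb4 (c1 := - h 1 k) (c2 := - h 1 k) (c3 := e (-1) (k + 1 + 1))
      (c4 := - e (-1) k) E1 E2 T1 T2).
    ring.
  move/eqP: T3; rewrite h1p h1p' -mulr2n mulrn_eq0 mulf_eq0 (negPf mu0) /=.
  by move/eqP.
have := eh (-1) 1 k0; rewrite !h1z mulr0 mul0r subrr -[-1 + 1]/(0 : int) h0 //.
by move/eqP; rewrite mul1r eq_sym (negPf mu0).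
Qed.

(** Since h_1 vanishes nowhere, rescaling the basis along the row turns it into
   the constant mu. *)
Lemma row_lemma (p : pred int) e h (lam mu : F) k0 :
  mu != 0 ->
  (forall i j k, h i (k + j) * h j k = h j (k + i) * h i k) ->
  (forall i j k, e i (k + j) * h j k - h j (k + i) * e i k
     = j%:~R * h (i + j) k) ->
  (forall i j k, e i (k + j) * e j k - e j (k + i) * e i k
     = (j - i)%:~R * e (i + j) k) ->
  (forall k, p k -> h 0 k = mu) -> (forall k, p k -> e 0 k = lam + k%:~R) ->
  (forall i k, ~~ (p k && p (k + i)) -> h i k = 0) ->
  p k0 ->
  (forall k, p k) /\
  exists (b : F) (s : int -> F), (forall k, s k != 0) /\ forall i k,
    h i k * s k = mu * s (k + i) /\
    e i k * s k = (lam + k%:~R + b * i%:~R) * s (k + i).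
Proof.
move=> mu0 hh eh ee h0 e0 hS pk0.
have h1 := row_full mu0 hh eh h0 hS pk0.
have pT k : p k by move: (h1 k); apply: contraR => npk; rewrite hS ?negb_and ?npk.
split=> //.
have [s [s0 sS]] := @int_cocycle (fun k => h 1 k / mu)
  (fun k => mulf_neq0 (h1 k) (invr_neq0 mu0)).
pose h' i k := h i k * s k / s (k + i).
pose e' i k := e i k * s k / s (k + i).
have [||||||b bE] := @row_normal_form e' h' lam mu mu0.
- move=> i j k; rewrite /h' -!addrA [i + j]addrC.
  have E := hh i j k; apply: (lincomb1 (c := s k / s (k + (j + i))) E).
  by field; rewrite !s0.
- move=> i j k; rewrite /h' /e' -!addrA [j + i]addrC.
  have E := eh i j k; apply: (lincomb1 (c := s k / s (k + (i + j))) E).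
  by field; rewrite !s0.
- move=> i j k; rewrite /h' /e' -!addrA [j + i]addrC.
  have E := ee i j k; apply: (lincomb1 (c := s k / s (k + (i + j))) E).
  by field; rewrite !s0.
- by move=> k; rewrite /h' addr0 mulfK // h0.
- by move=> k; rewrite /e' addr0 mulfK // e0.
- by move=> k; rewrite /h' sS; field; rewrite mu0 s0 h1.
exists b, s; split=> // i k; have [<- <-] := bE i k.
by rewrite /h' /e' !divfK.
Qed.

End Rows.

(** * Graded modules over the vector fields on a torus *)

Notation Z2 := (int * int)%type.

Definition crd (s : bool) (k : Z2) : int := if s then k.2 else k.1.

Lemma addpE (a b c d : int) : (a, b) + (c, d) = (a + c, b + d) :> Z2.
Proof. by []. Qed.

Ltac idx := rewrite ?addpE /=; congr (_, _); lia.

Section WSystems.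
Variable F : numFieldType.
Implicit Types (P : pred Z2) (f : bool -> Z2 -> Z2 -> F) (lam : bool -> F).
Implicit Types (S : Z2 -> F).

Definition wt lam (s : bool) (k : Z2) : F := lam s + (crd s k)%:~R.

Definition wnz lam (k : Z2) := (wt lam false k != 0) || (wt lam true k != 0).

(** Structure constants of x^n d_s on a Z^2-graded module whose component of
   degree k is spanned by one vector, nonzero exactly when P k. *)
Record wsys P f lam : Prop := WSys {
  ws_rel : forall s t n n' k,
    f s n (k + n') * f t n' k - f t n' (k + n) * f s n k
    = (crd s n')%:~R * f t (n + n') k - (crd t n)%:~R * f s (n + n') k;
  ws_deg : forall s k, P k -> f s 0 k = wt lam s k;
  ws_supp : forall s n k, ~~ (P k && P (k + n)) -> f s n k = 0 }.

Lemma ws_relE P f lam s t n n' k k1 k2 m : wsys P f lam ->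
  k1 = k + n' -> k2 = k + n -> m = n + n' ->
  f s n k1 * f t n' k - f t n' k2 * f s n k
    = (crd s n')%:~R * f t m k - (crd t n)%:~R * f s m k.
Proof. by move=> H -> -> ->; apply: (ws_rel H). Qed.

(** Structure constants after the rescaling of each basis vector v_k to S k *:
   v_k. *)
Definition wgauge f S s n k : F := f s n k * S k / S (k + n).

Lemma wsys_gauge P f lam S : (forall k, S k != 0) ->
  wsys P f lam -> wsys P (wgauge f S) lam.
Proof.
move=> S0 [hr hd hs]; split=> [s t n n' k|s k Pk|s n k nP].
- have E := hr s t n n' k; rewrite /wgauge -!addrA [n' + n]addrC.
  by apply: (lincomb1 (c := S k / S (k + (n + n'))) E); field; rewrite !S0.
- by rewrite /wgauge addr0 mulfK // hd.
- by rewrite /wgauge hs // !mul0r.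
Qed.

Lemma wgauge_comp f S S' s n k :
  wgauge (wgauge f S) S' s n k = wgauge f (fun k => S k * S' k) s n k.
Proof. by rewrite /wgauge invfM; ring. Qed.

Definition swp (k : Z2) : Z2 := (k.2, k.1).

Lemma wsys_swap P f lam : wsys P f lam ->
  wsys (fun k => P (swp k)) (fun s n k => f (~~ s) (swp n) (swp k))
    (fun s => lam (~~ s)).
Proof.
move=> [hr hd hs]; split=> [s t n n' k|s k Pk|s n k nP].
- have := hr (~~ s) (~~ t) (swp n) (swp n') (swp k).
  by case: s; case: t.
- by rewrite -[swp 0]/(0 : Z2) hd // /wt; case: (s).
- by rewrite hs.
Qed.

(** On a row where d_2 acts by a nonzero scalar, x^(i,0) d_1 and x^(j,0) d_2
   satisfy the hypotheses of row_lemma. *)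
Lemma ws_row P f lam x r : wsys P f lam -> lam true + r%:~R != 0 -> P (x, r) ->
  (forall k, P (k, r)) /\
  exists (b : F) (s : int -> F), (forall k, s k != 0) /\ forall i k,
    f true (i, 0) (k, r) * s k = (lam true + r%:~R) * s (k + i) /\
    f false (i, 0) (k, r) * s k = (lam false + k%:~R + b * i%:~R) * s (k + i).
Proof.
move=> H y0 Px.
have [|||||||] := @row_lemma F (fun k => P (k, r)) (fun i k => f false (i, 0) (k, r))
  (fun i k => f true (i, 0) (k, r)) (lam false) (lam true + r%:~R) x y0.
- move=> i j k; have := @ws_relE P f lam true true (i, 0) (j, 0) (k, r)
   (k + j, r) (k + i, r) (i + j, 0) H.
  rewrite /= !mul0r subrr => E; apply/eqP; rewrite -subr_eq0; apply/eqP.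
  by apply: E; idx.
- move=> i j k; have := @ws_relE P f lam false true (i, 0) (j, 0) (k, r)
   (k + j, r) (k + i, r) (i + j, 0) H.
  by rewrite /= mul0r subr0; apply; idx.
- move=> i j k; have := @ws_relE P f lam false false (i, 0) (j, 0) (k, r)
   (k + j, r) (k + i, r) (i + j, 0) H.
  by rewrite /= intrB mulrBl; apply; idx.
- by move=> k Pk; rewrite (ws_deg H).
- by move=> k Pk; rewrite (ws_deg H).
- move=> i k nP; apply: (ws_supp H); rewrite addpE addr0 //.
- exact: Px.
- by move=> ? [b [s ?]]; split=> //; exists b, s.
Qed.

Lemma ws_col P f lam x r : wsys P f lam -> lam false + x%:~R != 0 -> P (x, r) ->
  (forall k, P (x, k)) /\
  exists (b : F) (s : int -> F), (forall k, s k != 0) /\ forall i k,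
    f false (0, i) (x, k) * s k = (lam false + x%:~R) * s (k + i) /\
    f true (0, i) (x, k) * s k = (lam true + k%:~R + b * i%:~R) * s (k + i).
Proof.
by move=> H y0 Px; have := ws_row (x := r) (r := x) (wsys_swap H) y0 Px.
Qed.

Lemma int_avoid (xs : seq F) : exists t : int, t%:~R \notin xs.
Proof.
have [ts|] := boolP [exists t : 'I_(size xs).+1, (t%:R : F) \notin xs].
  by have /existsP[t tP] := ts; exists t%:Z.
rewrite negb_exists => /forallP allx.
have : uniq [seq ((val t)%:R : F) | t : 'I_(size xs).+1].
  by rewrite map_inj_uniq ?enum_uniq // => i j /(mulrIn (oner_neq0 _)) /val_inj.
move/uniq_leq_size => /(_ xs) H.
have : (size [seq ((val t)%:R : F) | t : 'I_(size xs).+1] <= size xs)%N.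
  by apply: H => y /mapP[t _ ->]; have := allx t; rewrite negbK.
by rewrite size_map -cardE card_ord ltnn.
Qed.

(** Two nonzero weights are joined by rows on which d_2 is not zero and columns
   on which d_1 is not zero, through a point where neither vanishes. *)
Lemma ws_full P f lam k0 : wsys P f lam -> P k0 -> wnz lam k0 ->
  forall k, wnz lam k -> P k.
Proof.
move=> H; case: k0 => x0 y0 P0 nz0.
have row x r : lam true + r%:~R != 0 -> P (x, r) -> forall k, P (k, r).
  by move=> h p; have [] := ws_row H h p.
have col x r : lam false + x%:~R != 0 -> P (x, r) -> forall k, P (x, k).
  by move=> h p; have [] := ws_col H h p.
have [x1] := int_avoid [:: - lam false]; rewrite inE => x1n.
have [y1] := int_avoid [:: - lam true]; rewrite inE => y1n.
have gx1 : lam false + x1%:~R != 0 by rewrite addrC addr_eq0.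
have gy1 : lam true + y1%:~R != 0 by rewrite addrC addr_eq0.
have P11 : P (x1, y1).
  case/orP: nz0 => h; first by apply: (row x0) => //; apply: (col _ y0).
  by apply: (col _ y0) => //; apply: (row x0).
case=> x y /orP[] h; first by apply: (col _ y1) => //; apply: (row x1).
by apply: (row x1) => //; apply: (col _ y1).
Qed.

(** Commutation with the functions expresses kap through its values at i = 0,
   and makes those affine: second differences vanish because y (y + l) != 0. *)
Lemma affine_transfer (kap : int -> int -> F) (lam l y : F) :
  l != 0 -> y != 0 -> y + l != 0 ->
  (forall i j k, l * kap (i + j) k = (y + l) * kap i k - y * kap i (k + j)) ->
  exists g0 g1, forall i k,
    kap i k = g0 + g1 * (l * (lam + k%:~R) - y * i%:~R).
Proof.
move=> l0 y0 yl0 E.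
have k1 j k : l * kap j k = (y + l) * kap 0 k - y * kap 0 (k + j).
  by rewrite -E add0r.
have d2 k : kap 0 (k + 1) = kap 0 k + (kap 0 1 - kap 0 0).
  have E0 := E k 1 0; have E1 := k1 (k + 1) 0; have E2 := k1 k 0.
  have E3 := k1 k 1.
  rewrite !add0r in E0 E1 E2 E3.
  rewrite [1 + k]addrC in E3.
  apply: (mulfI (mulf_neq0 y0 yl0)).
  apply: (lincomb4 (c1 := - l) (c2 := l) (c3 := - (y + l)) (c4 := y)
    E0 E1 E2 E3).
  ring.
have g k : kap 0 k = kap 0 0 + (kap 0 1 - kap 0 0) * k%:~R.
  exact: int_step_affine.
exists (kap 0 0 - (kap 0 1 - kap 0 0) * lam), ((kap 0 1 - kap 0 0) / l) => i k.
by apply: (mulfI l0); rewrite k1 g (g (k + i)) intrD; field.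
Qed.

(** Commutation with the Witt algebra leaves the constant solution g0, which
   requires equal densities b = b', and the first order solution g1, which
   exists only from b = 0 to b' = 1, like the exterior derivative. *)
Lemma transfer_weights (kap : int -> int -> F) (lam l y b b' g0 g1 : F) :
  l != 0 ->
  (forall i k, kap i k = g0 + g1 * (l * (lam + k%:~R) - y * i%:~R)) ->
  (forall i j k,
     (lam + (k + i)%:~R + b' * j%:~R) * kap i k
     - (lam + k%:~R + b * j%:~R) * kap i (k + j) = i%:~R * kap (i + j) k) ->
  [/\ b * g1 = 0, (b' - b - 1) * g1 = 0 & (b' - b) * g0 = 0].
Proof.
move=> l0 K E.
have E1 := E 0 1 0; have E2 := E 0 2 0; have E3 := E 0 1 1.
rewrite !K in E1 E2 E3.
have bg : b * g1 = 0.
  apply: (mulfI (_ : 2 * l != 0)); first by rewrite mulf_neq0 ?pnatr_eq0.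
  by apply: (lincomb2 (c := 2) (c' := -1) E1 E2); ring.
have bg' : (b' - b - 1) * g1 = 0.
  by apply: (mulfI l0); apply: (lincomb2 (c := 1) (c' := -1) E3 E1); ring.
split=> //; apply: (lincomb3 (c := 1) (c' := - l * lam) (c'' := l) E1 bg' bg).
ring.
Qed.

End WSystems.

(** * Transfer between rows *)

Section WGluing.
Variable F : numFieldType.
Implicit Types (P : pred Z2) (f : bool -> Z2 -> Z2 -> F) (lam : bool -> F).
Implicit Types (S : Z2 -> F).

(** Here kap and phi are the coefficients of x^(i,l) d_2 and x^(i,l) d_1 from
   the row where d_2 acts by y. Apart from the exceptional first order operator,
   kap is constant; then l phi - i kap satisfies the equation of kap, hence is
   affine. *)
Lemma pair_types (kap phi : int -> int -> F) (lam l y b b' : F) :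
  l != 0 -> y != 0 -> y + l != 0 ->
  (forall i j k, l * kap (i + j) k = (y + l) * kap i k - y * kap i (k + j)) ->
  (forall i j k,
     (lam + (k + i)%:~R + b' * j%:~R) * kap i k
     - (lam + k%:~R + b * j%:~R) * kap i (k + j) = i%:~R * kap (i + j) k) ->
  (forall i j k, l * phi (i + j) k - j%:~R * kap (i + j) k
     = (y + l) * phi i k - y * phi i (k + j)) ->
  (forall i j k,
     (lam + (k + i)%:~R + b' * j%:~R) * phi i k
     - (lam + k%:~R + b * j%:~R) * phi i (k + j) = (i - j)%:~R * phi (i + j) k) ->
  b = 0 /\ b' = 1 \/ exists p0 p1, [/\ forall i k, kap i k = p1 * (y + b * l),
    forall i k, phi i k = p0 + p1 * (lam + k%:~R + b * i%:~R),
    (b' - b) * p1 = 0 & (b' - b + 1) * p0 = 0].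
Proof.
move=> l0 y0 yl0 T1 T2 T3 T4.
have [g0 [g1 K]] := affine_transfer lam l0 y0 yl0 T1.
have [W1 W2 W3] := transfer_weights l0 K T2.
have [g10|g10] := eqVneq g1 0; last first.
  left; move/eqP: W1; rewrite mulf_eq0 (negPf g10) orbF => /eqP b0.
  move/eqP: W2; rewrite mulf_eq0 (negPf g10) orbF b0 subr0 subr_eq0 => /eqP ->.
  by [].
right; have {}K i k : kap i k = g0 by rewrite K g10 mul0r addr0.
(* subtracting i g0 / l turns the equation for phi into the one for kap *)
pose psi i k := l * phi i k - i%:~R * g0.
have [i j k|q0 [q1 Q]] := @affine_transfer _ psi lam l y l0 y0 yl0.
  by have := T3 i j k; rewrite /psi !K => E; apply: (lincomb1 (c := l) E); ring.
pose p0 := q0 / l; pose p2 := (g0 - y * q1) / l.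
have PE i k : phi i k = p0 + q1 * (lam + k%:~R) + p2 * i%:~R.
  apply: (mulfI l0); have := Q i k; rewrite /psi /p0 /p2 => E.
  by apply: (lincomb1 (c := 1) E); field.
have E1 := T4 0 1 0; have E2 := T4 0 2 0; have E3 := T4 0 1 1.
rewrite !PE in E1 E2 E3.
have p2E : p2 = b * q1.
  apply: (mulfI (_ : 2 != 0)); first by rewrite pnatr_eq0.
  by apply: (lincomb2 (c := -2) (c' := 1) E1 E2); ring.
have bb : (b' - b) * q1 = 0.
  by apply: (lincomb2 (c := 1) (c' := -1) E3 E1); ring.
exists p0, q1; split=> //.
- move=> i k; rewrite K; have : p2 * l = g0 - y * q1 by rewrite divfK.
  by rewrite p2E => E; apply: (lincomb1 (c := -1) E); ring.
- by move=> i k; rewrite PE p2E; ring.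
- by apply: (lincomb3 (c := 1) (c' := - lam) (c'' := -1) E1 bb p2E); ring.
Qed.

Definition rownormal f lam (b : int -> F) := forall r i k,
  lam true + r%:~R != 0 ->
  f true (i, 0) (k, r) = lam true + r%:~R /\
  f false (i, 0) (k, r) = lam false + k%:~R + b r * i%:~R.

(** The content of rownormal which does not depend on the rescaling of the
   basis. *)
Definition rowspec f lam (b : int -> F) := forall r i k,
  lam true + r%:~R != 0 ->
  f true (i, 0) (k, r) != 0 /\
  f false (i, 0) (k, r) * (lam true + r%:~R)
    = (lam false + k%:~R + b r * i%:~R) * f true (i, 0) (k, r).

Definition fsw f s n k : F := f (~~ s) (swp n) (swp k).
Definition lsw lam s : F := lam (~~ s).
Definition colspec f lam c := rowspec (fsw f) (lsw lam) c.

Lemma rowspec_gauge f lam b S : (forall k, S k != 0) ->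
  rowspec f lam b -> rowspec (wgauge f S) lam b.
Proof.
move=> S0 H r i k y0; have [h0 E] := H r i k y0; rewrite /wgauge; split.
  by rewrite !mulf_neq0 ?invr_eq0.
by rewrite mulrAC [f false _ _ * _ * _]mulrAC E !mulrA.
Qed.

Lemma colspec_gauge f lam b S : (forall k, S k != 0) ->
  colspec f lam b -> colspec (wgauge f S) lam b.
Proof.
by move=> S0; apply: (@rowspec_gauge (fsw f) (lsw lam) b (fun k => S (swp k))).
Qed.

Lemma rownormal_spec f lam b : rownormal f lam b -> rowspec f lam b.
Proof. by move=> H r i k y0; have [-> ->] := H r i k y0; rewrite y0. Qed.

Lemma ws_rownormal P f lam k0 : wsys P f lam -> P k0 -> wnz lam k0 ->
  exists b S, (forall k, S k != 0) /\ rownormal (wgauge f S) lam b.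
Proof.
move=> H P0 nz0; have full := ws_full H P0 nz0.
have row r : exists bs : F * (int -> F), (forall k, bs.2 k != 0) /\
  (lam true + r%:~R != 0 -> forall i k,
    f true (i, 0) (k, r) * bs.2 k = (lam true + r%:~R) * bs.2 (k + i) /\
    f false (i, 0) (k, r) * bs.2 k
      = (lam false + k%:~R + bs.1 * i%:~R) * bs.2 (k + i)).
  have [y0|y0] := eqVneq (lam true + r%:~R) 0.
    by exists (0, fun=> 1); split=> // k; apply: oner_neq0.
  have Pr : P (0, r) by apply: full; rewrite /wnz /wt /= y0 orbT.
  by have [_ [b [s [s0 E]]]] := ws_row H y0 Pr; exists (b, s).
have [bs bsP] := choice row.
exists (fun r => (bs r).1), (fun k => (bs k.2).2 k.1); split=> [k|r i k y0].
  by have [] := bsP k.2.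
have [s0 /(_ y0 i k)[E1 E2]] := bsP r.
by rewrite /wgauge /= addr0 E1 E2 !mulfK.
Qed.

(** The brackets with x^(j,0) d_1 and x^(j,0) d_2 are the four hypotheses of
   pair_types. *)
Lemma pair_transfer P f lam b r r' : wsys P f lam -> rownormal f lam b ->
  lam true + r%:~R != 0 -> lam true + r'%:~R != 0 -> r != r' ->
  let l : int := r' - r in let y := lam true + r%:~R in
  b r = 0 /\ b r' = 1 \/ exists p0 p1,
    [/\ forall i k, f true (i, l) (k, r) = p1 * (y + b r * l%:~R),
    forall i k, f false (i, l) (k, r)
      = p0 + p1 * (lam false + k%:~R + b r * i%:~R),
    (b r' - b r) * p1 = 0 & (b r' - b r + 1) * p0 = 0].
Proof.
move=> H R y0 y0' rr' l y.
have r'E : r' = r + l by rewrite /l addrC subrK.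
have yl : y + l%:~R = lam true + r'%:~R by rewrite r'E intrD addrA.
have l0 : l%:~R != 0 :> F by rewrite intr_eq0 subr_eq0 eq_sym.
apply: (pair_types (kap := fun i k => f true (i, l) (k, r))
   (phi := fun i k => f false (i, l) (k, r))) => //; rewrite ?yl //= => i j k.
- have := @ws_relE F P f lam true true (j, 0) (i, l) (k, r)
    (k + i, r') (k + j, r) (i + j, l) H.
  have [-> _] := R r j k y0; have [-> _] := R r' j (k + i) y0'.
  rewrite /= mul0r subr0 => <- //; rewrite ?r'E; [|idx..].
  by rewrite /y; ring.
- have := @ws_relE F P f lam false true (j, 0) (i, l) (k, r)
    (k + i, r') (k + j, r) (i + j, l) H.
  have [_ ->] := R r j k y0; have [_ ->] := R r' j (k + i) y0'.
  rewrite /= mul0r subr0 => <- //; rewrite ?r'E; [|idx..].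
  by ring.
- have := @ws_relE F P f lam true false (j, 0) (i, l) (k, r)
    (k + i, r') (k + j, r) (i + j, l) H.
  have [-> _] := R r j k y0; have [-> _] := R r' j (k + i) y0'.
  move=> /= <- //; rewrite ?r'E; [|idx..].
  by rewrite /y; ring.
- have := @ws_relE F P f lam false false (j, 0) (i, l) (k, r)
    (k + i, r') (k + j, r) (i + j, l) H.
  have [_ ->] := R r j k y0; have [_ ->] := R r' j (k + i) y0'.
  rewrite -mulrBl -intrB /= => <- //; rewrite ?r'E; [|idx..].
  by ring.
Qed.

(** The transfer from a row to another one also acts on each column x, where it
   has the form prescribed by the density c x; solving for c x gives a value
   independent of x. The exceptional case, from b = 0 to b' = 1, cannot hold for
   two rows in both orders. *)
Lemma col_const_normal P f lam b c : wsys P f lam -> rownormal f lam b ->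
  colspec f lam c -> exists C, forall x, lam false + x%:~R != 0 -> c x = C.
Proof.
move=> H R Cc.
have key r r' : lam true + r%:~R != 0 -> lam true + r'%:~R != 0 -> r != r' ->
    b r = 0 /\ b r' = 1 \/ exists C, forall x, lam false + x%:~R != 0 -> c x = C.
  move=> y0 y0' rr'.
  have l0 : (r' - r)%:~R != 0 :> F by rewrite intr_eq0 subr_eq0 eq_sym.
  have [|[p0 [p1 [K Ph E1 E2]]]] := pair_transfer H R y0 y0' rr'; [by left|right].
  have colE x : lam false + x%:~R != 0 ->
      p0 + p1 * (lam false + x%:~R) != 0 /\
      p1 * (lam true + r%:~R + b r * (r' - r)%:~R) * (lam false + x%:~R) =
      (lam true + r%:~R + c x * (r' - r)%:~R) * (p0 + p1 * (lam false + x%:~R)).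
    by move=> x0; have := Cc x (r' - r) r x0;
       rewrite /fsw /lsw /= /swp /= K Ph mulr0 addr0.
  have [p10|p10] := eqVneq p1 0.
    exists (- (lam true + r%:~R) / (r' - r)%:~R) => x /colE[].
    rewrite p10 !mul0r addr0 => p00 /esym/eqP; rewrite mulf_eq0 (negPf p00) orbF.
    by rewrite addrC addr_eq0 => /eqP <-; rewrite mulfK.
  exists (b r) => x x0; have [n0 E] := colE x x0.
  have bb : b r' - b r = 0.
    by move/eqP: E1; rewrite mulf_eq0 (negPf p10) orbF => /eqP.
  rewrite bb add0r mul1r in E2; rewrite E2 add0r in E n0.
  apply: (mulIf l0); apply: (mulIf n0).
  by apply: (lincomb1 (c := -1) E); ring.
have [r] := int_avoid [:: - lam true]; rewrite inE => rn.
have [r'] := int_avoid [:: - lam true; r%:~R]; rewrite !inE negb_or => /andP[r'n rr].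
have gr : lam true + r%:~R != 0 by rewrite addrC addr_eq0.
have gr' : lam true + r'%:~R != 0 by rewrite addrC addr_eq0.
have rr' : r != r' by apply: contraNneq rr => ->.
have [[b0 b1]|//] := key r r' gr gr' rr'.
have rr'' : r' != r by rewrite eq_sym.
have [[b2 _]|//] := key r' r gr' gr rr''.
by move/eqP: b1; rewrite b2 eq_sym oner_eq0.
Qed.

Lemma col_const P f lam k0 c : wsys P f lam -> P k0 -> wnz lam k0 ->
  colspec f lam c -> exists C, forall x, lam false + x%:~R != 0 -> c x = C.
Proof.
move=> H P0 nz0 Cc; have [b [S [S0 R]]] := ws_rownormal H P0 nz0.
exact: (col_const_normal (wsys_gauge S0 H) R (colspec_gauge S0 Cc)).
Qed.

Lemma row_const P f lam k0 b : wsys P f lam -> P k0 -> wnz lam k0 ->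
  rowspec f lam b -> exists B, forall r, lam true + r%:~R != 0 -> b r = B.
Proof.
move=> H; case: k0 => x r P0 nz0 Rb.
apply: (@col_const _ (fsw f) (lsw lam) (r, x) b (wsys_swap H) P0).
  by rewrite /wnz orbC.
by move=> k i j; apply: Rb.
Qed.

End WGluing.

(** * Normal form away from the weight zero *)

Section WNormalForm.
Variable F : numFieldType.
Implicit Types (P : pred Z2) (f : bool -> Z2 -> Z2 -> F) (lam : bool -> F).
Implicit Types (S : Z2 -> F).

(** The densities of the rows agree, so after normalising the rows a transfer
   has p0 = 0 and is a multiple p1 of the expected one. A rescaling which
   depends only on the row normalises one column x0, and this makes p1 = 1 for
   all pairs of rows. *)
Lemma ws_good_rows P f lam k0 : wsys P f lam -> P k0 -> wnz lam k0 ->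
  exists B S, (forall k, S k != 0) /\ forall s n k,
    wt lam true k != 0 -> wt lam true (k + n) != 0 ->
    wgauge f S s n k = wt lam s k + B * (crd s n)%:~R.
Proof.
move=> H P0 nz0; have [b [S [S0 R]]] := ws_rownormal H P0 nz0.
have H1 := wsys_gauge S0 H.
have [B bB] := row_const H1 P0 nz0 (rownormal_spec R).
have [x0] := int_avoid [:: - lam false]; rewrite inE => x0n.
have gx0 : lam false + x0%:~R != 0 by rewrite addrC addr_eq0.
have Px0 : P (x0, 0) by apply: (ws_full H P0 nz0); rewrite /wnz /wt /= gx0.
have [_ [c [s [s0 sE]]]] := ws_col H1 gx0 Px0.
pose S' (k : Z2) := s k.2; have S'0 k : S' k != 0 by apply: s0.
have H2 := wsys_gauge S'0 H1; set f2 := wgauge _ S' in H2.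
have R2 : rownormal f2 lam b.
  move=> r i k y0; have [E1 E2] := R r i k y0.
  have f2E t : f2 t (i, 0) (k, r) = wgauge f S t (i, 0) (k, r).
    by rewrite /f2 {1}/wgauge /S' /= addr0 mulfK.
  by rewrite !f2E.
have colE l r : f2 false (0, l) (x0, r) = lam false + x0%:~R.
  by rewrite /f2 {1}/wgauge /S' /= (sE l r).1 mulfK.
exists B, (fun k => S k * S' k); split=> [k|]; first by rewrite mulf_neq0.
move=> t [i l] [k r]; rewrite -wgauge_comp -/f2 /wt addpE /= => y0 y0'.
have [l0|l0] := eqVneq l 0.
  by have := R2 r i k y0; rewrite l0 bB //; case: t => -[E1 E2];
     rewrite ?E1 ?E2 /= ?mulr0 ?addr0.
have rr' : r != r + l by rewrite -subr_eq0 opprD addrA subrr add0r oppr_eq0.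
have [[]|[p0 [p1 [K Ph _ E2]]]] := pair_transfer H2 R2 y0 y0' rr'.
  by rewrite !bB // => -> /esym/eqP; rewrite oner_eq0.
rewrite !bB // in K Ph E2; rewrite subrr add0r mul1r in E2.
have lE : r + l - r = l by rewrite addrC addKr.
rewrite lE in K Ph; have := colE l r.
rewrite Ph E2 add0r mulr0 addr0 => E.
have p1E : p1 = 1 by apply: (mulIf gx0); rewrite E mul1r.
by case: t; rewrite ?K ?Ph ?p1E ?E2 mul1r ?add0r.
Qed.

Section BadRows.
Variables (P : pred Z2) (f : bool -> Z2 -> Z2 -> F) (lam : bool -> F) (B : F).
Hypothesis H : wsys P f lam.
Hypothesis G : forall s n k, wt lam true k != 0 -> wt lam true (k + n) != 0 ->
  f s n k = wt lam s k + B * (crd s n)%:~R.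

(** The bracket of the two operators at k - m, where the three other points
   involved are off the row killed by d_2: all its terms but one are known. *)
Lemma bad_row_passage s t (n m k : Z2) : wt lam true k = 0 ->
  n.2 != 0 -> m.2 != 0 -> n.2 != m.2 ->
  f s n k * f t m (k - m)
  = (wt lam s k + B * (crd s n)%:~R) * (wt lam t k + (B - 1) * (crd t m)%:~R).
Proof.
case: n m k => [n1 n2] [m1 m2] [k1 k2] /= y0 n20 m20 nm.
have yE : lam true = - k2%:~R by apply/eqP; rewrite -addr_eq0; apply/eqP.
have W a b : wt lam true (a, k2 + b) = b%:~R.
  by rewrite /wt /= yE intrD addKr.
have g1 : wt lam true (k1 - m1, k2 - m2) != 0 by rewrite W intr_eq0 oppr_eq0.
have g2 : wt lam true (k1 + n1, k2 + n2) != 0 by rewrite W intr_eq0.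
have g3 : wt lam true (k1 - m1 + n1, k2 - m2 + n2) != 0.
  by rewrite -[k2 - m2 + n2]addrA W intr_eq0 addrC subr_eq0.
have g4 : (k1 - m1 + n1, k2 - m2 + n2) + (m1, m2) = (k1 + n1, k2 + n2) by idx.
have g5 : (k1 - m1, k2 - m2) + (n1 + m1, n2 + m2) = (k1 + n1, k2 + n2) by idx.
have := @ws_relE F P f lam s t (n1, n2) (m1, m2) (k1 - m1, k2 - m2)
  (k1, k2) (k1 - m1 + n1, k2 - m2 + n2) (n1 + m1, n2 + m2) H.
rewrite (G t (k := (k1 - m1 + n1, _))) ?g4 // (G s (n := (n1, n2)) (k := (k1 - m1, _))) //.
rewrite (G t (n := (n1 + m1, _))) ?g5 // (G s (n := (n1 + m1, _))) ?g5 //.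
have i1 : (k1, k2) = (k1 - m1, k2 - m2) + (m1, m2) by idx.
move=> /(_ i1 erefl erefl) E; apply: (lincomb1 (c := 1) E); rewrite /wt.
by case: s t {E} => [] [] /=; ring.
Qed.

(** Makes x^(0,1) d_1 standard on the vectors of the row killed by d_2. *)
Definition badS (k : Z2) : F :=
  if (wt lam true k == 0) && (wt lam false k != 0)
  then wt lam false k / f false (0, 1) k else 1.

(** Each of the two factors in bad_row_passage is determined by the other up to
   a scalar that depends on k only. *)
Lemma bad_row_edges (k : Z2) : wt lam true k = 0 -> wt lam false k != 0 ->
  [/\ badS k != 0,
   forall s n, n.2 != 0 -> f s n k * badS k = wt lam s k + B * (crd s n)%:~R &
   forall t m, m.2 != 0 ->
     f t m (k - m) = (wt lam t k + (B - 1) * (crd t m)%:~R) * badS k].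
Proof.
move=> y0 x0.
have pass s t n m n0 m0 nm := @bad_row_passage s t n m k y0 n0 m0 nm.
have d0 : f false (0, 1) k != 0.
  have := pass false false (0, 1) (0, 2) isT isT isT.
  rewrite /= !mulr0 !addr0 => E; apply: contra_neq (mulf_neq0 x0 x0) => d0.
  by rewrite -E d0 mul0r.
have SE : badS k = wt lam false k / f false (0, 1) k by rewrite /badS y0 eqxx x0.
have S0 : badS k != 0 by rewrite SE mulf_neq0 ?invr_eq0.
have B1 t m : m.2 != 0 -> m.2 != 1 ->
    f t m (k - m) = (wt lam t k + (B - 1) * (crd t m)%:~R) * badS k.
  move=> m0 m1; apply: (mulfI d0); rewrite pass //; last by rewrite eq_sym.
  by rewrite /= mulr0 addr0 SE; field.
have A1 s n : n.2 != 0 -> f s n k * badS k = wt lam s k + B * (crd s n)%:~R.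
  move=> n0; pose mu : int := if n.2 == 2 then 3 else 2.
  have [mu0 mu1 nmu] : [/\ mu != 0, mu != 1 & n.2 != mu].
    by rewrite /mu; have [->|n2] := eqVneq n.2 2; split.
  have := pass s false n (0, mu) n0 mu0 nmu.
  rewrite (B1 false (0, mu)) //= !mulr0 !addr0 => E.
  by apply: (mulIf x0); apply: (lincomb1 (c := 1) E); ring.
split=> // t m m0; have [m1|/B1->//] := eqVneq m.2 1.
have := pass false t (0, 2) m isT m0; rewrite m1 => /(_ isT) E.
have /= := A1 false (0, 2) isT; rewrite mulr0 addr0 => E2.
rewrite /= mulr0 addr0 in E.
by apply: (mulfI x0);
   apply: (lincomb2 (c := badS k) (c' := - f t m (k - m)) E E2); ring.
Qed.

(** Operators between two points of the row killed by d_2 are brackets of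
   operators which leave the row and come back. *)
Lemma bad_row_gauge : (forall k, badS k != 0) /\
  forall s n k, wnz lam k -> wnz lam (k + n) ->
  wgauge f badS s n k = wt lam s k + B * (crd s n)%:~R.
Proof.
have S0 k' : badS k' != 0.
  rewrite /badS; case: ifP => [/andP[/eqP y0 x0]|_]; last exact: oner_neq0.
  by have [] := bad_row_edges y0 x0; rewrite /badS y0 eqxx x0.
have S1 k' : wt lam true k' != 0 -> badS k' = 1 by rewrite /badS => /negPf ->.
have bg s' n' k' : wt lam true k' = 0 -> wt lam false k' != 0 -> n'.2 != 0 ->
    wgauge f badS s' n' k' = wt lam s' k' + B * (crd s' n')%:~R.
  move=> y0 x0 n0; have [_ A _] := bad_row_edges y0 x0.
  rewrite /wgauge A // S1 ?divr1 //.
  move: y0; rewrite /wt /= intrD addrA => ->; by rewrite add0r intr_eq0.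
have gb s' n' k' : wt lam true (k' + n') = 0 -> wt lam false (k' + n') != 0 ->
    n'.2 != 0 -> wgauge f badS s' n' k' = wt lam s' k' + B * (crd s' n')%:~R.
  move=> y0 x0 n0; have [_ _ A] := bad_row_edges y0 x0.
  have := A s' n' n0; rewrite addrK => E.
  rewrite /wgauge E [badS k']S1 ?mulr1 ?mulfK //.
    rewrite /wt /=; case: (s'); rewrite /= intrD; ring.
  apply: contraNneq n0 => y1; move: y0; rewrite /wt /= intrD addrA.
  by rewrite -/(wt lam true k') y1 add0r => /eqP; rewrite intr_eq0.
have H' := wsys_gauge S0 H.
split=> // s n k nzk nzkn.
have [y0|y0] := eqVneq (wt lam true k) 0; last first.
  have [y1|y1] := eqVneq (wt lam true (k + n)) 0.
    apply: gb => //; first by move: nzkn; rewrite /wnz y1 eqxx orbF.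
    apply: contraNneq y0 => n0; move: y1; rewrite /wt /= n0 addr0 => ->.
    by rewrite eqxx.
  by rewrite /wgauge !S1 // mulr1 divr1 G.
have x0 : wt lam false k != 0 by move: nzk; rewrite /wnz y0 eqxx orbF.
have [n0|n0] := eqVneq n.2 0; last exact: bg.
have y1 : wt lam true (k + n) = 0 by move: y0; rewrite /wt /= n0 addr0.
have x1 : wt lam false (k + n) != 0 by move: nzkn; rewrite /wnz y1 eqxx orbF.
case: n k n0 nzk nzkn y0 x0 y1 x1 => [j n2] [k1 k2] /= -> nzk nzkn y0 x0 y1 x1.
have E1 : (k1 + j, k2 + 1) + (0, -1) = (k1, k2) + (j, 0) :> Z2 by idx.
have E2 : (k1, k2 - 1) + (j, 1) = (k1, k2) + (j, 0) :> Z2 by idx.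
have rel s' := @ws_relE F _ _ lam true s' (0, -1) (j, 1) (k1, k2)
  (k1 + j, k2 + 1) (k1, k2 - 1) (j, 0) H' erefl (congr2 pair (esym (addr0 _)) erefl)
  (congr2 pair (esym (add0r _)) erefl).
have yE : lam true = - k2%:~R by apply/eqP; rewrite -addr_eq0; apply/eqP.
have := rel s; rewrite (gb true (0, -1) (k1 + j, k2 + 1)) ?E1 //.
rewrite (gb s (j, 1) (k1, k2 - 1)) ?E2 // (bg s (j, 1)) // (bg true (0, -1)) //.
case: s; rewrite /= ?mulr1 ?mul1r ?mulr0 ?mul0r ?subr0 => E.
  apply: (mulfI (_ : 2 != 0)); first by rewrite pnatr_eq0.
  by apply: (lincomb1 (c := -1) E); rewrite /wt /= yE; ring.
by apply: (lincomb1 (c := -1) E); rewrite /wt /= yE; ring.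
Qed.

End BadRows.

Lemma ws_normal_form P f lam k0 : wsys P f lam -> P k0 -> wnz lam k0 ->
  exists B S, (forall k, S k != 0) /\ forall s n k,
    wnz lam k -> wnz lam (k + n) ->
    wgauge f S s n k = wt lam s k + B * (crd s n)%:~R.
Proof.
move=> H P0 nz0; have [B [S [S0 E]]] := ws_good_rows H P0 nz0.
have [T0 TE] := bad_row_gauge (wsys_gauge S0 H) E.
exists B, (fun k => S k * badS (wgauge f S) lam k).
split=> [k|s n k nz1 nz2]; first by rewrite mulf_neq0.
by rewrite -wgauge_comp; apply: TE.
Qed.

End WNormalForm.

(** * Homogeneous derivations at q = -1 and classes modulo 2 *)

Notation cls := (bool * bool)%type.

Definition pz (i : int) : bool := (i %% 2)%Z != 0.
Definition par (k : Z2) : cls := (pz k.1, pz k.2).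
Definition kadd (c d : cls) : cls := (c.1 (+) d.1, c.2 (+) d.2).
Definition evn (n : Z2) := par n == (false, false).
Definition lft (c : cls) : Z2 := ((c.1 : nat)%:Z, (c.2 : nat)%:Z).
Definition dbl (a : Z2) : Z2 := (2 * a.1, 2 * a.2).
Definition hlf (k : Z2) : Z2 := ((k.1 %/ 2)%Z, (k.2 %/ 2)%Z).

Lemma pzD i j : pz (i + j) = pz i (+) pz j.
Proof. rewrite /pz; lia. Qed.

Lemma pzN i : pz (- i) = pz i.
Proof. rewrite /pz; lia. Qed.

Lemma pz_even i : pz i = false -> i = 2 * (i %/ 2)%Z.
Proof. rewrite /pz; lia. Qed.

Lemma parD k m : par (k + m) = kadd (par k) (par m).
Proof. by rewrite /par !pzD. Qed.

Lemma parN k : par (- k) = par k.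
Proof. by rewrite /par !pzN. Qed.

Lemma parB k m : par (k - m) = kadd (par k) (par m).
Proof. by rewrite parD parN. Qed.

Lemma kaddC c d : kadd c d = kadd d c.
Proof. by rewrite /kadd ![_ (+) d.1]addbC ![_ (+) d.2]addbC. Qed.

Lemma kaddA c d e : kadd c (kadd d e) = kadd (kadd c d) e.
Proof. by rewrite /kadd /= !addbA. Qed.

Lemma kaddK c d : kadd (kadd c d) d = c.
Proof. by rewrite /kadd /= !addbK; case: c. Qed.

Lemma kadd0 c : kadd c (false, false) = c.
Proof. by rewrite /kadd /= !addbF; case: c. Qed.

Lemma kaddcc c : kadd c c = (false, false).
Proof. by rewrite /kadd !addbb. Qed.

Lemma parDe k n : evn n -> par (k + n) = par k.
Proof. by move=> /eqP n0; rewrite parD n0 kadd0. Qed.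

Lemma parBe k n : evn n -> par (k - n) = par k.
Proof. by move=> /eqP n0; rewrite parB n0 kadd0. Qed.

Lemma evnE n : evn n = ((n.1 %% 2)%Z == 0) && ((n.2 %% 2)%Z == 0).
Proof. by rewrite /evn /par /pz xpair_eqE /= !eqbF_neg !negbK. Qed.

Lemma evnD n m : evn n -> evn (m + n) = evn m.
Proof. by rewrite /evn => /eqP h; rewrite parD h kadd0. Qed.

Lemma evnB n m : evn n -> evn (m - n) = evn m.
Proof. by rewrite /evn => /eqP h; rewrite parB h kadd0. Qed.

Lemma lft_hlf k : lft (par k) + dbl (hlf k) = k.
Proof.
by case: k => a b; rewrite /lft /dbl /hlf /par /pz /=; congr (_, _);
   case: eqP => /=; lia.
Qed.

Lemma par_lft c a : par (lft c + dbl a) = c.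
Proof.
by case: c a => [c d] [a b]; rewrite /par /pz /=; congr (_, _);
   case: c; case: d => /=; lia.
Qed.

Lemma hlf_lft c a : hlf (lft c + dbl a) = a.
Proof.
by case: c a => [c d] [a b]; rewrite /hlf /=; congr (_, _);
   case: c; case: d => /=; lia.
Qed.

Lemma evn_dbl a : evn (dbl a).
Proof. by rewrite evnE /=; lia. Qed.

Lemma dbl_hlf n : evn n -> dbl (hlf n) = n.
Proof.
case: n => a b; rewrite evnE /dbl /hlf /= => /andP[/eqP h1 /eqP h2].
congr (_, _); lia.
Qed.

Lemma dblD a b : dbl (a + b) = dbl a + dbl b.
Proof. by rewrite /dbl /= !mulrDr. Qed.

Section QReps.
Variable F : numFieldType.
Implicit Types (P : pred Z2) (f : bool -> Z2 -> Z2 -> F) (g : Z2 -> Z2 -> F).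
Implicit Types (lam : bool -> F) (S : Z2 -> F).

Definition eps (b : bool) : F := if b then -1 else 1.
(** The coefficient of the bracket of two monomials of classes c and d. *)
Definition qcc (c d : cls) : F := eps (c.2 && d.1) - eps (c.1 && d.2).

Lemma qcc_evn m m' : evn (m + m') -> qcc (par m) (par m') = 0.
Proof.
rewrite /evn parD => /eqP E; have <- : par m = par m'.
  by rewrite -[par m](kaddK _ (par m')) E kaddC kadd0.
by rewrite /qcc andbC subrr.
Qed.

(** Coefficients f of x^n d_s and g of ad x^m on a Z^2-graded module with
   one-dimensional components on P. The last field is irreducibility, tested on
   the graded subspaces. *)
Record qrep P f g lam : Prop := QRep {
  q_WW : forall s t n n' k, evn n -> evn n' ->
    f s n (k + n') * f t n' k - f t n' (k + n) * f s n k
    = (crd s n')%:~R * f t (n + n') k - (crd t n)%:~R * f s (n + n') k;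
  q_WG : forall s n m k, evn n -> ~~ evn m ->
    f s n (k + m) * g m k - g m (k + n) * f s n k
    = (crd s m)%:~R * g (m + n) k;
  q_GG : forall m m' k, ~~ evn m -> ~~ evn m' ->
    g m (k + m') * g m' k - g m' (k + m) * g m k
    = qcc (par m) (par m') * g (m + m') k;
  q_deg : forall s k, P k -> f s 0 k = wt lam s k;
  q_fsupp : forall s n k, ~~ (P k && P (k + n)) -> f s n k = 0;
  q_gsupp : forall m k, ~~ (P k && P (k + m)) -> g m k = 0;
  q_irr : forall Q : pred Z2,
    (forall s n k, evn n -> Q k -> f s n k != 0 -> Q (k + n)) ->
    (forall m k, ~~ evn m -> Q k -> g m k != 0 -> Q (k + m)) ->
    (forall k, P k -> ~~ Q k) \/ (forall k, P k -> Q k) }.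

Definition ggauge g S m k : F := g m k * S k / S (k + m).

Lemma gauge_neq0 (x y z : F) : y != 0 -> z != 0 -> x != 0 -> x * y / z != 0.
Proof. by move=> y0 z0 x0; rewrite !mulf_neq0 // invr_eq0. Qed.

Lemma qrep_gauge P f g lam S : (forall k, S k != 0) ->
  qrep P f g lam -> qrep P (wgauge f S) (ggauge g S) lam.
Proof.
move=> S0 [h1 h2 h3 h4 h5 h6 h7]; split.
- move=> s t n n' k en en'.
  have E := h1 s t n n' k en en'; rewrite /wgauge -!addrA [n' + n]addrC.
  by apply: (lincomb1 (c := S k / S (k + (n + n'))) E); field; rewrite !S0.
- move=> s n m k en om.
  have E := h2 s n m k en om; rewrite /wgauge /ggauge -!addrA [n + m]addrC.
  by apply: (lincomb1 (c := S k / S (k + (m + n))) E); field; rewrite !S0.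
- move=> m m' k om om'.
  have E := h3 m m' k om om'; rewrite /ggauge -!addrA [m' + m]addrC.
  by apply: (lincomb1 (c := S k / S (k + (m + m'))) E); field; rewrite !S0.
- by move=> s k Pk; rewrite /wgauge addr0 mulfK // h4.
- by move=> s n k nP; rewrite /wgauge h5 // !mul0r.
- by move=> m k nP; rewrite /ggauge h6 // !mul0r.
move=> Q Q1 Q2; apply: h7 => [s n k en Qk|m k om Qk] x0.
  by apply: (Q1 s) => //; apply: gauge_neq0.
by apply: Q2 => //; apply: gauge_neq0.
Qed.

Section Cosets.
Variables (P : pred Z2) (f : bool -> Z2 -> Z2 -> F) (g : Z2 -> Z2 -> F).
Variable lam : bool -> F.
Hypothesis H : qrep P f g lam.

Definition csupp (c : cls) : bool :=
  `[< exists k, [/\ par k = c, wnz lam k & P k] >].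

Let two0 : 2 != 0 :> F. Proof. by rewrite pnatr_eq0. Qed.

Let Pc c a := P (lft c + dbl a).
Let fc c s n a := f s (dbl n) (lft c + dbl a) / 2.
Let lc c s := (lam s + (crd s (lft c))%:~R) / 2.

Let lcE c s a : wt (lc c) s a = wt lam s (lft c + dbl a) / 2.
Proof.
by rewrite /wt /lc; case: s; rewrite /= intrD intrM; field.
Qed.

Let lc_nz c a : wnz (lc c) a = wnz lam (lft c + dbl a).
Proof. by rewrite /wnz !lcE !mulf_eq0 invr_eq0 (negPf two0) !orbF. Qed.

Let coset_ws c : wsys (Pc c) (fc c) (lc c).
Proof.
split=> [s t n n' k|s k Pk|s n k nP].
- have E := q_WW H s t (lft c + dbl k) (evn_dbl n) (evn_dbl n').
  rewrite /fc !dblD !addrA; apply: (lincomb1 (c := 1 / 4) E).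
  by case: s t {E} => [] [] /=; rewrite !intrM; field.
- by rewrite /fc lcE -[dbl 0]/(0 : Z2) (q_deg H).
- by rewrite /fc (q_fsupp H) ?mul0r // -addrA -dblD.
Qed.

Lemma csuppP c : csupp c -> exists a, wnz (lc c) a /\ Pc c a.
Proof.
move=> /asboolP[k [kc nk Pk]]; exists (hlf k).
by rewrite lc_nz /Pc -kc lft_hlf.
Qed.

Lemma csupp_full k : wnz lam k -> P k = csupp (par k).
Proof.
move=> nk; apply/idP/idP => [Pk|/csuppP[a [na Pa]]]; first by apply/asboolP; exists k.
have := ws_full (coset_ws _) Pa na (k := hlf k).
by rewrite lc_nz lft_hlf => /(_ nk); rewrite /Pc lft_hlf.
Qed.

(** On the class of c, the operators x^(2n) d_s / 2 form a copy of the vector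
   fields, acting on vectors indexed by a in k = lft c + 2 a. *)
Lemma coset_normal_form : exists S b, (forall k, S k != 0) /\
  forall s n k, evn n -> wnz lam k -> wnz lam (k + n) -> csupp (par k) ->
    wgauge f S s n k = wt lam s k + b (par k) * (crd s n)%:~R.
Proof.
have coset c : exists bS : F * (Z2 -> F), (forall k, bS.2 k != 0) /\
    (csupp c -> forall s n k, wnz (lc c) k -> wnz (lc c) (k + n) ->
     wgauge (fc c) bS.2 s n k = wt (lc c) s k + bS.1 * (crd s n)%:~R).
  have [/csuppP[a [na Pa]]|_] := boolP (csupp c); last first.
    by exists (0, fun=> 1); split=> // k; apply: oner_neq0.
  by have [B [S [S0 E]]] := ws_normal_form (coset_ws c) Pa na; exists (B, S).
have [bS bSP] := choice coset.
exists (fun k => (bS (par k)).2 (hlf k)), (fun c => (bS c).1).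
split=> [k|s n k en nk nkn ck]; first by have [] := bSP (par k).
have [S0 /(_ ck s (hlf n) (hlf k))] := bSP (par k).
rewrite !lc_nz dblD !addrA lft_hlf dbl_hlf // => /(_ nk nkn).
rewrite /wgauge /fc lcE lft_hlf dbl_hlf // parDe // => E.
have -> : hlf (k + n) = hlf k + hlf n.
  by rewrite -{1}(lft_hlf k) -{1}(dbl_hlf en) -addrA -dblD hlf_lft.
have n2 : (crd s n)%:~R = 2 * (crd s (hlf n))%:~R :> F.
  by rewrite -{1}(dbl_hlf en); case: (s); rewrite /= intrM.
by rewrite n2; apply: (lincomb1 (c := 2) E); field.
Qed.

End Cosets.

End QReps.

(** * Density weights along odd steps *)

Section Edges.
Variable F : numFieldType.
Variables (P : pred Z2) (f : bool -> Z2 -> Z2 -> F) (g : Z2 -> Z2 -> F).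
Variables (lam : bool -> F) (b : cls -> F).
Hypothesis H : qrep P f g lam.
Hypothesis N : forall s n k, evn n -> wnz lam k -> wnz lam (k + n) ->
  csupp P lam (par k) -> f s n k = wt lam s k + b (par k) * (crd s n)%:~R.

Let x := wt lam false.
Let y := wt lam true.

Definition wdet (k m : Z2) : F := x k * m.2%:~R - y k * m.1%:~R.
Definition zdet (n m : Z2) : F := n.1%:~R * m.2%:~R - n.2%:~R * m.1%:~R.

Lemma wt_add s k m : wt lam s (k + m) = wt lam s k + (crd s m)%:~R.
Proof. by rewrite /wt; case: s; rewrite /= intrD addrA. Qed.

Lemma wdetD k n m : wdet (k + n) m = wdet k m + zdet n m.
Proof. by rewrite /wdet /zdet /x /y !wt_add /=; ring. Qed.

Lemma wdet_nz k m : wdet k m != 0 -> wnz lam k.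
Proof.
apply: contraNT; rewrite /wnz negb_or !negbK /wdet /x /y => /andP[/eqP -> /eqP ->].
by rewrite !mul0r subrr.
Qed.

(** The bracket [x^n d_s, x^m] applied to v_k gives one scalar equation for each
   s; they are solved by Cramer's rule for g m (k + n) and for g (m + n) k. *)
Lemma cramer k m n : evn n -> ~~ evn m ->
  wnz lam k -> wnz lam (k + m) -> wnz lam (k + n) -> wnz lam (k + m + n) ->
  csupp P lam (par k) -> csupp P lam (par (k + m)) ->
  let b0 := b (par k) in let b1 := b (par (k + m)) in
  (wdet k m + b0 * zdet n m) * g m (k + n) = (wdet k m + b1 * zdet n m) * g m k /\
  (wdet k m + b0 * zdet n m) * g (m + n) k =
    (wdet k m + b1 * wdet k n + b0 * (zdet n m - wdet k n)) * g m k.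
Proof.
move=> en om nk nkm nkn nkmn ck ckm b0 b1.
have E1 := q_WG H false k en om; have E2 := q_WG H true k en om.
rewrite !(N _ en nk nkn ck) !(N _ en nkm nkmn ckm) -/b0 -/b1 !wt_add /= in E1 E2.
split.
  apply: (lincomb2 (c := - m.2%:~R) (c' := m.1%:~R) E1 E2).
  by rewrite /wdet /zdet /x /y; ring.
apply: (lincomb2 (c := y k + b0 * n.2%:~R) (c' := - (x k + b0 * n.1%:~R)) E1 E2).
by rewrite /wdet /zdet /x /y; ring.
Qed.

(** A step n = t m multiplies g m k by 1 + be t, where be is the difference of
   the density weights. Going from m to 9 m directly or through 3 m gives be (be
   - 1) = 0. *)
Lemma edge_generic k m : ~~ evn m -> wdet k m != 0 ->
  csupp P lam (par k) -> csupp P lam (par (k + m)) -> g m k != 0 ->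
  b (par (k + m)) = b (par k) \/ b (par (k + m)) = b (par k) + 1.
Proof.
move=> om d0 ck ckm gk.
set be := b (par (k + m)) - b (par k).
pose mul (t : int) (n : Z2) : Z2 := (t * n.1, t * n.2).
have step (m' : Z2) (t : int) : ~~ evn m' -> pz t = false -> wdet k m' != 0 ->
    par m' = par m -> g (m' + mul t m') k = (1 + be * t%:~R) * g m' k.
  move=> om' et d0' pm'.
  have en : evn (mul t m').
    rewrite (pz_even et).
    by rewrite /mul -!mulrA; apply: (evn_dbl (_, _)).
  have zd : zdet (mul t m') m' = 0 by rewrite /zdet /mul /= !intrM; ring.
  have zm : zdet m' m' = 0 by rewrite /zdet; ring.
  have pk : par (k + m') = par (k + m) by rewrite !parD pm'.
  have nk := wdet_nz d0'.
  have [] := @cramer k m' (mul t m') en om' nk.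
  - by apply: (@wdet_nz _ m'); rewrite wdetD zm addr0.
  - by apply: (@wdet_nz _ m'); rewrite wdetD zd addr0.
  - by apply: (@wdet_nz _ m'); rewrite !wdetD zd zm !addr0.
  - by [].
  - by rewrite pk.
  rewrite zd mulr0 addr0 pk => _ E; apply: (mulfI d0'); rewrite E /be.
  have -> : wdet k (mul t m') = t%:~R * wdet k m'.
    by rewrite /wdet /mul /= !intrM; ring.
  by ring.
have E1 := step m 2 om erefl d0 erefl; have E3 := step m 8 om erefl d0 erefl.
have en2 : evn (mul 2 m) := evn_dbl m.
have E2 := step (m + mul 2 m) 2.
have m9 : m + mul 2 m + mul 2 (m + mul 2 m) = m + mul 8 m.
  by case: (m) => a c; rewrite /mul /= !addpE; congr (_, _); ring.
rewrite m9 evnD // parDe // E1 E3 in E2.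
have {}E2 := E2 om erefl _ erefl.
have : (be * (be - 1)) * g m k = 0.
  apply: (mulfI (_ : 4 != 0)); first by rewrite pnatr_eq0.
  have {}E2 : (1 + be * 8) * g m k = (1 + be * 2) * ((1 + be * 2) * g m k).
    apply: E2; rewrite /wdet /mul /= !intrD !intrM.
    have -> : x k * (m.2%:~R + 2 * m.2%:~R) - y k * (m.1%:~R + 2 * m.1%:~R)
      = 3 * wdet k m by rewrite /wdet; ring.
    by rewrite mulf_neq0 // pnatr_eq0.
  by apply: (lincomb1 (c := -1) E2); ring.
move/eqP; rewrite !mulf_eq0 (negPf gk) orbF !subr_eq0 => /orP[|] /eqP h.
  by left.
by right; rewrite -h /be [RHS]addrC subrK.
Qed.

Lemma transverse (m : Z2) : ~~ evn m -> exists n, evn n /\ zdet n m != 0.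
Proof.
case: m => m1 m2 om; have [m20|m20] := eqVneq m2 0.
  exists (0, 2); split; first by [].
  rewrite /zdet /= mul0r sub0r oppr_eq0 mulf_neq0 ?pnatr_eq0 // intr_eq0.
  by apply: contraNneq om => ->; rewrite m20.
exists (2, 0); split; first by [].
by rewrite /zdet /= mul0r subr0 mulf_neq0 ?pnatr_eq0 // intr_eq0.
Qed.

Lemma wdet_transverse k n m : wnz lam k -> wdet k m = 0 -> zdet n m != 0 ->
  wdet k n != 0.
Proof.
move=> nk d0 z0; apply: contraTneq nk => d1.
have xk : zdet n m * x k = 0.
  apply: (lincomb2 (c := n.1%:~R) (c' := - m.1%:~R) d0 d1).
  by rewrite /wdet /zdet; ring.
have yk : zdet n m * y k = 0.
  apply: (lincomb2 (c := n.2%:~R) (c' := - m.2%:~R) d0 d1).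
  by rewrite /wdet /zdet; ring.
rewrite /wnz negb_or !negbK -/x -/y.
by move/eqP: xk; move/eqP: yk; rewrite !mulf_eq0 (negPf z0) /= => -> ->.
Qed.

(** If m is parallel to the weight at k, the points k + n and the steps m + n
   are generic for a transverse even n. When the conclusion fails g vanishes
   there by edge_generic, and Cramer's equations then give b = 0 at both ends.
   *)
Lemma edge_weights k m : ~~ evn m -> wnz lam k -> wnz lam (k + m) ->
  csupp P lam (par k) -> csupp P lam (par (k + m)) -> g m k != 0 ->
  b (par (k + m)) = b (par k) \/ b (par (k + m)) = b (par k) + 1.
Proof.
move=> om nk nkm ck ckm gk.
have [d0|d0] := eqVneq (wdet k m) 0; last exact: edge_generic.
have [|nb] := pselect (b (par (k + m)) = b (par k) \/
  b (par (k + m)) = b (par k) + 1); first by [].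
exfalso; have [n [en zn]] := transverse om.
have generic0 k' m' : ~~ evn m' -> wdet k' m' != 0 -> par k' = par k ->
    par m' = par m -> g m' k' = 0.
  move=> om' d0' pk pm; apply/eqP; apply: contra_notT nb => g0.
  have pkm : par (k' + m') = par (k + m) by rewrite !parD pk pm.
  by rewrite -pk -pkm; apply: edge_generic; rewrite ?pk ?pkm.
have zm : zdet m m = 0 by rewrite /zdet; ring.
have d1 : wdet (k + n) m != 0 by rewrite wdetD d0 add0r.
have d2 : wdet k n != 0 := wdet_transverse nk d0 zn.
have d3 : wdet (k + m) n != 0.
  by apply: (wdet_transverse (m := m)) => //; rewrite wdetD d0 zm addr0.
have nkn := wdet_nz d1.
have nkmn : wnz lam (k + m + n).
  by apply: (@wdet_nz _ m); rewrite !wdetD d0 zm !add0r.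
have [E1 E2] := cramer en om nk nkm nkn nkmn ck ckm.
have g0 : g m (k + n) = 0 by apply: generic0; rewrite ?parDe.
rewrite g0 d0 mulr0 add0r in E1.
have b10 : b (par (k + m)) = 0.
  move/esym/eqP: E1; rewrite !mulf_eq0 (negPf zn) (negPf gk) !orbF.
  by move=> /eqP.
have g1 : g (m + n) k = 0.
  apply: generic0; rewrite ?evnD ?parDe //.
  have -> : wdet k (m + n) = wdet k m + wdet k n.
    by rewrite /wdet /= !intrD; ring.
  by rewrite d0 add0r.
rewrite g1 b10 d0 mulr0 mul0r !add0r in E2.
have zE : zdet n m - wdet k n = - wdet (k + m) n.
  by rewrite wdetD /zdet; ring.
move/esym/eqP: E2; rewrite zE !mulf_eq0 oppr_eq0 (negPf d3) (negPf gk) !orbF.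
by move=> /eqP b00; apply: nb; left; rewrite b10 b00.
Qed.

End Edges.

(** * Connectedness of the classes *)

(** GenW s n stands for x^n d_s and GenG m for ad x^m; gval tells which degrees
   are admissible. *)
Inductive gen := GenW of bool & Z2 | GenG of Z2.

Definition gdeg u := match u with GenW _ n => n | GenG m => m end.
Definition gval u := match u with GenW _ n => evn n | GenG m => ~~ evn m end.

Lemma fst_neq0 (n : Z2) : n.1 != 0 -> n != 0.
Proof. by apply: contraNneq => ->. Qed.

Lemma generic_split (p q : int) : exists a : int,
  [/\ 2 * a != 0, p - 2 * a != 0, p - 2 * a - 2 * a != 0 &
      q - 2 * a - 2 * a != 0].
Proof. by exists ((`|p|%N + `|q|%N)%N%:Z + 1); split; lia. Qed.

Section Passage.
Variable F : numFieldType.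
Variables (P : pred Z2) (f : bool -> Z2 -> Z2 -> F) (g : Z2 -> Z2 -> F).
Variables (lam : bool -> F).
Hypothesis H : qrep P f g lam.

Definition gco u k : F := match u with GenW s n => f s n k | GenG m => g m k end.

Lemma gco_supp u k : gco u k != 0 -> P k /\ P (k + gdeg u).
Proof.
by case: u => [s n|m] /=; move=> h; apply/andP; apply: contraNT h => nP;
  rewrite ?(q_fsupp H) ?(q_gsupp H).
Qed.

Lemma gco_irr (Q : pred Z2) :
  (forall u k, gval u -> P k -> Q k -> gco u k != 0 -> ~~ Q (k + gdeg u) -> False) ->
  (forall k, P k -> ~~ Q k) \/ (forall k, P k -> Q k).
Proof.
move=> HQ; apply: (q_irr H) => [s n k en Qk n0|m k om Qk n0].
  have [Pk _] := gco_supp (u := GenW s n) n0.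
  by apply: contraT => nQ; case: (HQ (GenW s n) k).
have [Pk _] := gco_supp (u := GenG m) n0.
by apply: contraT => nQ; case: (HQ (GenG m) k).
Qed.

Lemma wt_zero_uniq k k' : ~~ wnz lam k -> ~~ wnz lam k' -> k = k'.
Proof.
rewrite /wnz !negb_or !negbK /wt /=.
case: k k' => [a b] [a' b'] /= /andP[/eqP h1 /eqP h2] /andP[/eqP h3 /eqP h4].
congr (_, _); apply: (mulrIz (oner_neq0 F)).
  by apply: (addrI (lam false)); rewrite h1 h3.
by apply: (addrI (lam true)); rewrite h2 h4.
Qed.

Definition cclosed (T : pred cls) := forall m k, ~~ evn m -> wnz lam k ->
  wnz lam (k + m) -> T (par k) -> g m k != 0 -> T (par (k + m)).

Lemma cclosed_gco T u k : cclosed T -> gval u -> wnz lam k ->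
  wnz lam (k + gdeg u) -> T (par k) -> gco u k != 0 -> T (par (k + gdeg u)).
Proof.
by case: u => [s n|m] cT /= vu nk nk' Tk u0; [rewrite parDe|apply: cT].
Qed.

(** Without a nonzero step from T into v_k0, the vectors with nonzero weight in
   T would span a submodule; without a nonzero step from v_k0 out of T', so
   would v_k0 and the vectors in T'. If the steps into v_k0 all had the same
   degree, the operator u' doing one would be a bracket of operators of other
   degrees, which do not enter. *)
Lemma passage (T T' : pred cls) k0 c1 c2 :
  cclosed T -> cclosed T' -> T c1 -> csupp P lam c1 ->
  ~~ T' c2 -> csupp P lam c2 -> P k0 -> ~~ wnz lam k0 ->
  exists u u', [/\ gval u /\ gval u', gdeg u != gdeg u',
    gco u k0 != 0 /\ gco u' (k0 - gdeg u') != 0,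
    T (par (k0 - gdeg u')) /\ ~~ T' (par (k0 + gdeg u)) &
    wnz lam (k0 - gdeg u') /\ wnz lam (k0 + gdeg u)].
Proof.
move=> cT cT' Tc1 Sc1 Tc2 Sc2 Pk0 z0.
have to0 k : ~~ wnz lam k -> k = k0 by move=> nk; apply: wt_zero_uniq.
have nz0 k : k != k0 -> wnz lam k by apply: contraR => /to0 ->.
pose into u := [/\ gval u, gco u (k0 - gdeg u) != 0, T (par (k0 - gdeg u)) &
  wnz lam (k0 - gdeg u)].
pose out u := [/\ gval u, gco u k0 != 0, ~~ T' (par (k0 + gdeg u)) &
  wnz lam (k0 + gdeg u)].
have [u' [v1 n1 t1 w1]] : exists u, into u.
  have [|nE] := pselect (exists u, into u); first by [].
  exfalso; have [] := @gco_irr (fun k => wnz lam k && T (par k)).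
  - move=> u k vu Pk /andP[nk Tk] u0; rewrite negb_and => /orP[nw|nT].
      apply: nE; exists u; rewrite /into -(to0 _ nw) addrK; split=> //.
    have [nw|/to0 k0E] := boolP (wnz lam (k + gdeg u)).
      by rewrite (cclosed_gco cT vu nk nw Tk u0) in nT.
    by apply: nE; exists u; rewrite /into -k0E addrK.
  - case/asboolP: Sc1 => k [kc nk Pk] /(_ k Pk).
    by rewrite nk kc Tc1.
  - by move=> /(_ k0 Pk0); rewrite (negPf z0).
have [u [v2 n2 t2 w2]] : exists u, out u.
  have [|nE] := pselect (exists u, out u); first by [].
  exfalso; have [] := @gco_irr (fun k => (k == k0) || (wnz lam k && T' (par k))).
  - move=> u k vu Pk Qk u0; rewrite negb_or => /andP[/nz0 nw].
    rewrite nw /= => nT; case/orP: Qk => [/eqP kE|/andP[nk Tk]].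
      by apply: nE; exists u; rewrite /out -kE.
    by rewrite (cclosed_gco cT' vu nk nw Tk u0) in nT.
  - by move=> /(_ k0 Pk0); rewrite eqxx.
  - case/asboolP: Sc2 => k [kc nk Pk] /(_ k Pk).
    by rewrite kc (negPf Tc2) andbF orbF => /eqP kE; rewrite -kE nk in z0.
suff [u'' [v3 n3 t3 w3] d3] : exists2 u'', into u'' & gdeg u != gdeg u''.
  by exists u, u''.
have [dd|dd] := eqVneq (gdeg u) (gdeg u'); last by exists u'.
have [|nE] := pselect (exists2 u'', into u'' & gdeg u != gdeg u''); first by [].
exfalso; move: nE v1 n1 t1 w1; rewrite dd => nE; set m1 := gdeg u' => v1 n1 t1 w1.
have zero v : gval v -> gdeg v != m1 -> wnz lam (k0 - gdeg v) ->
    T (par (k0 - gdeg v)) -> gco v (k0 - gdeg v) = 0.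
  move=> vv dv nv Tv; apply/eqP; apply: contra_notT nE => v0.
  by exists v; rewrite // eq_sym.
have nzB (m : Z2) : m != 0 -> wnz lam (k0 - m).
  by move=> m0; apply: nz0; rewrite -subr_eq0 addrAC subrr add0r oppr_eq0.
pose k := k0 - m1.
(* up to a nonzero scalar u' is a bracket of v and v', whose degrees are nonzero
   and add up to m1: both products v v' and v' v enter v_k0 by a zero
   coefficient *)
have zprod v v' : gval v -> gval v' -> gdeg v + gdeg v' = m1 ->
    gdeg v != 0 -> gdeg v' != 0 -> gco v (k + gdeg v') * gco v' k = 0.
  move=> vv vv' dvv' v0 v'0; have [->|g0] := eqVneq (gco v' k) 0.
    by rewrite mulr0.
  have kE : k + gdeg v' = k0 - gdeg v by rewrite /k -dvv' opprD addrA subrK.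
  rewrite kE zero ?mul0r //; first by rewrite -dvv' -subr_eq0 opprD addNKr oppr_eq0.
    exact: nzB.
  by rewrite -kE; apply: cclosed_gco => //; rewrite kE; apply: nzB.
move: v1 n1; rewrite -/k /m1 in t1 w1 *; move: zprod; rewrite /k /m1.
case: (u') => [t n|m] /= zprod v1.
  have [a [a0 a1 a2 a3]] := generic_split n.1 n.2.
  pose h1 : Z2 := (2 * a, 2 * a); pose h2 : Z2 := n - h1.
  have en1 : evn h1 := evn_dbl (a, a).
  have en2 : evn h2 by rewrite evnB.
  have n12 : h1 + h2 = n by rewrite /h2 addrC subrK.
  have n10 : h1 != 0 by apply: fst_neq0.
  have n20 : h2 != 0 by apply: fst_neq0.
  have E := q_WW H t t (k0 - n) en1 en2.
  have Z1 := zprod (GenW t h1) (GenW t h2) en1 en2 n12 n10 n20.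
  have Z2 := zprod (GenW t h2) (GenW t h1) en2 en1 (etrans (addrC _ _) n12) n20 n10.
  rewrite /= in Z1 Z2; rewrite Z1 Z2 n12 subrr -mulrBl in E.
  have c0 : (crd t h2)%:~R - (crd t h1)%:~R != 0 :> F.
    by rewrite -intrB intr_eq0; case: (t).
  by move/esym/eqP: E; rewrite mulf_eq0 (negPf c0) /= => ->.
have [s ms] : exists s, crd s m != 0.
  have [m10|] := eqVneq m.1 0; last by exists false.
  have [m20|] := eqVneq m.2 0; last by exists true.
  by move: v1; rewrite evnE m10 m20.
pose n1 : Z2 := if s then (2, 0) else (0, 2).
have en1 : evn n1 by rewrite /n1; case: (s).
have n10 : n1 != 0 by rewrite /n1; case: (s).
pose m2 := m - n1.
have om2 : ~~ evn m2 by rewrite evnB.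
have m12 : n1 + m2 = m by rewrite /m2 addrC subrK.
have m21 : m2 + n1 = m by rewrite /m2 subrK.
have m20 : m2 != 0 by apply: contraNneq om2 => ->.
have c0 : crd s m2 = crd s m by rewrite /m2 /n1; case: (s); rewrite /= subr0.
have E := q_WG H s (k0 - m) en1 om2.
have Z1 := zprod (GenW s n1) (GenG m2) en1 om2 m12 n10 m20.
have Z2 := zprod (GenG m2) (GenW s n1) om2 en1 m21 m20 n10.
rewrite /= in Z1 Z2; rewrite Z1 Z2 m21 subrr c0 in E.
by move/esym/eqP: E; rewrite mulf_eq0 intr_eq0 (negPf ms) /= => ->.
Qed.

(** Irreducibility connects the classes, possibly through the vector of weight
   zero; but a passage u u' through it differs from the commutator of u and u'
   by a product u' u that avoids it, so the classes are already connected
   without it. *)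
Lemma cosets_connected (T : pred cls) c1 c2 : cclosed T ->
  T c1 -> csupp P lam c1 -> csupp P lam c2 -> T c2.
Proof.
move=> cT Tc1 Sc1 Sc2; apply: contraT => Tc2.
have [[k0 [Pk0 z0]]|nk0] := pselect (exists k0, P k0 /\ ~~ wnz lam k0); last first.
  have allnz k : P k -> wnz lam k.
    by move=> Pk; apply: contraT => nk; case: nk0; exists k.
  have [] := @gco_irr (fun k => wnz lam k && T (par k)).
  - move=> u k vu Pk /andP[nk Tk] u0; have [_ Pk'] := gco_supp u0.
    by rewrite allnz //= => /negP; apply; apply: cclosed_gco => //; apply: allnz.
  - case/asboolP: Sc1 => k [kc nk Pk] /(_ k Pk).
    by rewrite nk kc Tc1.
  - case/asboolP: Sc2 => k [kc nk Pk] /(_ k Pk).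
    by rewrite nk kc (negPf Tc2).
have [u [u' [[vu vu'] dd [u0 u'0] [Tk Tk'] [nk nk']]]] :=
  passage cT cT Tc1 Sc1 Tc2 Sc2 Pk0 z0.
have nz0 k : k != k0 -> wnz lam k.
  by apply: contraR => nk1; apply/eqP; apply: wt_zero_uniq.
set k := k0 - gdeg u' in u'0 Tk nk.
have kE : k + gdeg u' = k0 by rewrite /k subrK.
have nku : wnz lam (k + gdeg u).
  by apply: nz0; rewrite -kE (inj_eq (addrI k)).
have esc v j : gval v -> wnz lam j -> wnz lam (j + gdeg v) -> T (par j) ->
    ~~ T (par (j + gdeg v)) -> gco v j = 0.
  move=> vv nj nj' Tj; apply: contraNeq => v0; exact: cclosed_gco.
have tE : k + gdeg u + gdeg u' = k0 + gdeg u by rewrite addrAC kE.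
have Z : gco u' (k + gdeg u) * gco u k = 0.
  have [->|uk] := eqVneq (gco u k) 0; first by rewrite mulr0.
  by rewrite esc ?mul0r ?tE //; apply: cclosed_gco.
have zG m : ~~ evn m -> k + m = k0 + gdeg u -> g m k = 0.
  by move=> om mE; apply: (esc (GenG m)); rewrite //= mE.
have : gco u k0 * gco u' k != 0 by rewrite mulf_neq0.
have kE' : k + (gdeg u' + gdeg u) = k0 + gdeg u by rewrite addrA kE.
have kE'' : k + (gdeg u + gdeg u') = k0 + gdeg u by rewrite addrA tE.
move: Z zG Tk' vu vu' kE kE' kE'' Tk; rewrite /k; clear -H.
case: u => [s n|m]; case: u' => [t n'|m'] /= Z zG Tk' vu vu' kE kE' kE'' Tk.
- by move: Tk'; rewrite parDe // -(parBe k0 vu') Tk.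
- have E := q_WG H s (k0 - m') vu vu'.
  have G0 : g (m' + n) (k0 - m') = 0 by apply: zG; rewrite ?evnD.
  by rewrite kE Z subr0 G0 mulr0 in E; rewrite E eqxx.
- have E := q_WG H t (k0 - n') vu' vu.
  have G0 : g (m + n') (k0 - n') = 0 by apply: zG; rewrite ?evnD.
  by move/eqP: E; rewrite kE Z sub0r G0 mulr0 oppr_eq0 => ->.
- have E := q_GG H (k0 - m') vu vu'; rewrite kE Z subr0 in E; rewrite E.
  have [em|om] := boolP (evn (m + m')); last by rewrite (zG (m + m')) // mulr0 eqxx.
  by rewrite qcc_evn // mul0r eqxx.
Qed.

End Passage.

(** * Structure constants of the odd part *)

Section StructureConstants.
Variable F : numFieldType.
Variables (P : pred Z2) (f : bool -> Z2 -> Z2 -> F) (g : Z2 -> Z2 -> F).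
Variables (lam : bool -> F).
Hypothesis H : qrep P f g lam.

(** Along a nonzero step the density weight stays or grows by one, and each
   class can be reached from each other one. *)
Lemma coset_weights_const (b : cls -> F) :
  (forall s n k, evn n -> wnz lam k -> wnz lam (k + n) ->
    csupp P lam (par k) -> f s n k = wt lam s k + b (par k) * (crd s n)%:~R) ->
  forall c1 c2, csupp P lam c1 -> csupp P lam c2 -> b c1 = b c2.
Proof.
move=> N.
have above c1 c2 : csupp P lam c1 -> csupp P lam c2 ->
    exists j : nat, b c2 = b c1 + j%:R.
  move=> S1 S2; pose T c := csupp P lam c && `[< exists j : nat, b c = b c1 + j%:R >].
  have T1 : T c1 by rewrite /T S1; apply/asboolP; exists 0%N; rewrite addr0.
  have cT : cclosed g lam T.
    move=> m k om nk nkm /andP[ck /asboolP[j bj]] gk.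
    have [Pk Pkm] := gco_supp H (u := GenG m) gk.
    have ckm : csupp P lam (par (k + m)) by rewrite -(csupp_full H).
    rewrite /T ckm; apply/asboolP.
    have [->|->] := edge_weights H N om nk nkm ck ckm gk; first by exists j.
    by exists j.+1; rewrite bj -natr1 addrA.
  by have /andP[_ /asboolP] := cosets_connected H cT T1 S1 S2.
move=> c1 c2 S1 S2; have [j bj] := above c1 c2 S1 S2.
have [j' bj'] := above c2 c1 S2 S1.
move/eqP: bj'; rewrite bj -addrA -natrD -subr_eq0 opprD addNKr oppr_eq0.
by rewrite pnatr_eq0 addn_eq0 => /andP[/eqP -> _]; rewrite addr0.
Qed.

Variable B : F.
Hypothesis N : forall s n k, evn n -> wnz lam k -> wnz lam (k + n) ->
  csupp P lam (par k) -> f s n k = wt lam s k + B * (crd s n)%:~R.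

Local Notation wdt := (wdet lam).
Local Notation zdt := (zdet F).

Lemma zdetD n n' m : zdt (n + n') m = zdt n m + zdt n' m.
Proof. by rewrite /zdet /= !intrD; ring. Qed.

Lemma zdetN n m : zdt (- n) m = - zdt n m.
Proof. by rewrite /zdet /= !intrN; ring. Qed.

Lemma zdetmm m : zdt m m = 0.
Proof. by rewrite /zdet; ring. Qed.

Lemma g_shift k m n : evn n -> ~~ evn m -> wnz lam k -> wnz lam (k + m) ->
  wnz lam (k + n) -> wnz lam (k + m + n) ->
  csupp P lam (par k) -> csupp P lam (par (k + m)) ->
  wdt k m + B * zdt n m != 0 -> g m (k + n) = g m k /\ g (m + n) k = g m k.
Proof.
move=> en om nk nkm nkn nkmn ck ckm d0.
have [E1 E2] := @cramer _ P f g lam (fun=> B) H N k m n en om nk nkm nkn nkmn ck ckm.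
split; apply: (mulfI d0); first exact: E1.
by rewrite E2; congr (_ * _); ring.
Qed.

Let tr (e : Z2) (t : int) : Z2 := dbl (t * e.1, t * e.2).

Lemma transverse_unit (m : Z2) : ~~ evn m ->
  exists e z, z != 0 /\ forall t, zdt (tr e t) m = t%:~R * z.
Proof.
move=> om; have [m20|m20] := eqVneq m.2 0.
  exists (0, 1), (- (2 * m.1%:~R)); split.
    rewrite oppr_eq0 mulf_neq0 ?pnatr_eq0 // intr_eq0.
    by apply: contraNneq om => m10; rewrite evnE m10 m20.
  by move=> t; rewrite /zdet /= !intrM; ring.
exists (1, 0), (2 * m.2%:~R); split.
  by rewrite mulf_neq0 ?pnatr_eq0 // intr_eq0.
by move=> t; rewrite /zdet /= !intrM; ring.
Qed.

Lemma avoid_affine (a z : F) (t : int) : z != 0 -> t%:~R != - a / z ->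
  a + t%:~R * z != 0.
Proof.
move=> z0; apply: contraNneq => h.
by apply/eqP/(mulIf z0); rewrite divfK //; apply/eqP; rewrite -addr_eq0 addrC h.
Qed.

(** Once the density weights agree, Cramer's equations give g m (k + n) = g m k
   when their determinant does not vanish. A transverse even step from k leads
   to a point from which both k and k' are reached generically. *)
Lemma g_const_source m k k' : ~~ evn m -> par k = par k' ->
  wnz lam k -> wnz lam (k + m) -> wnz lam k' -> wnz lam (k' + m) ->
  csupp P lam (par k) -> csupp P lam (par (k + m)) -> g m k = g m k'.
Proof.
move=> om pk nk nkm nk' nkm' ck ckm.
have [e [z [z0 zE]]] := transverse_unit om.
have ckm' : csupp P lam (par (k' + m)) by rewrite parD -pk -parD.
have ev (j j' : Z2) : par j = par j' -> evn (j - j').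
  by move=> pj; rewrite /evn parB pj kaddcc.
have et t : evn (tr e t) := evn_dbl _.
have nz1 t : wdt k m + t%:~R * z != 0 ->
    wnz lam (k + tr e t) /\ wnz lam (k + tr e t + m).
  move=> h; split; apply: (@wdet_nz _ _ _ m); first by rewrite wdetD zE.
  by rewrite !wdetD zE zdetmm addr0.
have [B0|B0] := eqVneq B 0.
  have [t] := int_avoid [:: - wdt k m / z]; rewrite inE => /(avoid_affine z0) h.
  have [n1 n2] := nz1 t h.
  have back j : par j = par k -> wnz lam j -> wnz lam (j + m) ->
      g m (k + tr e t) = g m j.
    move=> pj nj njm.
    have jE : k + tr e t + (j - (k + tr e t)) = j by rewrite addrC subrK.
    have jE' : k + tr e t + m + (j - (k + tr e t)) = j + m.
      by rewrite addrAC jE.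
    have [] := @g_shift (k + tr e t) m (j - (k + tr e t)); rewrite ?jE ?jE' //.
    - by apply: ev; rewrite parDe.
    - by rewrite parDe.
    - by rewrite parD parDe // -parD.
    by rewrite B0 mul0r addr0 wdetD zE.
  by rewrite -(back k) // -(back k').
have Bz0 : B * z != 0 by rewrite mulf_neq0.
have [t] := int_avoid [:: - wdt k m / z; - wdt k m / (B * z);
  - (wdt k' m + B * zdt (k - k') m) / (B * z)].
rewrite !inE !negb_or => /and3P[/(avoid_affine z0) h1].
move=> /(avoid_affine Bz0) h2 /(avoid_affine Bz0) h3.
have [n1 n2] := nz1 t h1.
have n3 : wnz lam (k + m + tr e t) by rewrite addrAC.
have d3 : wdt k m + B * zdt (tr e t) m != 0 by rewrite zE mulrCA.
have [<- _] := g_shift (et t) om nk nkm n1 n3 ck ckm d3.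
have kE : k' + (k + tr e t - k') = k + tr e t by rewrite addrC subrK.
have [] := @g_shift k' m (k + tr e t - k'); rewrite ?kE //.
- by apply: ev; rewrite parDe.
- by rewrite addrAC kE.
- by rewrite -pk.
have -> : k + tr e t - k' = k - k' + tr e t by rewrite addrAC.
by rewrite zdetD zE mulrDr addrA mulrCA.
Qed.

(** After moving the source to a generic point, the step can be changed by the
   second of Cramer's equations. *)
Lemma g_const m m' k k' : ~~ evn m -> par k = par k' -> par m = par m' ->
  wnz lam k -> wnz lam (k + m) -> wnz lam k' -> wnz lam (k' + m') ->
  csupp P lam (par k) -> csupp P lam (par (k + m)) -> g m k = g m' k'.
Proof.
move=> om pk pm nk nkm nk' nkm' ck ckm.
have [e [z [z0 zE]]] := transverse_unit om.
have om' : ~~ evn m' by rewrite /evn -pm.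
have [t] := int_avoid [:: - wdt k m / z; - (wdt k m + zdt m' m) / z;
  - (wdt k m + B * zdt (m' - m) m) / z].
rewrite !inE !negb_or => /and3P[/(avoid_affine z0) h1].
move=> /(avoid_affine z0) h2 /(avoid_affine z0) h3.
pose k1 := k + tr e t.
have pk1 : par k1 = par k by rewrite parDe // evn_dbl.
have nz1 j a : zdt j m = a -> wdt k m + a + t%:~R * z != 0 -> wnz lam (k1 + j).
  by move=> ja h; apply: (@wdet_nz _ _ _ m); rewrite !wdetD zE ja addrAC.
have n1 : wnz lam k1 by apply: (@wdet_nz _ _ _ m); rewrite wdetD zE.
have n2 : wnz lam (k1 + m) by apply: (nz1 _ 0); rewrite ?zdetmm ?addr0.
have n3 : wnz lam (k1 + m') by apply: (nz1 _ _ erefl).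
have n4 : wnz lam (k1 + (m' - m)).
  by apply: (nz1 _ (zdt m' m)); rewrite // zdetD zdetN zdetmm subr0.
have ckm1 : csupp P lam (par (k1 + m)) by rewrite parD pk1 -parD.
rewrite (@g_const_source m k k1) //.
rewrite (@g_const_source m' k' k1) //; last first.
- by rewrite parD -pk -pm -parD.
- by rewrite -pk.
- by rewrite pk1.
have [] := @g_shift k1 m (m' - m); rewrite ?pk1 //.
- by rewrite /evn parB pm kaddcc.
- by rewrite [m' - m]addrC addrA addrK.
- by rewrite wdetD zE addrAC.
by rewrite [m + _]addrC subrK => _ ->.
Qed.

Lemma generic_point c (ms : seq Z2) : exists k, par k = c /\
  forall m, m \in ms -> wnz lam (k + m).
Proof.
have two0 : 2 != 0 :> F by rewrite pnatr_eq0.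
have [t tP] := int_avoid [seq - (lam false + (lft c).1%:~R + m.1%:~R) / 2 | m <- ms].
exists (lft c + dbl (t, 0)); split=> [|m mms]; first exact: par_lft.
have tm : t%:~R != - (lam false + (lft c).1%:~R + m.1%:~R) / 2.
  by apply: contraNneq tP => ->; apply/mapP; exists m.
rewrite /wnz /wt /=; apply/orP; left; move/(avoid_affine two0): tm.
by congr (_ != 0); rewrite /lft /= !intrD intrM; ring.
Qed.

Lemma structure_constants : exists sig : cls -> cls -> F,
  (forall m k, ~~ evn m -> wnz lam k -> wnz lam (k + m) ->
     g m k = sig (par k) (par m)) /\
  (forall c d, ~~ (csupp P lam c && csupp P lam (kadd c d)) -> sig c d = 0).
Proof.
have ex (cd : cls * cls) : exists x : F,
  (forall m k, ~~ evn m -> wnz lam k -> wnz lam (k + m) ->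
     par k = cd.1 -> par m = cd.2 -> g m k = x) /\
  (~~ (csupp P lam cd.1 && csupp P lam (kadd cd.1 cd.2)) -> x = 0).
  case: cd => c d /=; have [cs|ncs] := boolP (_ && _); last first.
    exists 0; split=> // m k om nk nkm pk pm; apply: (q_gsupp H).
    by rewrite !(csupp_full H) // parD pk pm.
  have [[m [k [om nk nkm pk pm]]]|nE] := pselect (exists m k, [/\ ~~ evn m,
    wnz lam k, wnz lam (k + m), par k = c & par m = d]).
    exists (g m k); split=> // m' k' om' nk' nkm' pk' pm'.
    case/andP: cs => cs1 cs2; apply: g_const => //; rewrite ?pk ?pm ?pk' //.
    by rewrite parD pk' pm'.
  by exists 0; split=> // m k om nk nkm pk pm; case: nE; exists m, k.
have [sig sigP] := choice ex.
exists (fun c d => sig (c, d)); split=> [m k om nk nkm|c d].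
  by have [h _] := sigP (par k, par m); apply: h.
by have [_ h] := sigP (c, d); apply: h.
Qed.

Variable sig : cls -> cls -> F.
Hypothesis sigE : forall m k, ~~ evn m -> wnz lam k -> wnz lam (k + m) ->
  g m k = sig (par k) (par m).

Lemma par_lft0 c : par (lft c) = c.
Proof. by have := par_lft c 0; rewrite -[dbl 0]/(0 : Z2) addr0. Qed.

(** Classes are lifted to steps from a point such that no weight involved
   vanishes. *)
Lemma sig_bracket c d d' : d != (false, false) -> d' != (false, false) ->
  d != d' ->
  sig (kadd c d') d * sig c d' - sig (kadd c d) d' * sig c d
  = qcc F d d' * sig c (kadd d d').
Proof.
move=> d0 d'0 dd'; pose m := lft d; pose m' := lft d'.
have [k [pk nk]] := generic_point c [:: 0; m; m'; m + m'].
have om : ~~ evn m by rewrite /evn par_lft0.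
have om' : ~~ evn m' by rewrite /evn par_lft0.
have omm : ~~ evn (m + m').
  rewrite /evn parD !par_lft0; apply: contra_neq dd' => h.
  by rewrite -(kaddK d d') h kaddC kadd0.
have n0 : wnz lam k by have := nk 0; rewrite addr0; apply; rewrite inE eqxx.
have n1 : wnz lam (k + m) by apply: nk; rewrite !inE eqxx ?orbT.
have n2 : wnz lam (k + m') by apply: nk; rewrite !inE eqxx ?orbT.
have n3 : wnz lam (k + m + m') by rewrite -addrA; apply: nk; rewrite !inE eqxx ?orbT.
have n4 : wnz lam (k + m' + m) by rewrite addrAC.
have := q_GG H k om om'; rewrite !sigE ?addrA //.
by rewrite !parD !par_lft0 pk.
Qed.

Lemma sig_connected (T : pred cls) c1 c2 :
  (forall c d, d != (false, false) -> T c -> sig c d != 0 -> T (kadd c d)) ->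
  T c1 -> csupp P lam c1 -> csupp P lam c2 -> T c2.
Proof.
move=> cT; apply: (cosets_connected H) => m k om nk nkm Tk.
by rewrite sigE // parD; apply: cT.
Qed.

End StructureConstants.

(** * Modules over sl_2 graded by the Klein four-group *)

Section KleinGraded.
Variable F : numFieldType.
Variables (S : pred cls) (sig : cls -> cls -> F).
Hypothesis supp : forall c d, ~~ (S c && S (kadd c d)) -> sig c d = 0.
Hypothesis rel : forall c d d', d != (false, false) -> d' != (false, false) ->
  d != d' ->
  sig (kadd c d') d * sig c d' - sig (kadd c d) d' * sig c d
  = qcc F d d' * sig c (kadd d d').
Hypothesis conn : forall (T : pred cls) c1 c2,
  (forall c d, d != (false, false) -> T c -> sig c d != 0 -> T (kadd c d)) ->
  T c1 -> S c1 -> S c2 -> T c2.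

Local Notation c00 := (false, false).
Local Notation c10 := (true, false).
Local Notation c01 := (false, true).
Local Notation c11 := (true, true).

(** The classes d != 0 index a basis of sl_2 with bracket [d, d'] = qcc d d' (d
   + d'), and sig c d is the coefficient of d on the line of class c. The square
   of d preserves this line; sq is its eigenvalue. *)
Definition sq (d c : cls) : F := sig (kadd c d) d * sig c d.
(** The square of the monomial of class d, in the quotient of the torus where
   x_1 and x_2 have square 1. *)
Definition sgn (d : cls) : F := eps F (d.1 && d.2).

Lemma sgn_neq0 d : sgn d != 0.
Proof. by rewrite /sgn /eps; case: ifP => _; rewrite ?oppr_eq0 oner_eq0. Qed.

Lemma sqD d c : sq d (kadd c d) = sq d c.
Proof. by rewrite /sq kaddK mulrC. Qed.

(** This is [d, [d, d']] = 4 sgn d d' applied to the line c. *)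
Lemma double_bracket c d d' : d != c00 -> d' != c00 -> d != d' ->
  sig c d' * (sq d c + sq d (kadd c d') - 4 * sgn d)
  = 2 * sig (kadd (kadd c d) d') d * sig (kadd c d) d' * sig c d.
Proof.
move=> d0 d'0 dd'.
have E1 := rel c d0 d'0 dd'; have E2 := rel (kadd c d) d0 d'0 dd'.
have e0 : kadd d d' != c00.
  by move: d0 d'0 dd'; case: (d) => [[] []]; case: (d') => [[] []].
have de : d != kadd d d'.
  by move: d0 d'0 dd'; case: (d) => [[] []]; case: (d') => [[] []].
have E3 := rel c d0 e0 de.
have k1 : kadd d (kadd d d') = d' by rewrite kaddC [kadd d d']kaddC kaddK.
have k2 : kadd c (kadd d d') = kadd (kadd c d) d' by rewrite kaddA.
have k3 : kadd (kadd c d') d = kadd (kadd c d) d' by rewrite -!kaddA (kaddC d').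
rewrite k1 k2 in E3; rewrite kaddK in E2.
have s4 : qcc F d d' * qcc F d (kadd d d') = 4 * sgn d.
  move: d0 d'0 dd'; rewrite /qcc /sgn /eps.
  by case: (d) => [[] []]; case: (d') => [[] []] //= _ _ _; ring.
rewrite -s4 /sq k3.
apply: (lincomb3 (c := sig (kadd (kadd c d) d') d) (c' := - sig c d)
  (c'' := qcc F d d') E1 E2 E3); ring.
Qed.

(** The square roots of the two eigenvalues can be chosen to differ by 2
   sqrt(sgn d), the eigenvalue of ad d. The relation follows from double_bracket
   at c and at c + d. *)
Lemma sq_pair c d d' : d != c00 -> d' != c00 -> d != d' -> sig c d' != 0 ->
  (sq d c + sq d (kadd c d') - 4 * sgn d) ^+ 2 = 4 * sq d c * sq d (kadd c d').
Proof.
move=> d0 d'0 dd' s0; have E1 := double_bracket c d0 d'0 dd'.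
have E2 := double_bracket (kadd c d) d0 d'0 dd'.
have k3 : kadd (kadd c d') d = kadd (kadd c d) d' by rewrite -!kaddA (kaddC d').
rewrite sqD -k3 sqD kaddK in E2.
apply: (mulfI s0); rewrite -k3 in E1.
move: E1 E2; set w := _ + _ - _ => E1 E2.
apply: (lincomb2 (c := w) (c' := 2 * sig (kadd (kadd c d') d) d * sig c d) E1 E2).
by rewrite /sq; ring.
Qed.

(** By connectedness some d' sends a line of class c1 or c1 + d to one of class
   c2 or c2 + d with a nonzero coefficient, and sq d takes the same value on
   both classes of each pair. *)
Lemma sq_cross d c1 c2 : d != c00 -> S c1 -> S c2 -> c2 != c1 -> c2 != kadd c1 d ->
  (sq d c1 + sq d c2 - 4 * sgn d) ^+ 2 = 4 * sq d c1 * sq d c2.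
Proof.
move=> d0 S1 S2 n1 n2; apply: contrapT => nE.
pose T c := (c == c1) || (c == kadd c1 d).
suff /(conn (T := T)) : forall c d', d' != c00 -> T c -> sig c d' != 0 ->
    T (kadd c d').
  move=> /(_ c1 c2); rewrite /T eqxx /= => /(_ isT S1 S2).
  by rewrite (negPf n1) (negPf n2).
move=> c d' d'0 Tc s0.
have [->|dd'] := eqVneq d' d.
  by move: Tc; rewrite /T => /orP[] /eqP ->; rewrite ?kaddK eqxx ?orbT.
have dd : d != d' by rewrite eq_sym.
case: nE; have := sq_pair d0 d'0 dd s0.
have -> : sq d c = sq d c1 by move: Tc; rewrite /T => /orP[] /eqP ->; rewrite ?sqD.
have [-> //|->] : kadd c d' = c2 \/ kadd c d' = kadd c2 d; last by rewrite sqD.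
move: Tc n1 n2 d0 d'0 dd; rewrite /T.
case: (c) => [[] []]; case: (c1) => [[] []]; case: (d) => [[] []];
  case: (d') => [[] []] //=; case: (c2) => [[] []] //=; by [left | right].
Qed.

(** The squares of the basis of sl_2 weighted by sgn add up to a multiple of the
   Casimir element. *)
Definition casimir c : F := sq c10 c + sq c01 c - sq c11 c.

(** This is [d, d' d'] = qcc d d' (d' (d + d') + (d + d') d') applied to the
   line c, products being composites of operators. *)
Lemma sq_bracket c d d' : d != c00 -> d' != c00 -> d != d' ->
  sig c d * (sq d' c - sq d' (kadd c d)) = qcc F d d' *
    (sig (kadd c (kadd d d')) d' * sig c (kadd d d')
     + sig (kadd c d') (kadd d d') * sig c d').
Proof.
move=> d0 d'0 dd'.
have E1 := rel c d0 d'0 dd'; have E2 := rel (kadd c d') d0 d'0 dd'.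
have k3 : kadd (kadd c d') d = kadd (kadd c d) d' by rewrite -!kaddA (kaddC d').
rewrite kaddK k3 in E2; rewrite /sq kaddA.
apply: (lincomb2 (c := sig (kadd (kadd c d) d') d') (c' := sig c d') E1 E2).
by ring.
Qed.

Lemma casimir_edge c d : d != c00 -> sig c d != 0 ->
  casimir (kadd c d) = casimir c.
Proof.
move=> d0 s0; apply: (mulfI s0).
pose d' := if d == c10 then c01 else c10.
have [d'0 dd' e0 de] : [/\ d' != c00, d != d', kadd d d' != c00 & d != kadd d d'].
  by move: d0; rewrite /d'; case: (d) => [[] []].
have E1 := sq_bracket c d0 d'0 dd'; have E2 := sq_bracket c d0 e0 de.
have k1 : kadd d (kadd d d') = d' by rewrite kaddC [kadd d d']kaddC kaddK.
rewrite k1 in E2; move: E1 E2; rewrite /casimir /d' {k1 de e0 dd' d'0 d' s0}.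
by case: d d0 => [[] []] // _; rewrite ?sqD /qcc /eps /= => E1 E2;
  [apply: (lincomb2 (c := -1) (c' := -1) E1 E2)
  |apply: (lincomb2 (c := -1) (c' := 1) E1 E2)
  |apply: (lincomb2 (c := -1) (c' := 1) E1 E2)]; ring.
Qed.

Lemma casimir_const c1 c2 : S c1 -> S c2 -> casimir c1 = casimir c2.
Proof.
move=> S1 S2; have := @conn (fun c => casimir c == casimir c1) c1 c2.
move=> /(_ _ (eqxx _) S1 S2) h; apply/esym/eqP; apply: h => c d d0 /eqP ch sc.
by rewrite casimir_edge // ch.
Qed.

(** If S had exactly two elements c and c + d', then sq d would vanish on both
   for d distinct from d', and sq_cross would read 16 = 0. *)
Lemma support_size : (exists c, S c) ->
  [\/ exists kap, forall c, S c = (c == kap),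
      exists kap, forall c, S c = (c != kap) | forall c, S c].
Proof.
move=> [c0 Sc0].
have two c1 d d' : d != c00 -> d' != c00 -> d != d' -> S c1 -> S (kadd c1 d') ->
    ~~ S (kadd c1 d) -> ~~ S (kadd (kadd c1 d') d) -> False.
  move=> d0 d'0 dd' S1 S2 n1 n2.
  have := @sq_cross d c1 (kadd c1 d') d0 S1 S2.
  have z1 : sq d c1 = 0 by rewrite /sq [sig c1 d]supp ?mulr0 // negb_and n1 orbT.
  have z2 : sq d (kadd c1 d') = 0.
    by rewrite /sq [sig (kadd c1 d') d]supp ?mulr0 // negb_and n2 orbT.
  rewrite z1 z2 !mulr0 addr0 sub0r => h; move: h.
  have -> : (- (4 * sgn d)) ^+ 2 = 16 :> F.
    by rewrite /sgn /eps; case: ifP => _; ring.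
  move=> h; have {}h : (16 : F) = 0.
    apply: h; move: d0 d'0 dd'; case: (c1) => [[] []];
      by case: (d) => [[] []]; case: (d') => [[] []].
  by move/eqP: h; rewrite pnatr_eq0.
case h1: (S c00); case h2: (S c10); case h3: (S c01); case h4: (S c11).
- by apply: Or33 => -[[] []].
- by apply: Or32; exists c11 => -[[] []].
- by apply: Or32; exists c01 => -[[] []].
- by exfalso; apply: (two c00 c01 c10); rewrite ?h1 ?h2 ?h3 ?h4.
- by apply: Or32; exists c10 => -[[] []].
- by exfalso; apply: (two c00 c10 c01); rewrite ?h1 ?h2 ?h3 ?h4.
- by exfalso; apply: (two c00 c10 c11); rewrite ?h1 ?h2 ?h3 ?h4.
- by apply: Or31; exists c00 => -[[] []].
- by apply: Or32; exists c00 => -[[] []].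
- by exfalso; apply: (two c10 c10 c11); rewrite ?h1 ?h2 ?h3 ?h4.
- by exfalso; apply: (two c10 c10 c01); rewrite ?h1 ?h2 ?h3 ?h4.
- by apply: Or31; exists c10 => -[[] []].
- by exfalso; apply: (two c01 c01 c10); rewrite ?h1 ?h2 ?h3 ?h4.
- by apply: Or31; exists c01 => -[[] []].
- by apply: Or31; exists c11 => -[[] []].
- by move: Sc0; case: c0 => [[] []]; rewrite ?h1 ?h2 ?h3 ?h4.
Qed.

(** Constancy of the Casimir element makes every sq d constant, equal to y say,
   and sq_cross becomes (2 y - 4 sgn d)^2 = 4 y^2. *)
Lemma full_sq : (forall c, S c) -> forall d c, d != c00 -> sq d c = sgn d.
Proof.
move=> Sall.
have G1 := casimir_const (Sall c00) (Sall c10).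
have G2 := casimir_const (Sall c00) (Sall c01).
have G3 := casimir_const (Sall c00) (Sall c11).
have A1 : sq c10 c10 = sq c10 c00 := sqD c10 c00.
have A2 : sq c10 c11 = sq c10 c01 := sqD c10 c01.
have B1 : sq c01 c01 = sq c01 c00 := sqD c01 c00.
have B2 : sq c01 c11 = sq c01 c10 := sqD c01 c10.
have C1 : sq c11 c11 = sq c11 c00 := sqD c11 c00.
have C2 : sq c11 c01 = sq c11 c10 := sqD c11 c10.
have two0 : (2 : F) != 0 by rewrite pnatr_eq0.
rewrite /casimir A1 ?A2 ?B1 ?B2 ?C1 ?C2 in G1 G2 G3.
have Ea : sq c10 c01 = sq c10 c00.
  apply: (mulfI two0).
  by apply: (lincomb3 (c := 1) (c' := -1) (c'' := -1) G1 G2 G3); ring.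
have Ee : sq c11 c10 = sq c11 c00.
  by apply: (lincomb2 (c := 1) (c' := 1) G2 Ea); ring.
have Eb : sq c01 c10 = sq c01 c00.
  by apply: (lincomb2 (c := -1) (c' := 1) G1 Ee); ring.
have fin d c : d != c00 -> c != c00 -> c != d -> sq d c = sq d c00 ->
    sq d c00 = sgn d.
  move=> d0 c0 cd h; have := sq_cross d0 (Sall c00) (Sall c) c0.
  have -> : kadd c00 d = d by case: (d) => [[] []].
  move=> /(_ cd); rewrite h => E.
  have s2 : sgn d * sgn d = 1 by rewrite /sgn /eps; case: ifP => _; ring.
  apply: (mulfI (_ : 16 * sgn d != 0)).
    rewrite mulf_neq0 ?pnatr_eq0 //; apply: contraTneq (oner_neq0 F) => s0.
    by rewrite -s2 s0 mul0r eqxx.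
  by apply: (lincomb1 (c := -1) E); ring.
have F1 : sq c10 c00 = sgn c10 by apply: (fin c10 c01).
have F2 : sq c01 c00 = sgn c01 by apply: (fin c01 c10).
have F3 : sq c11 c00 = sgn c11 by apply: (fin c11 c10).
by case=> [[] []] // [[] []] _;
   rewrite ?A1 ?A2 ?B1 ?B2 ?C1 ?C2 ?Ea ?Eb ?Ee ?F1 ?F2 ?F3.
Qed.

(** Number the classes 1 = (1,0), 2 = (0,1), 3 = (1,1); t_cd is the coefficient
   of the operator d on the line c, when those leaving the class 0 are 1.
   Products are given by sq, differences by the commutators. Eliminating t12,
   t13 and t23 leaves 3 (t21 - 1)^2 = 0 as a combination of the products. *)
Lemma regular_entries (t21 t12 t31 t13 t32 t23 : F) :
  t21 * t31 = 1 -> t12 * t32 = 1 -> t13 * t23 = -1 ->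
  t21 - t12 = 2 -> t32 - t23 = -2 -> t31 - t13 = 2 ->
  [/\ t21 = 1, t12 = -1, t31 = 1, t13 = -1 & t32 = -1 /\ t23 = 1].
Proof.
move=> h1 h2 h3 h4 h5 h6.
have {h4} E12 : t12 = t21 - 2 by rewrite -h4; ring.
have {h6} E13 : t13 = t31 - 2 by rewrite -h6; ring.
have {h5} E23 : t23 = t32 + 2 by apply: (lincomb1 (c := -1) h5); ring.
rewrite E12 E13 E23 in h2 h3 *.
have x1 : (t21 - 1) ^+ 2 = 0.
  apply: (mulfI (_ : 3 != 0)); first by rewrite pnatr_eq0.
  apply: (lincomb3 (c := 2 * t21 - 3 + ((t21 - 2) * t32 - 1)) (c' := 1 - 2 * t21)
    (c'' := - t21 * (t21 - 2)) h1 h2 h3).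
  by ring.
have {x1} x1 : t21 = 1 by apply/eqP; rewrite -subr_eq0 -sqrf_eq0 x1.
move: h1 h2 h3; rewrite x1 mul1r => -> h2 _.
have -> : t32 = -1 by apply: (lincomb1 (c := -1) h2); ring.
by split=> //; try split; ring.
Qed.

(** The coefficient of x^d on v_c in A_{a,alpha,b} at q = -1. *)
Definition reg_coef (a : bool) (c d : cls) : F :=
  eps F (d.2 && c.1) - a%:R * eps F (d.1 && c.2).

(** The class kap plays the part of the class 0 of the model; when a is 1, that
   class carries the trivial module and the three others the adjoint one. *)
Definition normalizes a kap (u : cls -> F) := (forall c, u c != 0) /\
  forall c d, d != c00 -> S c ->
    sig c d * u c = reg_coef a (kadd c kap) d * u (kadd c d).

Lemma normalize_full : (forall c, S c) -> exists u, normalizes false c00 u.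
Proof.
move=> Sall.
have pd := full_sq Sall.
have sn d : d != c00 -> sig c00 d != 0.
  move=> d0; have := pd d c00 d0; rewrite /sq; apply: contra_eq_neq => ->.
  by rewrite mulr0 eq_sym sgn_neq0.
pose u c := if c == c00 then 1 else sig c00 c.
have u0 c : u c != 0.
  by rewrite /u; case: (eqVneq c c00) => [_|c0]; [exact: oner_neq0 | exact: sn].
exists u; split=> //.
pose t c d := sig c d * u c / u (kadd c d).
suff tE : forall c d, d != c00 -> t c d = reg_coef false c d.
  by move=> c d d0 _; rewrite kadd0 -tE // /t divfK.
have sgnE d : sgn d = reg_coef false d d.
  by rewrite /sgn /reg_coef mul0r subr0 andbC.
have t0 d : d != c00 -> t c00 d = 1.
  move=> d0; rewrite /t /u eqxx mulr1 (negPf (_ : kadd c00 d != c00)); last first.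
    by case: (d) d0 => [[] []].
  by rewrite (_ : kadd c00 d = d) ?divff ?sn //; case: (d) => [[] []].
have tt c d : d != c00 -> t c d * t (kadd c d) d = sgn d.
  move=> d0; rewrite -(pd d c d0) /t kaddK /sq; have := u0 c; have := u0 (kadd c d).
  by move=> a1 a2; field; rewrite a1 a2.
have tb d d' : d != c00 -> d' != c00 -> d != d' ->
    t d' d - t d d' = qcc F d d'.
  move=> d0 d'0 dd'; have E := rel c00 d0 d'0 dd'.
  have k0 e : kadd c00 e = e by case: (e) => [[] []].
  have uE e : e != c00 -> u e = sig c00 e by rewrite /u => /negPf ->.
  have dd0 : kadd d d' != c00.
    by move: d0 d'0 dd'; case: (d) => [[] []]; case: (d') => [[] []].
  have s0 := sn (kadd d d') dd0; rewrite !k0 in E.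
  rewrite /t [kadd d' d]kaddC !uE //; apply: (mulIf s0); rewrite -E; field.
  exact: s0.
have [] := @regular_entries (t c01 c10) (t c10 c01) (t c11 c10) (t c10 c11)
  (t c11 c01) (t c01 c11).
- by rewrite (tt c01 c10).
- by rewrite (tt c10 c01).
- by rewrite (tt c10 c11).
- by rewrite (tb c10 c01) // /qcc /eps /=; ring.
- by rewrite (tb c01 c11) // /qcc /eps /=; ring.
- by rewrite (tb c10 c11) // /qcc /eps /=; ring.
move=> e21 e12 e31 e13 [e32 e23] c d d0.
have [->|c0] := eqVneq c c00.
  by rewrite t0 // /reg_coef /eps /= andbF mul0r subr0.
have [->|cd] := eqVneq c d.
  by rewrite -sgnE -(tt c00 d d0) t0 // mul1r; case: (d) => [[] []].
move: c0 cd d0; case: c => [[] []] //; case: d => [[] []] // _ _ _;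
  by rewrite ?e21 ?e12 ?e31 ?e13 ?e32 ?e23 /reg_coef /eps /= mul0r subr0.
Qed.

Lemma normalize_single kap : (forall c, S c = (c == kap)) ->
  exists u, normalizes true kap u.
Proof.
move=> SE; exists (fun=> 1); split=> [c|c d d0]; first exact: oner_neq0.
rewrite SE => /eqP ->; rewrite supp; last first.
  rewrite !SE eqxx /=; move: d0; case: (d) => [[] []]; by case: (kap) => [[] []].
by rewrite kaddcc /reg_coef /= !andbF mul1r subrr !mul0r.
Qed.

(** On the pair of classes containing kap the square of d is 0, and on the other
   pair sq_cross then gives 4 sgn d, as in the adjoint representation. *)
Lemma normalize_triple kap : (forall c, S c = (c != kap)) ->
  exists u, normalizes true kap u.
Proof.
move=> SE.
have Sk d : d != c00 -> S (kadd kap d).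
  by rewrite SE; case: (d) => [[] []]; case: (kap) => [[] []].
have zero d : sig (kadd kap d) d = 0.
  by apply: supp; rewrite kaddK !SE eqxx andbF.
have sq4 d d' : d != c00 -> d' != c00 -> d != d' ->
    sig (kadd kap (kadd d d')) d * sig (kadd kap d') d = 4 * sgn d.
  move=> d0 d'0 dd'.
  have := @sq_cross d (kadd kap d) (kadd kap d') d0 (Sk d d0) (Sk d' d'0).
  have -> : sq d (kadd kap d) = 0 by rewrite /sq zero mulr0.
  rewrite add0r !mulr0 mul0r => E.
  have {}E : (sq d (kadd kap d') - 4 * sgn d) ^+ 2 = 0.
    by apply: E; move: d0 d'0 dd'; case: (d) => [[] []]; case: (d') => [[] []] //;
       case: (kap) => [[] []].
  move/eqP: E; rewrite sqrf_eq0 subr_eq0 => /eqP <-.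
  by rewrite /sq -kaddA [kadd d' d]kaddC.
pose k1 := kadd kap c10; pose k2 := kadd kap c01; pose k3 := kadd kap c11.
have s10 : sig k3 c10 * sig k2 c10 = 4 by rewrite (sq4 c10 c01) // /sgn mulr1.
have s01 : sig k3 c01 * sig k1 c01 = 4 by rewrite (sq4 c01 c10) // /sgn mulr1.
have s11 : sig k2 c11 * sig k1 c11 = -4.
  by rewrite (sq4 c11 c10) // /sgn mulrN1.
have four0 : (4 : F) != 0 by rewrite pnatr_eq0.
have n01 : sig k1 c01 != 0.
  by apply: contra_eq_neq s01 => ->; rewrite mulr0 eq_sym.
have n11 : sig k1 c11 != 0.
  by apply: contra_eq_neq s11 => ->; rewrite mulr0 eq_sym oppr_eq0.
have R := @rel k1 c10 c01 isT isT isT.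
have k13 : kadd k1 c01 = k3 by rewrite /k1 -kaddA.
have k1z : sig k1 c10 = 0 by apply: zero.
rewrite k13 k1z mulr0 subr0 /qcc /eps /= in R.
pose u c := if c == k2 then - sig k1 c11 / 2
  else if c == k3 then - sig k1 c01 / 2 else 1.
have two0 : (2 : F) != 0 by rewrite pnatr_eq0.
have m2 : - (2 : F)^-1 != 0 by rewrite oppr_eq0 invr_eq0.
have u0 c : u c != 0.
  rewrite /u; case: ifP => _; first by rewrite mulNr -mulrN mulf_neq0.
  by case: ifP => _; [rewrite mulNr -mulrN mulf_neq0 | apply: oner_neq0].
have u1 : u k1 = 1 by rewrite /u /k1 /k2 /k3; case: (kap) => [[] []].
have u2 : u k2 = - sig k1 c11 / 2 by rewrite /u eqxx.
have u3 : u k3 = - sig k1 c01 / 2.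
  by rewrite /u /k1 /k2 /k3 eqxx; case: (kap) => [[] []].
have Q13 : sig k1 c01 * u k1 = -2 * u k3 by rewrite u1 u3; field.
have Q12 : sig k1 c11 * u k1 = -2 * u k2 by rewrite u1 u2; field.
have Q32 : sig k3 c10 * u k3 = 2 * u k2.
  by rewrite u2 u3; apply: (lincomb1 (c := - 1 / 2) R); field.
have Q21 : sig k2 c11 * u k2 = 2 * u k1.
  by rewrite u1 u2; apply: (lincomb1 (c := - 1 / 2) s11); field.
have Q31 : sig k3 c01 * u k3 = -2 * u k1.
  by rewrite u1 u3; apply: (lincomb1 (c := - 1 / 2) s01); field.
have Q23 : sig k2 c10 * u k2 = 2 * u k3.
  apply: (mulfI two0).
  by apply: (lincomb2 (c := - sig k2 c10) (c' := u k3) Q32 s10); ring.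
exists u; split=> // c d d0 Sc.
have [e [e0 ->]] : exists e, e != c00 /\ c = kadd kap e.
  exists (kadd kap c); move: Sc; rewrite SE.
  by case: (c) => [[] []]; case: (kap) => [[] []].
have ke : kadd (kadd kap e) kap = e by rewrite (kaddC kap e) kaddK.
rewrite ke; have [<-|ed] := eqVneq e d.
  by rewrite zero /reg_coef /= [e.2 && _]andbC mul1r subrr !mul0r.
have kadde : kadd (kadd kap e) d = kadd kap (kadd e d) by rewrite kaddA.
rewrite kadde.
move: e0 d0 ed; rewrite {ke kadde Sc c}.
case: e => [[] []] //; case: d => [[] []] // _ _ _;
  rewrite /reg_coef /eps /=.
- by rewrite (_ : 1 - 1 * -1 = 2); [exact: Q32|ring].
- by rewrite (_ : -1 - 1 * 1 = -2); [exact: Q31|ring].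
- by rewrite (_ : -1 - 1 * 1 = -2); [exact: Q12|ring].
- by rewrite (_ : -1 - 1 * 1 = -2); [exact: Q13|ring].
- by rewrite (_ : 1 - 1 * -1 = 2); [exact: Q21|ring].
- by rewrite (_ : 1 - 1 * -1 = 2); [exact: Q23|ring].
Qed.

(** The trivial module, the adjoint module and the regular one, according to the
   size of the support. *)
Lemma klein_classification : (exists c, S c) -> exists a kap u,
  normalizes a kap u /\
  if a then (forall c, S c = (c == kap)) \/ (forall c, S c = (c != kap))
  else forall c, S c.
Proof.
move=> /support_size[[kap SE]|[kap SE]|SE].
- by have [u uP] := normalize_single SE; exists true, kap, u; split=> //; left.
- by have [u uP] := normalize_triple SE; exists true, kap, u; split=> //; right.
- by have [u uP] := normalize_full SE; exists false, c00, u.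
Qed.

End KleinGraded.

(** * Coefficients of the model *)

Lemma evn_mul t n : evn n -> evn (t * n.1, t * n.2).
Proof.
by move=> en; rewrite -(dbl_hlf en) /= ![t * _]mulrCA; apply: (evn_dbl (_, _)).
Qed.

Section ModelCoefficients.
Variable F : numFieldType.
Variables (lam : bool -> F) (a : bool) (kap : Z2) (B : F).

(** The coefficients of A_{a,alpha,b}, where alpha is lam shifted so that the
   index kap becomes the origin. *)
Definition aco u k : F := match u with
  | GenW s n => wt lam s k + B * (crd s n)%:~R
  | GenG m => reg_coef F a (par (k - kap)) (par m) end.

Definition gbracket (co : gen -> Z2 -> F) u u' k : F := match u, u' with
  | GenW s n, GenW t n' => (crd s n')%:~R * co (GenW t (n + n')) k
                           - (crd t n)%:~R * co (GenW s (n + n')) k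
  | GenW s n, GenG m => (crd s m)%:~R * co (GenG (m + n)) k
  | GenG m, GenW t n => - ((crd t m)%:~R * co (GenG (m + n)) k)
  | GenG m, GenG m' => qcc F (par m) (par m') * co (GenG (m + m')) k end.

Lemma par_sub_even k n : evn n -> par (k + n - kap) = par (k - kap).
Proof. by move=> en; rewrite addrAC (@parDe (k - kap)). Qed.

Lemma aco_bracket u u' k : gval u -> gval u' ->
  aco u (k + gdeg u') * aco u' k - aco u' (k + gdeg u) * aco u k
  = gbracket aco u u' k.
Proof.
case: u => [s n|m]; case: u' => [t n'|m'] /= vu vu'.
- by rewrite !wt_add; case: s t => [] []; rewrite /= !intrD; ring.
- by rewrite par_sub_even // (@parDe m' n) // wt_add; ring.
- by rewrite par_sub_even // (@parDe m n') // wt_add; ring.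
rewrite (addrAC k m') (addrAC k m) !(parD (k - kap)) (parD m) /reg_coef /qcc /eps /kadd.
move: (par (k - kap)) (par m) (par m') => [c1 c2] [d1 d2] [e1 e2] /=.
by case: (a); case: c1; case: c2; case: d1; case: d2; case: e1; case: e2 => /=; ring.
Qed.

End ModelCoefficients.

Section GBracket.
Variable F : numFieldType.
Variables (P : pred Z2) (f : bool -> Z2 -> Z2 -> F) (g : Z2 -> Z2 -> F).
Variables (lam : bool -> F).
Hypothesis H : qrep P f g lam.

Lemma gco_bracket u u' k : gval u -> gval u' ->
  gco f g u (k + gdeg u') * gco f g u' k - gco f g u' (k + gdeg u) * gco f g u k
  = gbracket (gco f g) u u' k.
Proof.
case: u => [s n|m]; case: u' => [t n'|m'] /= vu vu'.
- exact: (q_WW H).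
- exact: (q_WG H).
- by rewrite -(q_WG H) // opprB.
- exact: (q_GG H).
Qed.

End GBracket.

(** * The weight zero *)

Section ZeroWeight.
Variable F : numFieldType.
Variables (P : pred Z2) (f : bool -> Z2 -> Z2 -> F) (g : Z2 -> Z2 -> F).
Variables (lam : bool -> F) (a : bool) (kc : cls) (B : F).
Hypothesis H : qrep P f g lam.

Local Notation S := (csupp P lam).
Local Notation co := (gco f g).
Local Notation ac := (aco lam a (lft kc) B).

Hypothesis shape : if a then (forall c, S c = (c == kc)) \/ (forall c, S c = (c != kc))
  else forall c, S c.
Hypothesis coE : forall u k, gval u -> wnz lam k -> wnz lam (k + gdeg u) ->
  S (par k) -> co u k = ac u k.
Variable c0 : cls.
Hypothesis Sc0 : S c0.

Lemma par_kap k : par (k - lft kc) = kadd (par k) kc.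
Proof. by rewrite parB par_lft0. Qed.

Lemma ac_closed u k : gval u -> S (par k) -> ac u k != 0 -> S (par (k + gdeg u)).
Proof.
case: u => [s n|m] /= vu Sk; first by rewrite parDe.
rewrite par_kap parD /reg_coef; move: (par m) (par k) Sk => d c.
move: shape; case: (a) => [[SE|SE]|SE]; rewrite ?SE //.
  by move=> /eqP ->; rewrite kaddcc !andbF mul1r subrr eqxx.
move=> _; apply: contraNneq => kE; rewrite -kE kaddA kaddcc.
rewrite (_ : kadd (false, false) d = d); last by case: (d) => [[] []].
by rewrite /= andbC mul1r subrr.
Qed.

Section At.
Variable k0 : Z2.
Hypothesis z0 : ~~ wnz lam k0.

Let nz0 k : k != k0 -> wnz lam k.
Proof. by apply: contraR => nk; apply/eqP; apply: (@wt_zero_uniq F lam). Qed.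

Let nzB (m : Z2) : m != 0 -> wnz lam (k0 - m).
Proof. by move=> m0; apply: nz0; rewrite -subr_eq0 addrAC subrr add0r oppr_eq0. Qed.

Let nzD (m : Z2) : m != 0 -> wnz lam (k0 + m).
Proof. by move=> m0; apply: nz0; rewrite -subr_eq0 addrAC subrr add0r. Qed.

Lemma wt0 s : wt lam s k0 = 0.
Proof.
by move: z0; rewrite /wnz negb_or !negbK => /andP[/eqP h1 /eqP h2]; case: s.
Qed.

(** The two orders of u and u' differ by their bracket, which is homogeneous,
   and u' u avoids the weight zero. *)
Lemma through_zero u u' : gval u -> gval u' -> gdeg u != gdeg u' ->
  gdeg u != 0 -> gdeg u' != 0 -> S (par (k0 - gdeg u')) ->
  co u k0 * co u' (k0 - gdeg u') = ac u k0 * ac u' (k0 - gdeg u').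
Proof.
move=> vu vu' dd du du'; set k := k0 - gdeg u' => Sk.
have kE : k + gdeg u' = k0 by rewrite /k subrK.
have E1 := gco_bracket H k vu vu'; have E2 := aco_bracket lam a (lft kc) B k vu vu'.
rewrite kE in E1 E2.
have nk : wnz lam k by apply: nzB.
have nku : wnz lam (k + gdeg u) by apply: nz0; rewrite -kE (inj_eq (addrI k)).
have nt : wnz lam (k0 + gdeg u) by apply: nzD.
have tE : k + gdeg u + gdeg u' = k0 + gdeg u by rewrite addrAC kE.
have E3 : co u' (k + gdeg u) * co u k = ac u' (k + gdeg u) * ac u k.
  rewrite (coE vu nk nku Sk); have [->|a0] := eqVneq (ac u k) 0.
    by rewrite !mulr0.
  by rewrite coE ?tE //; apply: ac_closed.
have T v : gval v -> gdeg v = gdeg u + gdeg u' -> co v k = ac v k.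
  by move=> vv dv; apply: coE => //; rewrite dv addrA tE.
suff E4 : gbracket co u u' k = gbracket ac u u' k.
  apply/eqP; rewrite -subr_eq0; apply/eqP.
  move: E1 E2; rewrite E3 E4 => <- E2.
  by rewrite -[X in _ - X](subrK (ac u' (k + gdeg u) * ac u k)) E2; ring.
move: T vu vu'; rewrite /k; clear; case: u => [s n|m]; case: u' => [t n'|m'] /= T vu vu'.
- have ev : evn (n + n') by rewrite evnD.
  by have /= -> := T (GenW t (n + n')) ev erefl; have /= -> := T (GenW s (n + n')) ev erefl.
- have om : ~~ evn (m' + n) by rewrite evnD.
  by have /= -> := T (GenG (m' + n)) om (addrC _ _).
- have om : ~~ evn (m + n') by rewrite evnD.
  by have /= -> := T (GenG (m + n')) om erefl.
have [em|om] := boolP (evn (m + m')); last by have /= -> := T (GenG (m + m')) om erefl.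
by rewrite qcc_evn // !mul0r.
Qed.

Lemma step_avoid (m e : Z2) (ms : seq Z2) : e != 0 ->
  exists t : int, [/\ t != 0, m + (t * e.1, t * e.2) \notin ms &
    m + (t * e.1, t * e.2) != 0].
Proof.
move=> e0; have [s es] : exists s, crd s e != 0.
  have [e1|e1] := eqVneq e.1 0; last by exists false.
  exists true; apply: contraNneq e0 => e2.
  by rewrite (surjective_pairing e) e1 -[e.2]/(crd true e) e2.
have eF : (crd s e)%:~R != 0 :> F by rewrite intr_eq0.
have [t tP] := int_avoid ((0 : F) :: [seq ((crd s j)%:~R - (crd s m)%:~R) / (crd s e)%:~R
  | j <- 0 :: ms]).
have avoid j : j \in 0 :: ms -> m + (t * e.1, t * e.2) != j.
  move=> jms; apply: contraNneq tP => jE; rewrite inE; apply/orP; right.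
  apply/mapP; exists j => //; rewrite -jE.
  by apply: (mulIf eF); rewrite divfK //; case: (s) => /=; rewrite intrD intrM; ring.
exists t; split.
- by move: tP; rewrite inE negb_or intr_eq0 => /andP[].
- apply/negP => jms; have := avoid (m + (t * e.1, t * e.2)).
  by rewrite inE jms orbT eqxx => /(_ isT).
- by apply: avoid; rewrite inE eqxx.
Qed.

(** The coefficients of the model vanish or not along lines of degrees, so that
   a nonzero one can be moved away from finitely many degrees. *)
Lemma ac_out_avoid u (ms : seq Z2) : gval u -> gdeg u != 0 -> ac u k0 != 0 ->
  exists v, [/\ gval v, gdeg v != 0, gdeg v \notin ms & ac v k0 != 0].
Proof.
case: u => [s n|m] /= vu du; rewrite ?wt0.
  rewrite add0r mulf_eq0 negb_or intr_eq0 => /andP[B0 ns].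
  have [t [t0 tms tn]] := step_avoid 0 ms du.
  exists (GenW s (0 + (t * n.1, t * n.2))); split=> //=.
    by rewrite add0r evn_mul.
  rewrite wt0 add0r mulf_neq0 // intr_eq0 add0r.
  by case: (s) ns => /= ns; rewrite mulf_neq0.
move=> r0; have [t [t0 tms tn]] := step_avoid m ms (isT : (2, 0) != 0 :> Z2).
have ev : evn (t * 2, t * 0) := evn_mul t (isT : evn (2, 0)).
by exists (GenG (m + (t * 2, t * 0))); split=> //=; rewrite ?evnD ?(@parDe m).
Qed.

Lemma ac_in_avoid u (ms : seq Z2) : gval u -> gdeg u != 0 ->
  ac u (k0 - gdeg u) != 0 -> S (par (k0 - gdeg u)) ->
  exists v, [/\ gval v, gdeg v != 0, gdeg v \notin ms, ac v (k0 - gdeg v) != 0 &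
    S (par (k0 - gdeg v))].
Proof.
have wtB s n : wt lam s (k0 - n) = - (crd s n)%:~R.
  by rewrite wt_add wt0 add0r; case: s; rewrite /= intrN.
case: u => [s n|m] /= vu du.
  rewrite wtB -{1}[_%:~R]mul1r -mulNr -mulrDl mulf_eq0 negb_or intr_eq0.
  move=> /andP[B0 ns] Sk.
  have [t [t0 tms tn]] := step_avoid 0 ms du.
  have ev : evn (0 + (t * n.1, t * n.2)) by rewrite add0r evn_mul.
  exists (GenW s (0 + (t * n.1, t * n.2))); split=> //=.
    rewrite wtB -{1}[_%:~R]mul1r -mulNr -mulrDl mulf_neq0 // intr_eq0 add0r.
    by case: (s) ns => /= ns; rewrite mulf_neq0.
  by rewrite parBe //; rewrite parBe in Sk.
move=> r0 Sk; have [t [t0 tms tn]] := step_avoid m ms (isT : (2, 0) != 0 :> Z2).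
have ev : evn (t * 2, t * 0) := evn_mul t (isT : evn (2, 0)).
exists (GenG (m + (t * 2, t * 0))); split=> //=; rewrite ?evnD //.
  rewrite (@parDe m) // (_ : par _ = par (k0 - m - lft kc)) //.
  by rewrite !parB (@parDe m).
by rewrite parB (@parDe m) // -parB.
Qed.

(** By through_zero the coefficients out of v_k0 and those into v_k0 have the
   same products as in the model, so that they are those of the model up to a
   scalar and its inverse. Degrees are varied because through_zero requires
   distinct ones. *)
Lemma zero_gauge : P k0 -> exists rho, [/\ rho != 0,
  S (par k0),
  forall u, gval u -> gdeg u != 0 -> co u k0 = rho * ac u k0 &
  forall u, gval u -> gdeg u != 0 -> S (par (k0 - gdeg u)) ->
    rho * co u (k0 - gdeg u) = ac u (k0 - gdeg u)].
Proof.
move=> Pk0.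
have cS : cclosed g lam S.
  move=> m k om nk nkm Sk gk.
  have [_ Pkm] := gco_supp H (u := GenG m) gk.
  by rewrite -(csupp_full H).
have cF : cclosed g lam pred0 by [].
have [u1 [u1' [[v1 v1'] dd [n1 n1'] [S1 _] [w1 w1']]]] :=
  passage H cS cF Sc0 Sc0 isT Sc0 Pk0 z0.
have d1 : gdeg u1 != 0.
  by apply: contraTneq w1' => ->; rewrite addr0.
have d1' : gdeg u1' != 0.
  by apply: contraTneq w1 => ->; rewrite subr0.
have E1 := through_zero v1 v1' dd d1 d1' S1.
have : ac u1 k0 * ac u1' (k0 - gdeg u1') != 0 by rewrite -E1 mulf_neq0.
rewrite mulf_eq0 negb_or => /andP[a1 a1'].
have Sk0 : S (par k0) by have := ac_closed v1' S1 a1'; rewrite subrK.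
pose rho := ac u1' (k0 - gdeg u1') / co u1' (k0 - gdeg u1').
have rho0 : rho != 0 by rewrite mulf_neq0 ?invr_eq0.
have out1 u : gval u -> gdeg u != 0 -> gdeg u != gdeg u1' ->
    co u k0 = rho * ac u k0.
  move=> vu du du1; have E := through_zero vu v1' du1 du d1' S1.
  by apply: (mulIf n1'); rewrite E /rho mulrAC divfK // mulrC.
have into u : gval u -> gdeg u != 0 -> S (par (k0 - gdeg u)) ->
    rho * co u (k0 - gdeg u) = ac u (k0 - gdeg u).
  move=> vu du Su.
  have [v [vv dv dms av]] := ac_out_avoid [:: gdeg u; gdeg u1'] v1 d1 a1.
  move: dms; rewrite !inE negb_or => /andP[dvu dvu1].
  have E := through_zero vv vu dvu dv du Su.
  by apply: (mulfI av); rewrite -E (out1 v) //; ring.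
exists rho; split=> // u vu du.
have [v [vv dv dms av Sv]] := ac_in_avoid [:: gdeg u] v1' d1' a1' S1.
rewrite inE eq_sym in dms.
have E := through_zero vu vv dms du dv Sv.
have := into v vv dv Sv => E2.
by apply: (mulIf av); rewrite -{1}E2 mulrCA E; ring.
Qed.

End At.
End ZeroWeight.

(** * Classification of the coefficients *)

Section Classification.
Variable F : numFieldType.
Variables (P : pred Z2) (f : bool -> Z2 -> Z2 -> F) (g : Z2 -> Z2 -> F).
Variables (lam : bool -> F).
Hypothesis H : qrep P f g lam.

(** V as a sub-quotient of the model: the vectors indexed by P or Q2 span a
   submodule, those indexed by Q2 a smaller one, and S rescales the quotient
   into V. *)
Definition modelled (a : bool) (kap : Z2) (B : F) (S : Z2 -> F) (Q2 : pred Z2) :=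
  [/\ forall k, S k != 0,
    forall u k, gval u -> P k -> P (k + gdeg u) ->
      gco f g u k * S k = aco lam a kap B u k * S (k + gdeg u),
    forall u k, gval u -> P k || Q2 k -> aco lam a kap B u k != 0 ->
      P (k + gdeg u) || Q2 (k + gdeg u),
    forall k, Q2 k -> ~~ P k &
    forall u k, gval u -> Q2 k -> aco lam a kap B u k != 0 -> Q2 (k + gdeg u)].

Lemma aco_trivial kap u : gval u -> ~~ wnz lam kap -> aco lam true kap 0 u kap = 0.
Proof.
case: u => [s n|m] /= _ z0; first by rewrite mul0r addr0 (wt0 z0).
by rewrite subrr /reg_coef /par /pz /= !andbF mul1r subrr.
Qed.

(** V is then the trivial module, spanned in A_{1,alpha,0} by the vector of
   weight zero. *)
Lemma trivial_support : (exists k, P k) -> (forall c, ~~ csupp P lam c) ->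
  exists a kap B S Q2, modelled a kap B S Q2.
Proof.
move=> [k1 Pk1] nS.
have Pz k : P k -> ~~ wnz lam k.
  by move=> Pk; apply: contraNN (nS (par k)) => nk; rewrite -(csupp_full H).
have P1 k : P k -> k = k1.
  by move=> /Pz nk; apply: (@wt_zero_uniq F lam) => //; apply: Pz.
exists true, k1, 0, (fun=> 1), pred0; split=> //.
- by move=> _; apply: oner_neq0.
- move=> u k vu Pk Pku; rewrite !mulr1 (P1 _ Pk) aco_trivial ?Pz //.
  have d0 : gdeg u = 0.
    by apply: (addrI k); rewrite addr0 (P1 _ Pku) (P1 _ Pk).
  case: u vu d0 Pku => [s n|m] /= vu d0 Pku; last by rewrite d0 in vu.
  by rewrite d0 (q_deg H) // (wt0 (Pz _ Pk1)).
- move=> u k vu; rewrite orbF => Pk; rewrite (P1 _ Pk) aco_trivial ?eqxx //.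
  exact: Pz.
Qed.

(** The vector of weight zero, if any, is treated separately: it belongs to V;
   or it does not, and its class is not in the support; or it is missing from a
   class in the support. In the last case the products through it vanish in the
   model. *)
Theorem qrep_classification : (exists k, P k) ->
  exists a kap B S Q2, modelled a kap B S Q2.
Proof.
move=> exP.
have [[c0 Sc0]|nS] := pselect (exists c, csupp P lam c); last first.
  by apply: trivial_support => // c; apply: contra_notN nS => Sc; exists c.
have [S1 [b [S10 N1]]] := coset_normal_form H.
have H1 := qrep_gauge S10 H.
have N1' s n k : evn n -> wnz lam k -> wnz lam (k + n) -> csupp P lam (par k) ->
    wgauge f S1 s n k = wt lam s k + b c0 * (crd s n)%:~R.
  move=> en nk nkn ck; rewrite N1 //.
  by rewrite (coset_weights_const H1 N1 ck Sc0).
set B := b c0 in N1'.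
have [sig [sigE sigS]] := structure_constants H1 N1'.
have [a [kc [u [[u0 uE] shape]]]] := klein_classification sigS
  (sig_bracket H1 sigE) (sig_connected H1 sigE) (ex_intro _ c0 Sc0).
pose S2 (k : Z2) := u (par k).
have S20 k : S2 k != 0 by apply: u0.
have H2 := qrep_gauge S20 H1.
set f2 := wgauge _ S2 in H2; set g2 := ggauge _ S2 in H2.
pose kap := lft kc; pose ac := aco lam a kap B.
have coE v k : gval v -> wnz lam k -> wnz lam (k + gdeg v) -> csupp P lam (par k) ->
    gco f2 g2 v k = ac v k.
  case: v => [s n|m] /= vv nk nk' ck.
    by rewrite /f2 {1}/wgauge /S2 parDe // mulfK ?N1'.
  rewrite /g2 {1}/ggauge sigE // /S2 parD uE //.
  by rewrite mulfK // /kap parB par_lft0.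
pose S12 k := S1 k * S2 k.
have S120 k : S12 k != 0 by rewrite mulf_neq0.
have gauge v k : gval v -> gco f g v k * S12 k = gco f2 g2 v k * S12 (k + gdeg v).
  have := S10 k; have := S20 k; have := S10 (k + gdeg v); have := S20 (k + gdeg v).
  case: v => [s n|m] /= h1 h2 h3 h4 _; rewrite /f2 /g2 /wgauge /ggauge /S12.
    by field; rewrite h1 h2.
  by field; rewrite h1 h2.
have closed := ac_closed (lam := lam) (B := B) shape.
have Pnz k : wnz lam k -> P k = csupp P lam (par k) := csupp_full H (k := k).
have [[k0 [Pk0 z0]]|nP0] := pselect (exists k0, P k0 /\ ~~ wnz lam k0).
- have [rho [rho0 Sk0 rout rin]] := zero_gauge H2 shape coE Sc0 z0 Pk0.
  have PS k : P k = csupp P lam (par k).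
    have [nk|nk] := boolP (wnz lam k); first exact: Pnz.
    by rewrite (@wt_zero_uniq F lam k k0) // Pk0 Sk0.
  pose S3 k := if k == k0 then rho^-1 else 1.
  have S30 k : S3 k != 0.
    by rewrite /S3; case: ifP => _; rewrite ?invr_eq0 ?oner_eq0.
  have nz k : k != k0 -> wnz lam k.
    by apply: contraR => nk; apply/eqP; apply: (@wt_zero_uniq F lam).
  exists a, kap, B, (fun k => S12 k * S3 k), pred0; split=> //.
  + by move=> k; rewrite mulf_neq0.
  + move=> v k vv Pk Pkv; rewrite mulrA gauge // -/ac.
    suff E : gco f2 g2 v k * S3 k = ac v k * S3 (k + gdeg v).
      by rewrite mulrAC E; ring.
    have [d0|d0] := eqVneq (gdeg v) 0.
      rewrite d0 addr0; congr (_ * _); case: v vv d0 Pkv => [s n|m] /= vv d0 Pkv.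
        by rewrite d0 (q_deg H2) // /ac /=; case: (s); rewrite /= mulr0 addr0.
      by rewrite d0 in vv.
    rewrite /S3; have [kE|kk] := eqVneq k k0.
      rewrite kE rout // (_ : k0 + gdeg v == k0 = false); last first.
        by rewrite -subr_eq0 addrAC subrr add0r (negPf d0).
      by rewrite mulr1 mulrAC divff // mul1r.
    have [kvE|kvk] := eqVneq (k + gdeg v) k0.
      have kE : k = k0 - gdeg v by rewrite -kvE addrK.
      have := rin v vv d0; rewrite -kE -PS => /(_ Pk) R.
      by rewrite mulr1 /ac -R mulrAC divff // mul1r.
    by rewrite !mulr1 coE ?nz // -PS.
  + by move=> v k vv; rewrite !orbF !PS => Sk a0; apply: closed.
have allnz k : P k -> wnz lam k.
  by move=> Pk; apply: contraT => nk; case: nP0; exists k.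
have PE k : P k = wnz lam k && csupp P lam (par k).
  by have [nk|nk] := boolP (wnz lam k);
     [rewrite Pnz | apply: contraNF nk => /allnz].
have gaugeE v k : gval v -> P k -> P (k + gdeg v) ->
    gco f g v k * S12 k = ac v k * S12 (k + gdeg v).
  move=> vv Pk Pkv; rewrite gauge // coE //; try exact: allnz.
  by move: Pk; rewrite PE => /andP[].
have [[k0 [z0 Sk0]]|nz] := pselect (exists k0, ~~ wnz lam k0 /\ csupp P lam (par k0));
  last first.
  exists a, kap, B, S12, pred0; split=> // v k vv; rewrite !orbF !PE.
  move=> /andP[nk Sk] a0; have Skv := closed v k vv Sk a0; rewrite Skv andbT.
  by apply: contraT => zk; case: nz; exists (k + gdeg v).
have nPk0 : ~~ P k0 by apply: contraNN z0; apply: allnz.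
have through v v' : gval v -> gval v' -> gdeg v != gdeg v' ->
    gdeg v != 0 -> gdeg v' != 0 -> csupp P lam (par (k0 - gdeg v')) ->
    ac v k0 * ac v' (k0 - gdeg v') = 0.
  move=> vv vv' dd d0 d0' Sk; rewrite -(through_zero H2 shape coE z0) //.
  suff -> : gco f2 g2 v k0 = 0 by rewrite mul0r.
  by apply/eqP; apply: contraNT nPk0 => /(gco_supp H2)[].
have wtB s n : wt lam s (k0 - n) = - (crd s n)%:~R.
  by rewrite wt_add (wt0 z0) add0r; case: s; rewrite /= intrN.
(* otherwise, for some class d, two steps of class d through the missing weight
   have a nonzero product in the model *)
have [ta kcE] : a = true /\ par k0 = kc.
  pose c := kadd (par k0) kc.
  suff nbad d : d != (false, false) -> reg_coef F a c d != 0 ->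
      reg_coef F a (kadd c d) d != 0 -> csupp P lam (kadd (par k0) d) -> False.
    have two0 : (1 + 1 : F) != 0 by rewrite -[1 + 1]/(2%:R) pnatr_eq0.
    have mtwo0 : (-1 - 1 : F) != 0 by rewrite -opprD oppr_eq0.
    move: shape nbad; case: (a) => [[SE|SE]|SE] nbad.
    - by split=> //; apply/eqP; rewrite -SE.
    - exfalso; apply: (nbad (if c == (true, false) then (false, true) else (true, false))).
      + by case: ifP.
      + have : c != (false, false).
          rewrite SE in Sk0; apply: contraNneq Sk0 => h.
          by rewrite -(kaddK (par k0) kc) -/c h kaddC kadd0.
        by rewrite /reg_coef /eps; case: (c) => [[] []] //= _;
           rewrite mul1r ?opprK // /eps.
      + have : c != (false, false).
          rewrite SE in Sk0; apply: contraNneq Sk0 => h.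
          by rewrite -(kaddK (par k0) kc) -/c h kaddC kadd0.
        by rewrite /reg_coef /eps; case: (c) => [[] []] //= _;
           rewrite mul1r ?opprK // /eps.
      + rewrite SE; move: Sk0; rewrite SE /c.
        by case: (par k0) => [[] []]; case: (kc) => [[] []].
    - exfalso; apply: (nbad (true, false)) => //; rewrite ?SE //.
        by rewrite /reg_coef /= mul0r subr0 oner_eq0.
      by rewrite /reg_coef /= mul0r subr0 oner_eq0.
  move=> d0 r1 r2 Sd; pose m := lft d; pose m' := lft d + (2, 0).
  have pm : par m = d := par_lft0 d.
  have pm' : par m' = d by rewrite parDe.
  have om : ~~ evn m by rewrite /evn pm.
  have om' : ~~ evn m' by rewrite /evn pm'.
  have := through (GenG m) (GenG m') om om'; rewrite /= /ac /=.
  rewrite !parB /kap par_lft0 pm pm' -/c => /(_ _ _ _ Sd) E.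
  have {}E : reg_coef F a c d * reg_coef F a (kadd (kadd (par k0) d) kc) d = 0.
    apply: E.
    - by rewrite /m' -subr_eq0 opprD addNKr oppr_eq0.
    - by apply: contraNneq om => ->.
    - by apply: contraNneq om' => ->.
  have kE : kadd (kadd (par k0) d) kc = kadd c d.
    by rewrite /c -!kaddA (kaddC d).
  by move/eqP: E; rewrite kE mulf_eq0 (negPf r1) (negPf r2).
have Skc : forall c, csupp P lam c = (c == kc).
  move: shape; rewrite ta => -[//|SE].
  by move: Sk0; rewrite SE kcE eqxx.
have acG m k : par k = kc -> ac (GenG m) k = 0.
  by move=> pk; rewrite /ac /= parB pk /kap par_lft0 kaddcc ta /reg_coef /= !andbF
    mul1r subrr.
have BB : B * (B - 1) = 0.
  have := through (GenW false (2, 0)) (GenW false (4, 0)) erefl erefl isT isT isT.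
  rewrite /= /ac /= -/wtB (@parBe k0 (4, 0)) // => /(_ Sk0).
  rewrite (wt0 z0) (wtB false) /= => E.
  apply: (mulfI (_ : 8 != 0)); first by rewrite pnatr_eq0.
  by apply: (lincomb1 (c := 1) E); ring.
move/eqP: BB; rewrite mulf_eq0 subr_eq0 => /orP[] /eqP BE.
(* functions modulo constants: v_k0 spans the smaller submodule *)
- exists a, kap, B, S12, (pred1 k0); split=> //.
  + move=> v k vv Pk a0.
    have Sk : csupp P lam (par k).
      by case/orP: Pk => [|/eqP -> //]; rewrite PE => /andP[].
    have Skv := closed v k vv Sk a0; rewrite PE Skv andbT /=.
    have [//|zk] := boolP (wnz lam (k + gdeg v)).
    by rewrite (@wt_zero_uniq F lam (k + gdeg v) k0) // eqxx.
  + by move=> k /eqP ->.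
  + move=> v k vv /eqP ->; case: v vv => [s n|m] /= vv.
      by rewrite /= (wt0 z0) add0r BE mul0r eqxx.
    by have /= -> := acG m k0 kcE; rewrite eqxx.
(* densities of total mass zero: v_k0 is not reached *)
exists a, kap, B, S12, pred0; split=> // v k vv; rewrite !orbF => Pk a0.
have Sk : csupp P lam (par k) by move: Pk; rewrite PE => /andP[].
have Skv := closed v k vv Sk a0; rewrite PE Skv andbT.
apply: contraT => zk; have kE : k = k0 - gdeg v.
  by rewrite -(@wt_zero_uniq F lam (k + gdeg v) k0) // addrK.
case: v vv a0 Skv zk kE => [s n|m] /= vv a0 Skv zk kE.
  by move: a0; rewrite kE (wtB s) BE mul1r addNr eqxx.
have pk : par k = kc by apply/eqP; rewrite -Skc.
by have /= E := acG m k pk; rewrite E eqxx in a0.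
Qed.

End Classification.

(** * The quantum torus at q = -1 *)

Lemma pz_expand z : z = (pz z : nat)%:Z + 2 * (z %/ 2)%Z.
Proof. by rewrite /pz; case: eqP => /=; lia. Qed.

Lemma pzM i j : pz (i * j) = pz i && pz j.
Proof.
rewrite {1}(pz_expand i) {1}(pz_expand j).
set p := (i %/ 2)%Z; set r := (j %/ 2)%Z.
have -> : ((pz i : nat)%:Z + 2 * p) * ((pz j : nat)%:Z + 2 * r)
  = ((pz i && pz j : nat) : nat)%:Z
    + 2 * ((pz i : nat)%:Z * r + p * (pz j : nat)%:Z + 2 * p * r).
  by rewrite -mulnb PoszM; ring.
by move: (_ + _ * r) (pz i && pz j) => t b; rewrite /pz; case: b => /=; lia.
Qed.

Section Torus.
Variable F : numFieldType.
Variable hq : 2.-primitive_root (-1 : F).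

Local Notation A := (qtorus hq).
Local Notation x m := (xmon hq m).

Lemma in_NZ2_evn n : (n \in in_NZ2 2) = evn n.
Proof. by rewrite evnE inE /=; lia. Qed.

Lemma expN1_eps (z : int) : (-1 : F) ^ z = eps F (pz z).
Proof.
rewrite {1}(pz_expand z).
rewrite expfzDr ?oppr_eq0 ?oner_eq0 // -exprz_exp -[(-1) ^ 2]exprnP sqrrN expr1n.
by rewrite exp1rz mulr1 /eps; case: (pz z).
Qed.

Lemma xM m n : x m * x n = eps F (pz m.2 && pz n.1) *: x (m + n).
Proof. by rewrite xmonM expN1_eps pzM. Qed.

Lemma linear_ext (V : lmodType F) (h1 h2 : A -> V) : linear h1 -> linear h2 ->
  (forall m, h1 (x m) = h2 (x m)) -> forall w, h1 w = h2 w.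
Proof.
move=> l1 l2 E; apply: qtorus_ind => [c u w eu ew||//].
  by rewrite l1 l2 eu ew.
have z h : linear h -> h (0 : A) = 0 :> V.
  by move=> l; have := l (-1) 0 0; rewrite scaler0 addr0 scaleN1r addNr.
by rewrite !z.
Qed.

Lemma der_ext_xmon (D E : der A) : (forall m, D (x m) = E (x m)) -> D = E.
Proof.
move=> DE; apply: val_inj; apply: funext; apply: linear_ext => //.
  exact: der_linear.
exact: der_linear.
Qed.

Definition proj (p : pred Z2) (w : A) : A :=
  fglift (fun m => if p m then x m else 0) w.

Lemma proj_linear p : linear (proj p).
Proof. exact: fglift_linear. Qed.

Lemma proj_xmon p m : proj p (x m) = if p m then x m else 0.
Proof. exact: qlift_xmon. Qed.

Lemma coeff_linear m : linear (coeff m : A -> F^o).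
Proof. by move=> c u w; rewrite coeffD coeffZ. Qed.

Lemma coeff_xmon m n : coeff m (x n) = (n == m)%:R.
Proof. by rewrite coeffU mul1r. Qed.

Lemma torus_eqP (u w : A) : (forall m, coeff m u = coeff m w) -> u = w.
Proof. by move=> E; apply/eqP/freeg_eqP. Qed.

Lemma coeff_proj p m w : coeff m (proj p w) = if p m then coeff m w else 0.
Proof.
apply: (@linear_ext F^o (fun w => coeff m (proj p w))
  (fun w => if p m then coeff m w else 0)) => [c u v|c u v|n].
- by rewrite proj_linear coeff_linear.
- by case: ifP => _; rewrite ?coeff_linear // scaler0 addr0.
rewrite proj_xmon coeff_xmon; case: eqVneq => [->|nm].
  by case: ifP; rewrite ?coeff_xmon ?eqxx // coeff0.
by case: (p n); case: (p m); rewrite ?coeff_xmon ?(negPf nm) ?coeff0.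
Qed.

Lemma proj_evn_central w u : proj evn w * u = u * proj evn w.
Proof.
elim/qtorus_ind: w => [c v w ev ew||m].
- by rewrite proj_linear mulrDl mulrDr -scalerAl -scalerAr ev ew.
- by rewrite /proj linear0 mul0r mulr0.
rewrite proj_xmon; case: ifP => em; last by rewrite mul0r mulr0.
by apply: xmon_central; rewrite in_NZ2_evn.
Qed.

Definition part (s : bool) : der A := if s then partial2 hq else partial1 hq.

Lemma part_xmon s m : part s (x m) = (crd s m)%:~R *: x m.
Proof. by case: s; rewrite /= qlift_xmon. Qed.

(** The derivation x^n d_s extended linearly in x^n, through the projection to
   the centre. *)
Definition zder s (w : A) : der A := central_mul (proj_evn_central w) (part s).

Lemma zder_xmon s w m : zder s w (x m) = (crd s m)%:~R *: (proj evn w * x m).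
Proof. by rewrite /zder /= part_xmon -scalerAr. Qed.

Lemma zder_linear s : linear (zder s).
Proof.
move=> c u w; apply: der_ext_xmon => m; rewrite zder_xmon.
rewrite -[(c *: zder s u + zder s w) (x m)]/(c *: zder s u (x m) + zder s w (x m)).
rewrite !zder_xmon.
by rewrite proj_linear mulrDl -scalerAl scalerDr !scalerA mulrC.
Qed.

Lemma ad_linear : linear (@ad F A).
Proof.
move=> c u w; apply: val_inj; apply: funext => v /=.
rewrite -[RHS]/(c *: (u * v - v * u) + (w * v - v * w)).
by rewrite mulrDl mulrDr -scalerAl -scalerAr scalerBr opprD addrACA.
Qed.

Definition dgen u : der A := match u with
  | GenW s n => zder s (x n) | GenG m => ad (x m) end.

Lemma dgenW_xmon s n k : evn n ->
  dgen (GenW s n) (x k) = (crd s k)%:~R *: x (n + k).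
Proof.
move=> en; rewrite /dgen zder_xmon proj_xmon en xM.
move: en; rewrite /evn /par xpair_eqE => /andP[_ /eqP ->].
by rewrite /eps /= scale1r.
Qed.

Lemma dgenG_xmon m k :
  dgen (GenG m) (x k) = qcc F (par m) (par k) *: x (m + k).
Proof.
rewrite /dgen /= !xM [k + m]addrC -scalerBl /qcc /=.
by rewrite [pz k.2 && _]andbC.
Qed.

Lemma derZ (D : der A) c u : D (c *: u) = c *: D u.
Proof. exact: linearZ. Qed.

Lemma bracket_WW s t n n' : evn n -> evn n' ->
  bracket (dgen (GenW s n)) (dgen (GenW t n'))
  = (crd s n')%:~R *: dgen (GenW t (n + n')) - (crd t n)%:~R *: dgen (GenW s (n + n')).
Proof.
move=> en en'; have enn : evn (n + n') by rewrite evnD.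
apply: der_ext_xmon => k.
rewrite -[bracket _ _ (x k)]/(dgen (GenW s n) (dgen (GenW t n') (x k))
  - dgen (GenW t n') (dgen (GenW s n) (x k))).
rewrite -[RHS]/((crd s n')%:~R *: dgen (GenW t (n + n')) (x k)
  - (crd t n)%:~R *: dgen (GenW s (n + n')) (x k)).
rewrite !dgenW_xmon // !derZ !dgenW_xmon // !scalerA.
rewrite (addrCA n') [n + (n' + k)]addrA -!scalerBl; congr (_ *: _).
by case: s; case: t; rewrite /= !intrD; ring.
Qed.

Lemma bracket_WG s n m : evn n ->
  bracket (dgen (GenW s n)) (dgen (GenG m)) = (crd s m)%:~R *: dgen (GenG (m + n)).
Proof.
move=> en; apply: der_ext_xmon => k.
rewrite -[bracket _ _ (x k)]/(dgen (GenW s n) (dgen (GenG m) (x k))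
  - dgen (GenG m) (dgen (GenW s n) (x k))).
rewrite -[RHS]/((crd s m)%:~R *: dgen (GenG (m + n)) (x k)).
rewrite dgenG_xmon dgenW_xmon // !derZ dgenW_xmon // !dgenG_xmon !scalerA.
have -> : par (m + n) = par m by rewrite parDe.
have -> : par (n + k) = par k by rewrite addrC parDe.
rewrite (addrCA m) addrA [m + n]addrC -scalerBl; congr (_ *: _).
by case: s; rewrite /= !intrD; ring.
Qed.

Lemma bracket_GG m m' : bracket (dgen (GenG m)) (dgen (GenG m'))
  = qcc F (par m) (par m') *: dgen (GenG (m + m')).
Proof.
apply: der_ext_xmon => k.
rewrite -[bracket _ _ (x k)]/(dgen (GenG m) (dgen (GenG m') (x k))
  - dgen (GenG m') (dgen (GenG m) (x k))).
rewrite -[RHS]/(qcc F (par m) (par m') *: dgen (GenG (m + m')) (x k)).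
rewrite !dgenG_xmon !derZ !dgenG_xmon !scalerA.
rewrite (addrCA m') addrA -scalerBl; congr (_ *: _).
rewrite !parD /qcc /eps /kadd.
move: (par m) (par m') (par k) => [c1 c2] [d1 d2] [e1 e2] /=.
by case: c1; case: c2; case: d1; case: d2; case: e1; case: e2 => /=; ring.
Qed.

End Torus.

(** * Decomposition of derivations *)

Section Derivations.
Variable F : numFieldType.
Variable hq : 2.-primitive_root (-1 : F).

Local Notation A := (qtorus hq).
Local Notation x m := (xmon hq m).
Local Notation der := (der A).

(** The logarithmic derivatives of x_1 and x_2. *)
Definition logd (s : bool) (D : der) : A :=
  if s then D (x (0, 1)) * x (0, -1) else D (x (1, 0)) * x (-1, 0).

Lemma logd_linear s : linear (logd s).
Proof.
by move=> c D E; rewrite /logd; case: s;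
  [rewrite -[(c *: D + E) (x (0, 1))]/(c *: D (x (0, 1)) + E (x (0, 1)))
  |rewrite -[(c *: D + E) (x (1, 0))]/(c *: D (x (1, 0)) + E (x (1, 0)))];
  rewrite mulrDl -scalerAl.
Qed.

(** ad u contributes to the logarithmic derivatives of x_1 and x_2 the
   components of u where m_2, respectively m_1, is odd, multiplied by 2; so u is
   read off from the first where m_2 is odd, and from the second elsewhere. *)
Definition inner_part (D : der) : A :=
  2^-1 *: (proj (fun m => pz m.2) (logd false D)
           + proj (fun m => pz m.1 && ~~ pz m.2) (logd true D)).

Definition central_part s (D : der) : A := proj evn (logd s D).

Lemma central_part_linear s : linear (central_part s).
Proof. by move=> c D E; rewrite /central_part logd_linear proj_linear. Qed.

Lemma inner_part_linear : linear inner_part.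
Proof.
move=> c D E; rewrite /inner_part !logd_linear !proj_linear.
by rewrite addrACA -scalerDr [LHS]scalerDr !scalerA [2^-1 * c]mulrC.
Qed.

Lemma logd_ad s w m :
  coeff m (logd s (ad w)) = (1 - eps F (if s then pz m.1 else pz m.2)) * coeff m w.
Proof.
apply: (@linear_ext F hq F^o (fun w => coeff m (logd s (ad w)))
  (fun w => (1 - eps F (if s then pz m.1 else pz m.2)) * coeff m w)).
- by move=> c u v; rewrite ad_linear logd_linear coeff_linear.
- by move=> c u v; rewrite coeff_linear mulrDr -[c *: _]/(c * _) -[c *: _]/(c * _) mulrCA.
move=> n; rewrite coeff_xmon /logd.
have E u v : ad (x n) (x u) * x v
    = (eps F (pz n.2 && pz u.1) - eps F (pz u.2 && pz n.1))
      *: (eps F (pz (n + u).2 && pz v.1) *: x (n + u + v)).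
  by rewrite /= !xM [u + n]addrC -scalerBl -scalerAl xM.
have pz0 : pz 0 = false by []. have pz1 : pz 1 = true by [].
have pzN1 : pz (-1) = true by [].
have e1 b : eps F b * eps F b = 1 by case: b; rewrite /eps; ring.
suff -> : (if s then ad (x n) (x (0, 1)) * x (0, -1)
    else ad (x n) (x (1, 0)) * x (-1, 0))
  = (1 - eps F (if s then pz n.1 else pz n.2)) *: x n.
  rewrite coeffZ coeff_xmon; case: eqVneq => [->//|_]; by rewrite !mulr0.
case: s; rewrite E scalerA.
  rewrite pz0 pz1 !andbF /= {2}/eps /= mulr1 -addrA (_ : (0, 1) + (0, -1) = 0) //.
  by rewrite addr0.
rewrite pz0 pz1 pzN1 /= pzD pz0 addbF !andbT -addrA (_ : (1, 0) + (-1, 0) = 0) //.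
by rewrite addr0 mulrBl e1 mul1r.
Qed.

Lemma logd_zder s t w : logd s (zder t w) = if s == t then proj evn w else 0.
Proof.
have x1 : x (1, 0) * x (-1, 0) = 1 by rewrite xM /= /eps /= scale1r.
have x2 : x (0, 1) * x (0, -1) = 1 by rewrite xM /= /eps /= scale1r.
rewrite /logd; case: s; rewrite zder_xmon -scalerAl -mulrA ?x1 ?x2 mulr1.
  by case: t; rewrite /= ?scale1r ?scale0r.
by case: t; rewrite /= ?scale1r ?scale0r.
Qed.

Lemma coeff_mulx (w : A) m n l : l = m + n ->
  coeff l (w * x n) = eps F (pz m.2 && pz n.1) * coeff m w.
Proof.
move=> ->; apply: (@linear_ext F hq F^o (fun w => coeff (m + n) (w * x n))
  (fun w => eps F (pz m.2 && pz n.1) * coeff m w)) => [c u v|c u v|k].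
- by rewrite mulrDl -scalerAl coeff_linear.
- by rewrite coeff_linear mulrDr -[c *: _]/(c * _) -[c *: _]/(c * _) mulrCA.
rewrite xM coeffZ !coeff_xmon (inj_eq (addIr n)).
by case: eqVneq => [->|]; rewrite ?mulr0.
Qed.

Lemma coeff_xmul (w : A) m n l : l = n + m ->
  coeff l (x n * w) = eps F (pz n.2 && pz m.1) * coeff m w.
Proof.
move=> ->; apply: (@linear_ext F hq F^o (fun w => coeff (n + m) (x n * w))
  (fun w => eps F (pz n.2 && pz m.1) * coeff m w)) => [c u v|c u v|k].
- by rewrite mulrDr -scalerAr coeff_linear.
- by rewrite coeff_linear mulrDr -[c *: _]/(c * _) -[c *: _]/(c * _) mulrCA.
rewrite xM coeffZ !coeff_xmon (inj_eq (addrI n)).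
by case: eqVneq => [->|]; rewrite ?mulr0.
Qed.

Lemma coeff_logd s (D : der) m : coeff m (logd s D)
  = if s then coeff (m + (0, 1)) (D (x (0, 1)))
    else eps F (pz m.2) * coeff (m + (1, 0)) (D (x (1, 0))).
Proof.
case: s; rewrite /logd.
  rewrite (@coeff_mulx _ (m + (0, 1))); last first.
    by rewrite -addrA (_ : (0, 1) + (0, -1) = 0) ?addr0.
  by rewrite [pz (0, -1).1](_ : _ = false) // andbF mul1r.
rewrite (@coeff_mulx _ (m + (1, 0))); last first.
  by rewrite -addrA (_ : (1, 0) + (-1, 0) = 0) ?addr0.
by rewrite [pz (-1, 0).1](_ : _ = true) // andbT /= addr0.
Qed.

(** This is the component of degree m of the relation D (x_2 x_1) = - D (x_1
   x_2), divided by x_1 x_2. *)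
Lemma logd_relation (D : der) m :
  (1 - eps F (pz m.1)) * coeff m (logd false D)
  = (1 - eps F (pz m.2)) * coeff m (logd true D).
Proof.
rewrite !coeff_logd.
have comm : x (0, 1) * x (1, 0) = - (x (1, 0) * x (0, 1)).
  by rewrite !xM /= /eps /= scaleN1r scale1r.
have := congr1 (fun w => coeff (m + (1, 1)) (D w)) comm.
rewrite /= linearN /= !derM coeffN !coeffD.
rewrite (@coeff_mulx _ (m + (0, 1)) (1, 0)); last by rewrite -addrA.
rewrite (@coeff_xmul _ (m + (1, 0)) (0, 1)); last by rewrite addrCA.
rewrite (@coeff_mulx _ (m + (1, 0)) (0, 1)); last by rewrite -addrA.
rewrite (@coeff_xmul _ (m + (0, 1)) (1, 0)); last by rewrite addrCA.
rewrite !pzD (_ : pz 0 = false) // (_ : pz 1 = true) // !addbT.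
set al := coeff _ (D (x (1, 0))); set be := coeff _ (D (x (0, 1))).
move: (pz m.1) (pz m.2) => b1 b2.
by move=> E; apply: (lincomb1 (c := eps F b2) E); case: b1 E; case: b2 => _;
   rewrite /eps /=; ring.
Qed.

Lemma xmon_split m : x m = x (m.1, 0) * x (0, m.2).
Proof.
case: m => a b; rewrite xM /= /eps /= scale1r.
by rewrite addpE addr0 add0r.
Qed.

Lemma logd_inj D E : (forall s, logd s D = logd s E) -> D = E.
Proof.
move=> DE; apply/eqP; rewrite -subr_eq0; apply/eqP.
have K0 s : logd s (D - E) = 0.
  have := logd_linear s (-1) E D; rewrite !scaleN1r [- E + D]addrC => ->.
  by rewrite DE addNr.
set K := D - E in K0 *.
have x1 : x (-1, 0) * x (1, 0) = 1 by rewrite xM /= /eps /= scale1r.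
have x2 : x (0, -1) * x (0, 1) = 1 by rewrite xM /= /eps /= scale1r.
have x1' : x (1, 0) * x (-1, 0) = 1 by rewrite xM /= /eps /= scale1r.
have x2' : x (0, 1) * x (0, -1) = 1 by rewrite xM /= /eps /= scale1r.
have K1 : K (x (1, 0)) = 0.
  by rewrite -[LHS]mulr1 -x1 mulrA -[_ * x (-1, 0)]/(logd false K) K0 mul0r.
have K2 : K (x (0, 1)) = 0.
  by rewrite -[LHS]mulr1 -x2 mulrA -[_ * x (0, -1)]/(logd true K) K0 mul0r.
have KU : K 1 = 0.
  have := derM K 1 1; rewrite !mulr1 mul1r => /eqP.
  by rewrite -subr_eq0 opprD addNKr oppr_eq0 => /eqP.
have E1 a : x (a + 1, 0) = x (a, 0) * x (1, 0).
  by rewrite xM /= /eps /= scale1r addpE addr0.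
have E2 a : x (0, a + 1) = x (0, a) * x (0, 1).
  by rewrite xM [pz (0, 1).1](_ : _ = false) // andbF /eps scale1r addpE addr0.
have step (u v w v' : A) : u = w * v -> v * v' = 1 -> K v = 0 ->
    (K u = 0) <-> (K w = 0).
  move=> uE vv Kv; rewrite uE derM Kv mulr0 addr0; split=> [h|->].
    by rewrite -[K w]mulr1 -vv mulrA h mul0r.
  by rewrite mul0r.
have posS (n : nat) : n.+1%:Z = n%:Z + 1 by lia.
have negS (n : nat) : - n.+1%:Z + 1 = - n%:Z by lia.
have Kx1 a : K (x (a, 0)) = 0.
  elim/int_ind: a => [|n ih|n ih]; first exact: KU.
    by rewrite posS; apply/(step _ _ _ _ (E1 _) x1' K1).
  apply/(step _ _ _ _ (E1 _) x1' K1); rewrite negS.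
  exact: ih.
have Kx2 a : K (x (0, a)) = 0.
  elim/int_ind: a => [|n ih|n ih]; first exact: KU.
    by rewrite posS; apply/(step _ _ _ _ (E2 _) x2' K2).
  apply/(step _ _ _ _ (E2 _) x2' K2); rewrite negS.
  exact: ih.
by apply: der_ext_xmon => m; rewrite xmon_split derM Kx1 Kx2 mul0r mulr0 addr0.
Qed.

(** By logd_relation the components of the two logarithmic derivatives at a
   degree that is not even come from the same inner derivation; those at even
   degrees are central. *)
Lemma der_decomposition D :
  D = ad (inner_part D)
      + (zder false (central_part false D) + zder true (central_part true D)).
Proof.
apply: logd_inj => s; apply: torus_eqP => m.
have lD : linear (logd s) := logd_linear s.
have lA D1 D2 : logd s (D1 + D2) = logd s D1 + logd s D2.
  by have := lD 1 D1 D2; rewrite !scale1r.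
have cz t w : coeff m (logd s (zder t w)) = if (s == t) && evn m then coeff m w else 0.
  by rewrite logd_zder; case: eqP => _ /=; rewrite ?coeff_proj ?coeff0.
have R := logd_relation D m; rewrite !lA !coeffD logd_ad !cz /central_part.
rewrite !coeff_proj coeffZ coeffD !coeff_proj.
have evE : evn m = ~~ pz m.1 && ~~ pz m.2 by rewrite /evn xpair_eqE !eqbF_neg.
have two0 : (2 : F) != 0 by rewrite pnatr_eq0.
move: R; rewrite evE {lD lA cz}; set al := coeff m (logd false D).
set be := coeff m (logd true D); case: s; rewrite -?/al -?/be; move: al be => al be;
  case: (pz m.1); case: (pz m.2); rewrite /eps /= => R; apply: (mulfI two0);
  try (by field); try (by apply: (lincomb1 (c := 1) R); field);
  by apply: (lincomb1 (c := -1) R); field.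
Qed.

Lemma der_ind (Q : der -> Prop) :
  (forall c D E, Q D -> Q E -> Q (c *: D + E)) ->
  (forall u, gval u -> Q (dgen hq u)) -> forall D, Q D.
Proof.
move=> Qlin Qgen.
have Q0 : Q 0.
  have h := Qgen (GenW false 0) erefl.
  by have := Qlin (-1) _ _ h h; rewrite scaleN1r addNr.
have QD D E : Q D -> Q E -> Q (D + E).
  by move=> qD qE; rewrite -[D]scale1r; apply: Qlin.
have Qz s w : Q (zder s w).
  elim/qtorus_ind: w => [c v w|  |m]; first by rewrite zder_linear; apply: Qlin.
    suff -> : zder s (0 : A) = 0 by [].
    by apply: der_ext_xmon => k; rewrite zder_xmon /proj linear0 mul0r scaler0.
  have [em|om] := boolP (evn m); first exact: (Qgen (GenW s m)).
  suff -> : zder s (x m) = 0 by [].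
  by apply: der_ext_xmon => k; rewrite zder_xmon proj_xmon (negPf om) mul0r scaler0.
have ad0 : ad (0 : A) = 0.
  by apply: der_ext_xmon => k; rewrite /= mul0r mulr0 subrr.
have Qad w : Q (ad (proj (predC evn) w)).
  elim/qtorus_ind: w => [c v w|  |m].
  - by rewrite proj_linear ad_linear; apply: Qlin.
  - by rewrite /proj linear0 ad0.
  rewrite proj_xmon /=; have [em|om] := boolP (evn m); last exact: (Qgen (GenG m)).
  by rewrite ad0.
move=> D; rewrite (der_decomposition D); apply: (QD); last by apply: QD.
suff <- : proj (predC evn) (inner_part D) = inner_part D by [].
apply: torus_eqP => m; rewrite coeff_proj /=; case: ifP => // /negbFE.
rewrite /evn xpair_eqE => /andP[/eqP h1 /eqP h2].
by rewrite coeffZ coeffD !coeff_proj h1 h2 /= addr0 mulr0.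
Qed.

End Derivations.

(** * The model on the torus *)

Section Model.
Variable F : numFieldType.
Variable hq : 2.-primitive_root (-1 : F).

Local Notation A := (qtorus hq).
Local Notation x m := (xmon hq m).
Local Notation der := (der A).

Lemma inner_dgenG m : ~~ evn m -> inner_part (dgen hq (GenG m)) = x m.
Proof.
move=> om; apply: torus_eqP => k.
have two0 : (2 : F) != 0 by rewrite pnatr_eq0.
rewrite coeffZ coeffD !coeff_proj (logd_ad false) (logd_ad true) coeff_xmon.
have [<-|_] := eqVneq m k; last by rewrite !mulr0 !if_same addr0 mulr0.
move: om; rewrite /evn xpair_eqE !eqbF_neg /eps.
by case: (pz m.1); case: (pz m.2) => //= _; field.
Qed.

Lemma central_dgenG s m : ~~ evn m -> central_part s (dgen hq (GenG m)) = 0.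
Proof.
move=> om; apply: torus_eqP => k; rewrite coeff0 coeff_proj logd_ad coeff_xmon.
case: ifP => // ek; have [mk|_] := eqVneq m k; last by rewrite mulr0.
by rewrite mk ek in om.
Qed.

Lemma inner_dgenW s n : inner_part (dgen hq (GenW s n)) = 0.
Proof.
apply: torus_eqP => k.
rewrite coeff0 coeffZ coeffD !coeff_proj !(logd_zder _ _ (x n)) proj_xmon.
apply/eqP; rewrite mulf_eq0; apply/orP; right; apply/eqP.
have z t : coeff k (if t then if evn n then x n else 0 else 0 : A)
    = if t && evn n then (n == k)%:R else 0.
  by case: t => //=; rewrite ?coeff0 //; case: ifP; rewrite ?coeff_xmon ?coeff0.
rewrite !z; have [<-|nk] := eqVneq n k; last by rewrite /= !if_same addr0.
have [en|] := boolP (evn n); last by rewrite !andbF !if_same addr0.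
move: en; rewrite /evn xpair_eqE => /andP[/eqP -> /eqP ->].
by rewrite /= addr0.
Qed.

Lemma central_dgenW s t n : evn n ->
  central_part t (dgen hq (GenW s n)) = if t == s then x n else 0.
Proof.
move=> en; rewrite /central_part (logd_zder _ _ (x n)) proj_xmon en.
by case: ifP; rewrite ?proj_xmon ?en // /proj linear0.
Qed.

Variables (a : bool) (lam : bool -> F) (b : F).

(** The derivation D acts on the torus by D, corrected by right multiplication
   by its inner part (which turns ad u into left multiplication when a is 0), by
   the weight shift lam and by b times the divergence of D. *)
Definition mact (D : der) (v : A) : A :=
  D v + (~~ a)%:R *: (v * inner_part D)
  + (lam false *: central_part false D + lam true *: central_part true D
     + b *: (part hq false (central_part false D) + part hq true (central_part true D)))
    * v.

Lemma scale_comb (V : lmodType F) (l c : F) (p p' : V) :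
  l *: (c *: p + p') = c *: (l *: p) + l *: p'.
Proof. by rewrite scalerDr !scalerA mulrC. Qed.

Lemma comb3 (V : lmodType F) (c : F) (p p' r r' t t' : V) :
  c *: p + p' + (c *: r + r') + (c *: t + t')
  = c *: (p + r + t) + (p' + r' + t').
Proof. by rewrite (addrACA (c *: p)) (addrACA (c *: p + c *: r)) -!scalerDr. Qed.

Lemma mact_linear D : linear (mact D).
Proof.
move=> c u v; rewrite /mact; set M := lam false *: _ + _ + _.
move: (inner_part D) M => I M; rewrite der_linear mulrDl mulrDr -scalerAl -scalerAr.
by rewrite scale_comb comb3.
Qed.

Lemma mact_linearl v : linear (mact^~ v).
Proof.
move=> c D E; rewrite /mact.
rewrite -[(c *: D + E) v]/(c *: D v + E v) inner_part_linear !central_part_linear.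
rewrite !(der_linear (part hq false)) !(der_linear (part hq true)).
move: (inner_part D) (inner_part E) => I J.
move: (part hq false (central_part false D)) (part hq false (central_part false E)) => a1 a2.
move: (part hq true (central_part true D)) (part hq true (central_part true E)) => a3 a4.
move: (central_part false D) (central_part false E) => b1 b2.
move: (central_part true D) (central_part true E) (D v) (E v) => b3 b4 d1 d2.
rewrite mulrDr -scalerAr !scale_comb.
rewrite (addrACA (c *: a1)) -scalerDr scale_comb comb3.
by rewrite mulrDl -scalerAl comb3.
Qed.

Lemma mact_dgen u k : gval u ->
  mact (dgen hq u) (x k) = aco lam a 0 b u k *: x (k + gdeg u).
Proof.
case: u => [s n|m] vu.
  have nk : x n * x k = x (k + n).
    move: vu; rewrite /= /evn xpair_eqE xM [n + k]addrC => /andP[_ /eqP ->].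
    by rewrite /eps /= scale1r.
  have p0 t : part hq t (0 : A) = 0 by rewrite linear0.
  have cf : central_part false (dgen hq (GenW s n)) = (~~ s)%:R *: x n.
    by rewrite central_dgenW //; case: (s); rewrite ?scale0r ?scale1r.
  have ct : central_part true (dgen hq (GenW s n)) = s%:R *: x n.
    by rewrite central_dgenW //; case: (s); rewrite ?scale0r ?scale1r.
  rewrite /mact inner_dgenW mulr0 scaler0 addr0 cf ct dgenW_xmon // !derZ !part_xmon.
  rewrite !scalerA -scalerDl -scalerDl scalerA -scalerDl -scalerAl nk [n + k]addrC.
  rewrite -scalerDl /= /wt; congr (_ *: _).
  by case: (s); rewrite /=; ring.
rewrite /mact inner_dgenG // !central_dgenG // dgenG_xmon.
have p0 t : part hq t (0 : A) = 0 by rewrite linear0.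
rewrite !p0 !scaler0 !addr0 scaler0 addr0 mul0r addr0 xM scalerA.
rewrite [m + k]addrC -scalerDl /=; congr (_ *: _).
rewrite subr0 /reg_coef /qcc /= [pz k.2 && _]andbC.
by case: (a); rewrite /=; ring.
Qed.

Lemma bracket_linearl (E D D' : der) c :
  bracket (c *: D + D') E = c *: bracket D E + bracket D' E.
Proof.
apply: val_inj; apply: funext => v.
rewrite -[LHS]/(c *: D (E v) + D' (E v) - E (c *: D v + D' v)).
rewrite -[RHS]/(c *: (D (E v) - E (D v)) + (D' (E v) - E (D' v))).
by rewrite der_linear scalerBr opprD addrACA.
Qed.

Lemma bracket_linearr (E D D' : der) c :
  bracket E (c *: D + D') = c *: bracket E D + bracket E D'.
Proof.
apply: val_inj; apply: funext => v.
rewrite -[LHS]/(E (c *: D v + D' v) - (c *: D (E v) + D' (E v))).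
rewrite -[RHS]/(c *: (E (D v) - D (E v)) + (E (D' v) - D' (E v))).
by rewrite der_linear scalerBr opprD addrACA.
Qed.

Lemma mact_bracket_gen u u' k : gval u -> gval u' ->
  mact (bracket (dgen hq u) (dgen hq u')) (x k)
  = gbracket (aco lam a 0 b) u u' k *: x (k + gdeg u' + gdeg u).
Proof.
have lD D E c : mact (c *: D + E) (x k) = c *: mact D (x k) + mact E (x k).
  exact: mact_linearl.
have l0 : mact 0 (x k) = 0.
  by have := lD 0 0 (-1); rewrite scaler0 addr0 scaleN1r addNr.
have lZ D c : mact (c *: D) (x k) = c *: mact D (x k).
  by rewrite -[c *: D]addr0 lD l0 addr0.
move=> vu vu'; have kE : k + gdeg u' + gdeg u = k + (gdeg u + gdeg u').
  by rewrite -addrA [gdeg u' + _]addrC.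
rewrite kE; case: u vu {kE} => [s n|m] vu; case: u' vu' => [t n'|m'] vu'.
- have en : evn (n + n') by rewrite evnD.
  rewrite bracket_WW // [_ *: _ - _]addrC -scaleNr lD lZ.
  rewrite !(@mact_dgen (GenW _ _)) // !scalerA -scalerDl.
  by congr (_ *: _); rewrite /gbracket; ring.
- have om : ~~ evn (m' + n) by rewrite evnD.
  rewrite bracket_WG // lZ (@mact_dgen (GenG _)) // scalerA /=.
  by rewrite [m' + n]addrC.
- have om : ~~ evn (m + n') by rewrite evnD.
  have -> : bracket (dgen hq (GenG m)) (dgen hq (GenW t n'))
      = (- (crd t m)%:~R) *: dgen hq (GenG (m + n')).
    rewrite scaleNr -bracket_WG //; apply: val_inj; apply: funext => w.
    by rewrite /= opprB.
  by rewrite lZ (@mact_dgen (GenG _)) // scalerA /gbracket mulNr.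
rewrite bracket_GG lZ.
have [em|om] := boolP (evn (m + m')); last first.
  by rewrite (@mact_dgen (GenG _)) // scalerA.
by rewrite /gbracket (qcc_evn F em) !mul0r !scale0r.
Qed.

Lemma comb_sub (V : lmodType F) (c : F) (p p' r r' : V) :
  c *: (p - r) + (p' - r') = c *: p + p' - (c *: r + r').
Proof. by rewrite scalerBr opprD addrACA. Qed.

Lemma mactl c D E v : mact (c *: D + E) v = c *: mact D v + mact E v.
Proof. exact: mact_linearl. Qed.

Lemma mactr D c v w : mact D (c *: v + w) = c *: mact D v + mact D w.
Proof. exact: mact_linear. Qed.

Lemma mact_bracket D E v :
  mact (bracket D E) v = mact D (mact E v) - mact E (mact D v).
Proof.
move: D E v; apply: der_ind => [c D D' ihD ihD' E v|u vu].
  by rewrite bracket_linearl !mactl mactr ihD ihD' comb_sub.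
apply: der_ind => [c E E' ihE ihE' v|u' vu'].
  by rewrite bracket_linearr !mactl mactr ihE ihE' comb_sub.
apply: linear_ext => [c v w|c v w|k]; first exact: mact_linear.
  by rewrite !mactr comb_sub.
have mZ D c w : mact D (c *: w) = c *: mact D w.
  have l0 : mact D 0 = 0.
    by have := mact_linear D (-1) 0 0; rewrite scaler0 addr0 scaleN1r addNr.
  by rewrite -[c *: w]addr0 mact_linear l0 addr0.
rewrite mact_bracket_gen // -aco_bracket // !mact_dgen // !mZ !mact_dgen // !scalerA.
rewrite [k + gdeg u + gdeg u']addrAC -scalerBl; congr (_ *: _); ring.
Qed.

Definition model : derModule A :=
  DerModule mact_linear mact_linearl mact_bracket.

End Model.

(** * Coefficients of a module of the intermediate series *)

Section Coefficients.
Variable F : numFieldType.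
Variable hq : 2.-primitive_root (-1 : F).

Local Notation A := (qtorus hq).
Local Notation x m := (xmon hq m).
Local Notation der := (der A).
Variable V : derModule A.

Lemma actZl c D (v : V) : dm_act (c *: D) v = c *: dm_act D v.
Proof.
have l0 : dm_act (0 : der) v = 0.
  by have := dm_act_linearl v (-1) 0 0; rewrite scaler0 addr0 scaleN1r addNr.
by rewrite -[c *: D]addr0 (dm_act_linearl v) l0 addr0.
Qed.

Lemma actPl c D E (v : V) : dm_act (c *: D + E) v = c *: dm_act D v + dm_act E v.
Proof. exact: (dm_act_linearl v). Qed.

Lemma actPr c D (v w : V) : dm_act D (c *: v + w) = c *: dm_act D v + dm_act D w.
Proof. exact: dm_act_linear. Qed.

Lemma act0r D : dm_act D (0 : V) = 0.
Proof.
by have := actPr (-1) D 0 0; rewrite scaler0 addr0 scaleN1r addNr.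
Qed.

Lemma actZr c D (v : V) : dm_act D (c *: v) = c *: dm_act D v.
Proof. by rewrite -[c *: v]addr0 actPr act0r addr0. Qed.

Lemma part_dgen s : part hq s = dgen hq (GenW s 0).
Proof. by apply: der_ext_xmon => k; rewrite dgenW_xmon // add0r part_xmon. Qed.

Lemma toralE a : toral hq a
  = a.1 *: dgen hq (GenW false 0) + a.2 *: dgen hq (GenW true 0).
Proof. by rewrite -!part_dgen. Qed.

Lemma weight_spaceP l (v : V) : v \in weight_space l <->
  forall s, dm_act (dgen hq (GenW s 0)) v = (if s then l.2 else l.1) *: v.
Proof.
split=> [/asboolP h s|h]; last first.
  by apply/asboolP => c; rewrite toralE actPl actZl !h !scalerA -scalerDl.
case: s.
  have := h (0, 1); rewrite toralE actPl actZl /pairing.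
  rewrite -[((0 : F), (1 : F)).1]/(0 : F) -[((0 : F), (1 : F)).2]/(1 : F).
  by rewrite scale0r scale1r mul0r mul1r !add0r.
have := h (1, 0); rewrite toralE actPl actZl /pairing.
rewrite -[((1 : F), (0 : F)).1]/(1 : F) -[((1 : F), (0 : F)).2]/(0 : F).
by rewrite scale0r scale1r mul0r mul1r !addr0.
Qed.

Lemma weight_shift u l (v : V) : gval u -> v \in weight_space l ->
  dm_act (dgen hq u) v \in weight_space (l + int2F F (gdeg u)).
Proof.
move=> vu /weight_spaceP h; apply/weight_spaceP => s.
have E := dm_act_bracket (dgen hq (GenW s 0)) (dgen hq u) v.
have B : bracket (dgen hq (GenW s 0)) (dgen hq u) = (crd s (gdeg u))%:~R *: dgen hq u.
  case: u vu {E} => [t n|m] vu.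
    rewrite bracket_WW // add0r (_ : crd t 0 = 0) ?mulr0z ?scale0r ?subr0 //.
    by case: t {vu}.
  by rewrite bracket_WG // addr0.
rewrite B actZl h actZr in E; have {}E := esym (canLR (subrK _) E).
rewrite E -scalerDl; congr (_ *: _); rewrite addrC.
by case: (s).
Qed.

Section Family.
Variables (lam : bool -> F) (vv : Z2 -> V).

Definition wgt (k : Z2) : F * F := (wt lam false k, wt lam true k).

Hypothesis vw : forall k, vv k \in weight_space (wgt k).

Definition lift (u : A) : V := fglift vv u.

Lemma lift_linear : linear lift.
Proof. exact: fglift_linear. Qed.

Lemma lift_xmon k : lift (x k) = vv k.
Proof. exact: qlift_xmon. Qed.

Lemma lift_sum u : lift u = \sum_(k <- dom u) coeff k u *: vv k.
Proof.
rewrite -{1}(freeg_sumE u) /lift (@linear_sum _ _ _ _ (fglift vv)).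
by apply: eq_bigr => k _; apply: liftU.
Qed.

(** Applying d_t minus its eigenvalue on v_j kills the term of index j, and some
   t distinguishes j from any other index. *)
Lemma distinct_weights_free (s : seq Z2) (c : Z2 -> F) : uniq s ->
  \sum_(k <- s) c k *: vv k = 0 -> forall k, k \in s -> c k *: vv k = 0.
Proof.
elim: s c => // j s ih c /andP[js us] E.
have shift t : \sum_(k <- s) (c k * (wt lam t k - wt lam t j)) *: vv k = 0.
  have sumE : dm_act (dgen hq (GenW t 0)) (\sum_(k <- j :: s) c k *: vv k)
      = \sum_(k <- j :: s) (c k * wt lam t k) *: vv k.
    elim: (j :: s) => [|i r ihr]; first by rewrite !big_nil act0r.
    rewrite !big_cons actPr ihr; congr (_ + _).
    by have /weight_spaceP -> := vw i; rewrite scalerA; case: (t).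
  have /= Z : \sum_(k <- j :: s) (c k * (wt lam t k - wt lam t j)) *: vv k = 0.
    under eq_bigr => k _ do rewrite mulrBr scalerBl.
    rewrite big_split /= -sumE E act0r add0r sumrN.
    under eq_bigr => k _ do rewrite mulrC -scalerA.
    by rewrite -scaler_sumr E scaler0 oppr0.
  by move: Z; rewrite big_cons subrr mulr0 scale0r add0r.
have sz k : k \in s -> c k *: vv k = 0.
  move=> ks; have kj : k != j by apply: contraNneq js => <-.
  have [t tn] : exists t, wt lam t k - wt lam t j != 0.
    case: k j kj {ks js E shift} => [k1 k2] [j1 j2] kj.
    have [e1|n1] := eqVneq k1 j1; last first.
      by exists false; rewrite /wt /= opprD addrACA subrr add0r -intrB intr_eq0 subr_eq0.
    have [e2|n2] := eqVneq k2 j2; first by rewrite e1 e2 eqxx in kj.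
    by exists true; rewrite /wt /= opprD addrACA subrr add0r -intrB intr_eq0 subr_eq0.
  have := ih _ us (shift t) k ks; rewrite mulrC -scalerA => /eqP.
  by rewrite scaler_eq0 (negPf tn) => /eqP.
move: E; rewrite big_cons big_seq big1 ?addr0 // => E.
by move=> k; rewrite inE => /orP[/eqP ->|/sz].
Qed.

Lemma lift_free u k : lift u = 0 -> vv k != 0 -> coeff k u = 0.
Proof.
rewrite lift_sum => E vk; have [kd|] := boolP (k \in dom u); last first.
  by move/coeff_outdom.
have /eqP := distinct_weights_free (uniq_dom u) E kd.
by rewrite scaler_eq0 (negPf vk) orbF => /eqP.
Qed.

Hypothesis vmax : forall k v, v \in weight_space (wgt k) -> exists c, v = c *: vv k.

Let P k := vv k != 0.

(** A homogeneous derivation sends v_k to a weight vector, hence to a multiple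
   of another vector of the family. *)
Lemma action_coefficients : exists co : gen -> Z2 -> F,
  (forall u k, gval u -> dm_act (dgen hq u) (vv k) = co u k *: vv (k + gdeg u)) /\
  (forall u k, ~~ (P k && P (k + gdeg u)) -> co u k = 0).
Proof.
have ex (uk : gen * Z2) : exists c : F,
    (gval uk.1 -> dm_act (dgen hq uk.1) (vv uk.2) = c *: vv (uk.2 + gdeg uk.1)) /\
    (~~ (P uk.2 && P (uk.2 + gdeg uk.1)) -> c = 0).
  case: uk => u k /=; have [vu|] := boolP (gval u); last by exists 0.
  have wgtD : wgt k + int2F F (gdeg u) = wgt (k + gdeg u).
    by rewrite /wgt !wt_add.
  have /vmax[c E] : dm_act (dgen hq u) (vv k) \in weight_space (wgt (k + gdeg u)).
    by rewrite -wgtD; apply: weight_shift.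
  have [PP|nP] := boolP (P k && P (k + gdeg u)); first by exists c.
  exists 0; split=> // _; rewrite scale0r; move: nP; rewrite negb_and !negbK.
  case/orP=> /eqP z; first by rewrite z act0r.
  by rewrite E z scaler0.
have [co coP] := choice ex; exists (fun u k => co (u, k)).
by split=> u k; have [h1 h2] := coP (u, k).
Qed.

Variable co : gen -> Z2 -> F.
Hypothesis coE : forall u k, gval u ->
  dm_act (dgen hq u) (vv k) = co u k *: vv (k + gdeg u).
Hypothesis coS : forall u k, ~~ (P k && P (k + gdeg u)) -> co u k = 0.

Lemma co_bracket u u' k : gval u -> gval u' ->
  co u (k + gdeg u') * co u' k - co u' (k + gdeg u) * co u k = gbracket co u u' k.
Proof.
move=> vu vu'; set t := k + (gdeg u + gdeg u').
have t1 : k + gdeg u + gdeg u' = t by rewrite -addrA.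
have t2 : k + gdeg u' + gdeg u = t by rewrite addrAC.
have S v j : ~~ P t -> j + gdeg v = t -> co v j = 0.
  by move=> nP jt; apply: coS; rewrite jt negb_and nP orbT.
have [Pt|nP] := boolP (P t); last first.
  rewrite [co u (_ + _)]S // [co u' (_ + _)]S // !mul0r subrr.
  rewrite /t in S nP; case: u u' {vu vu' t t1 t2} S nP => [s n|m] [t n'|m'] /= S nP.
  - by rewrite !S // !mulr0 subrr.
  - by rewrite S ?mulr0 //= [m' + n]addrC.
  - by rewrite S ?mulr0 ?oppr0.
  - by rewrite S ?mulr0.
have E := dm_act_bracket (dgen hq u) (dgen hq u') (vv k).
rewrite !coE // !actZr !coE // !scalerA t1 t2 -scalerBl in E.
rewrite [co u k * _]mulrC [co u' k * _]mulrC in E.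
have inj c d : c *: vv t = d *: vv t -> c = d.
  by move/eqP; rewrite -subr_eq0 -scalerBl scaler_eq0 (negPf Pt) orbF subr_eq0 => /eqP.
apply: inj; rewrite -E {E}.
have gen_at v : gval v -> gdeg v = gdeg u + gdeg u' ->
    dm_act (dgen hq v) (vv k) = co v k *: vv t.
  by move=> vv' dv; rewrite coE // dv.
move: vu vu' gen_at; rewrite /t {t t1 t2 S Pt}.
case: u => [s n|m]; case: u' => [t n'|m'] /= vu vu' G.
- have en : evn (n + n') by rewrite evnD.
  rewrite bracket_WW // [_ *: _ - _]addrC -scaleNr actPl actZl.
  have /= -> := G (GenW s (n + n')) en erefl.
  have /= -> := G (GenW t (n + n')) en erefl.
  by rewrite !scalerA -scalerDl; congr (_ *: _); ring.
- have om : ~~ evn (m' + n) by rewrite evnD.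
  rewrite bracket_WG // actZl.
  by have /= -> := G (GenG (m' + n)) om (addrC _ _); rewrite scalerA.
- have om : ~~ evn (m + n') by rewrite evnD.
  have -> : bracket (dgen hq (GenG m)) (dgen hq (GenW t n'))
      = (- (crd t m)%:~R) *: dgen hq (GenG (m + n')).
    rewrite scaleNr -bracket_WG //; apply: val_inj; apply: funext => w.
    by rewrite /= opprB.
  rewrite actZl; have /= -> := G (GenG (m + n')) om erefl.
  by rewrite scalerA mulNr.
rewrite bracket_GG actZl.
have [em|om] := boolP (evn (m + m')); last first.
  by have /= -> := G (GenG (m + m')) om erefl; rewrite scalerA.
by rewrite (qcc_evn F em) !mul0r !scale0r.
Qed.

Definition spanned (Q : pred Z2) : {pred V} :=
  [pred w | `[< exists u, w = lift (proj Q u) >]].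

Lemma spanned_closed Q : submod_closed (spanned Q).
Proof.
split=> [|c v w].
  by apply/asboolP; exists 0; rewrite /proj linear0 /lift linear0.
move=> /asboolP[u ->] /asboolP[u' ->]; apply/asboolP; exists (c *: u + u').
by rewrite proj_linear lift_linear.
Qed.

Lemma spanned_vec (Q : pred Z2) k : Q k -> vv k \in spanned Q.
Proof. by move=> Qk; apply/asboolP; exists (x k); rewrite proj_xmon Qk lift_xmon. Qed.

Lemma spanned_stable (Q : pred Z2) :
  (forall u k, gval u -> Q k -> co u k != 0 -> Q (k + gdeg u)) ->
  forall D v, v \in spanned Q -> dm_act D v \in spanned Q.
Proof.
move=> HQ; have [S0 SD] := spanned_closed Q.
apply: der_ind => [c D E ihD ihE v vQ|u vu v].
  by rewrite actPl; apply: SD; [apply: ihD | apply: ihE].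
move=> /asboolP[w ->] {v}; elim/qtorus_ind: w => [c w w' ihw ihw'||k].
- by rewrite proj_linear lift_linear actPr; apply: SD.
- by rewrite /proj linear0 /lift linear0 act0r.
rewrite proj_xmon; case: ifP => Qk; last by rewrite /lift linear0 act0r.
rewrite lift_xmon coE //; have [->|c0] := eqVneq (co u k) 0.
  by rewrite scale0r.
by rewrite -[_ *: _]addr0; apply: SD => //; apply/spanned_vec/HQ.
Qed.

Hypothesis irr : irreducible V.

(** A set of indices stable under the nonzero coefficients spans a submodule. *)
Lemma irreducible_supports (Q : pred Z2) :
  (forall u k, gval u -> Q k -> co u k != 0 -> Q (k + gdeg u)) ->
  (forall k, P k -> ~~ Q k) \/ (forall v, v \in spanned Q).
Proof.
move=> HQ; pose U := Submodule (spanned_closed Q) (spanned_stable HQ).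
have [_ /(_ U)[U0|UT]] := irr; [left|by right] => k.
by apply: contraNN => Qk; rewrite (U0 (vv k)) //; apply: spanned_vec.
Qed.

Lemma extracted_qrep :
  qrep P (fun s n => co (GenW s n)) (fun m => co (GenG m)) lam.
Proof.
split.
- by move=> s t n n' k en en'; apply: (@co_bracket (GenW s n) (GenW t n')).
- by move=> s n m k en om; apply: (@co_bracket (GenW s n) (GenG m)).
- by move=> m m' k om om'; apply: (@co_bracket (GenG m) (GenG m')).
- move=> s k Pk; have := coE (u := GenW s 0) k erefl; rewrite /= addr0.
  have /weight_spaceP -> := vw k => /eqP.
  rewrite -subr_eq0 -scalerBl scaler_eq0 (negPf Pk) orbF subr_eq0 => /eqP <-.
  by case: (s).
- by move=> s n k nP; apply: coS.
- by move=> m k nP; apply: coS.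
move=> Q Q1 Q2; have [|h|h] := @irreducible_supports Q.
- by case=> [s n|m] k /=; [apply: Q1 | apply: Q2].
- by left.
right=> k Pk; apply: contraT => nQ; have /asboolP[u E] := h (vv k).
have := @lift_free (x k + (-1) *: proj Q u) k.
have -> : lift (x k + (-1) *: proj Q u) = 0.
  rewrite [x k + _]addrC lift_linear lift_xmon -E scaleN1r addNr //.
move=> /(_ erefl Pk)/eqP; rewrite coeffD coeffZ coeff_proj (negPf nQ) mulr0 addr0.
by rewrite coeff_xmon eqxx oner_eq0.
Qed.

Lemma lift_surjective k : P k -> forall v : V, exists u, v = lift u.
Proof.
move=> Pk v; have [|h|h] := @irreducible_supports predT; first by [].
  by have := h k Pk.
have /asboolP[u ->] := h v; by exists (proj predT u).
Qed.

End Family.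

(** The weights of the family are those in the coset of one weight that occurs
   in V. *)
Lemma weight_family : (exists v : V, v != 0) -> intermediate_series V ->
  exists (lam : bool -> F) (vv : Z2 -> V), [/\ forall k, vv k \in weight_space (M := V) (wgt lam k),
    forall k (v : V), v \in weight_space (M := V) (wgt lam k) -> exists c, v = c *: vv k &
    exists k, vv k != 0].
Proof.
move=> [v0 v0n] [[dec _] dim1].
have [g [[gw vE] _]] := dec v0.
have [l gl] : exists l, g l != 0.
  have [//|nE] := pselect (exists l, g l != 0); case/eqP: v0n.
  rewrite vE big1 // => l _; apply/eqP; apply: contra_notT nE => gl.
  by exists l.
pose lam (s : bool) := if s then l.2 else l.1.
have ex k : exists e : V, e \in weight_space (M := V) (wgt lam k) /\
    forall v, v \in weight_space (M := V) (wgt lam k) -> exists c, v = c *: e.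
  have [e [ew eS]] := dim1 (wgt lam k); exists (e ord0); split=> // v /eS[c ->].
  by exists (c ord0); rewrite big_ord1.
have [vv vvP] := choice ex; exists lam, vv; split=> [k|k|].
- by have [] := vvP k.
- by have [] := vvP k.
exists 0; have [_ h] := vvP 0.
have l0 : wgt lam 0 = l by rewrite /wgt /wt /lam /= !addr0; case: (l).
have := gw l; rewrite -l0 => /h[c E].
by apply: contraNneq gl => z; rewrite -l0 E z scaler0.
Qed.

End Coefficients.

(** * Sub-quotients from partial homomorphisms *)

Section FirstIsomorphism.
Variables (F : fieldType) (A : algType F) (V M : derModule A).
Variables (psi : {linear M -> V}) (U : submodule M).
Hypothesis psi_surj : forall v, exists2 u, u \in sm_pred U & psi u = v.
Hypothesis psi_act : forall D u, u \in sm_pred U ->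
  psi (dm_act D u) = dm_act D (psi u).

Let SU := subModule U.

Definition ker_pred : {pred SU} := [pred u | psi (val u) == 0].

Lemma ker_closed : submod_closed ker_pred.
Proof.
split=> [|c u w]; rewrite !inE ?raddf0 // => /eqP u0 /eqP w0.
by rewrite linearP u0 w0 scaler0 addr0.
Qed.

Lemma ker_stable D u : u \in ker_pred -> dm_act D u \in ker_pred.
Proof.
rewrite !inE => /eqP u0; rewrite /= psi_act ?(valP u) // u0.
by have := dm_act_linear D (-1) (0 : V) 0; rewrite scaler0 addr0 scaleN1r addNr => ->.
Qed.

Definition ker_module : submodule SU := Submodule ker_closed ker_stable.

(** The map psi respects the action only on the submodule U, so that its kernel
   is taken inside U. *)
Lemma first_isomorphism : isomorphic V (quotientModule ker_module).
Proof.
have lift v : exists u : SU, psi (val u) = v.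
  by have [u uU uE] := psi_surj v; exists (SubSort uU).
have [s sP] := choice lift.
have piE (u w : SU) : psi (val u) = psi (val w) ->
    quot_pi ker_module u = quot_pi ker_module w.
  move=> E; apply/quot_eqP; rewrite inE raddfB /=.
  by rewrite E subrr.
pose f0 v : quotientModule ker_module := quot_pi ker_module (s v).
have f0_lin : linear f0.
  move=> c v w; rewrite /f0 quot_piZ quot_addE; apply: piE.
  by rewrite sP -[val (c *: s v + s w)]/(c *: val (s v) + val (s w)) linearP !sP.
pose f : {linear V -> quotientModule ker_module} :=
  HB.pack f0 (GRing.isLinear.Build _ _ _ _ f0 f0_lin).
exists f; split; last first.
  move=> D v; rewrite -[dm_act D (f v)]/(quot_act D (f0 v)) /f0 quot_actE.
  apply: piE; rewrite sP -[val (sub_act D (s v))]/(dm_act D (val (s v))).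
  by rewrite psi_act ?sP // (valP (s v)).
exists (fun q : quotientModule ker_module => psi (val (quot_repr q : SU))) => [v|q];
  last first.
  by rewrite -[RHS]quot_piK; apply: piE; rewrite sP.
have /quot_eqP := quot_piK (f0 v); rewrite inE raddfB /= sP subr_eq0.
by move=> /eqP.
Qed.

Lemma subquotient_of_map : isomorphic_to_subquotient V M.
Proof. by exists U, ker_module; apply: first_isomorphism. Qed.

End FirstIsomorphism.

(** * The model as a module with a basis *)

Section Assembly.
Variable F : numFieldType.
Variable hq : 2.-primitive_root (-1 : F).

Local Notation A := (qtorus hq).
Local Notation x m := (xmon hq m).

Lemma coeff_xmon_sum (c : {fsfun Z2 -> F with 0}) k :
  coeff k (\sum_(i <- finsupp c) c i *: x i) = c k.
Proof.
have coeff_term i : coeff k (c i *: x i) = c i * (i == k)%:R.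
  by rewrite coeffZ coeff_xmon.
rewrite (big_morph _ (coeffD k) (coeff0 _ k)).
under eq_bigr => i _ do rewrite coeff_term.
have [kc|kc] := boolP (k \in finsupp c).
  rewrite (bigD1_seq k) ?fset_uniq //= eqxx mulr1 big1 ?addr0 // => i /negPf ->.
  by rewrite mulr0.
rewrite big_seq big1; first by rewrite fsfun_dflt.
by move=> i ic; case: eqP => [ik|]; rewrite ?mulr0 // -ik ic in kc *.
Qed.

Lemma xmon_basis : is_basis (fun k => x k : A).
Proof.
move=> w; pose c : {fsfun Z2 -> F with 0} :=
  [fsfun i in seq_fset tt (dom w) => coeff i w].
exists c; split.
  apply: torus_eqP => k; rewrite coeff_xmon_sum fsfunE seq_fsetE.
  by case: ifP => // /negbT /coeff_outdom.
move=> c' wE; apply/fsfunP => k; rewrite -(coeff_xmon_sum c') -wE.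
by rewrite fsfunE seq_fsetE; case: ifP => // /negbT /coeff_outdom ->.
Qed.

Variables (a : bool) (lam : bool -> F) (b : F).

Lemma model_is_A : is_A a (lam false, lam true) b (fun k => x k : model hq a lam b).
Proof.
split=> [|m k om|n hn k d].
- exact: xmon_basis.
- have om' : ~~ evn m by rewrite -(in_NZ2_evn hq).
  have := mact_dgen hq a lam b (u := GenG m) k om'.
  rewrite /= subr0 addrC => ->.
  by rewrite !expN1_eps !pzM.
have en : evn n by rewrite -(in_NZ2_evn hq).
have -> : xtoral hq hn d = d.1 *: dgen hq (GenW false n) + d.2 *: dgen hq (GenW true n).
  apply: der_ext_xmon => j.
  rewrite -[RHS]/(d.1 *: dgen hq (GenW false n) (x j) + d.2 *: dgen hq (GenW true n) (x j)).
  rewrite !dgenW_xmon // -[xtoral hq hn d (x j)]/(x n * (d.1 *: part hq false (x j) + d.2 *: part hq true (x j))).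
  rewrite !part_xmon !scalerA -!scalerDl -scalerAr xM.
  move: en; rewrite /evn /par xpair_eqE => /andP[_ /eqP ->].
  by rewrite /eps /= scale1r.
rewrite -[dm_act _ _]/(mact a lam b _ _) mactl.
have l0 : mact a lam b (0 : der A) (x k) = 0.
  by have := mactl a lam b (-1) 0 0 (x k); rewrite scaler0 addr0 scaleN1r addNr.
have lZ D c : mact a lam b (c *: D) (x k) = c *: mact a lam b D (x k).
  by rewrite -[c *: D]addr0 mactl l0 addr0.
rewrite lZ !mact_dgen // !scalerA -scalerDl [n + k]addrC; congr (_ *: _).
Qed.

End Assembly.

(** * The classification *)

Section IntermediateSeries.
Variable F : numFieldType.
Variable hq : 2.-primitive_root (-1 : F).
Variable V : derModule (qtorus hq).

Local Notation x m := (xmon hq m).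

Lemma aco_shift lam (a : bool) kap (B : F) u k :
  aco (fun s => lam s + (crd s kap)%:~R) a 0 B u k = aco lam a kap B u (k + kap).
Proof.
case: u => [s n|m] /=; last by rewrite subr0 addrK.
rewrite /wt -(addrA (lam s)) -intrD [crd s kap + _]addrC.
by congr (_ + (_)%:~R + _); case: s.
Qed.

(** The linear map psi sends the vectors of A_{a,alpha,b} indexed by P to
   rescaled vectors of V, and the others to 0. It respects the action on the
   submodule spanned by the indices in P or Q2, where its kernel is spanned by
   those in Q2. *)
Theorem intermediate_series_subquotient : irreducible V -> intermediate_series V ->
  exists (a : bool) (alpha : F * F) (b : F) (M : derModule (qtorus hq)) (v : Z2 -> M),
    is_A a alpha b v /\ isomorphic_to_subquotient V M.
Proof.
move=> irrV interV; have [nzV _] := irrV.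
have [lam [vv [vw vmax exP]]] := weight_family nzV interV.
have [co [coE coS]] := action_coefficients vw vmax.
have H := extracted_qrep vw coE coS irrV.
set P := (fun k => vv k != 0) in H coS; set f := (fun s n => _) in H; set g := (fun m => _) in H.
have coG u k : gco f g u k = co u k by case: u.
have [a [kap [B [S [Q2 [S0 inner closed12 dis closed2]]]]]] := qrep_classification H exP.
pose lam' s := lam s + (crd s kap)%:~R; pose M := model hq a lam' B.
exists a, (lam' false, lam' true), B, M, (fun k => x k : M); split.
  exact: model_is_A.
pose e k := if P (k + kap) then S (k + kap) *: vv (k + kap) else 0.
pose psi0 (u : M) : V := fglift e u.
have psi0_lin : linear psi0 by exact: fglift_linear.
pose psi : {linear M -> V} := HB.pack psi0 (GRing.isLinear.Build _ _ _ _ psi0 psi0_lin).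
have psiZ c u : psi (c *: u) = c *: psi u by exact: linearZ.
have psi_xmon k : psi (x k) = e k by apply: qlift_xmon.
pose Q1 k := P (k + kap) || Q2 (k + kap).
pose U0 : {pred M} := [pred u | proj Q1 u == u].
have U0_closed : submod_closed U0.
  split=> [|c u w]; rewrite !inE; first by rewrite /proj linear0.
  by move=> /eqP uE /eqP wE; rewrite proj_linear uE wE.
have [U00 U0D] := U0_closed.
have U0_xmon k : Q1 k -> x k \in U0 by rewrite inE proj_xmon => ->.
have act_xmon u k : gval u ->
    dm_act (dgen hq u) (x k : M) = aco lam a kap B u (k + kap) *: x (k + gdeg u).
  by move=> vu; rewrite -aco_shift; apply: mact_dgen.
have U0_stable D (u : M) : u \in U0 -> dm_act D u \in U0.
  move: D u; apply: der_ind => [c D E ihD ihE u uU|u vu w].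
    by rewrite actPl; apply: U0D; [apply: ihD | apply: ihE].
  rewrite inE => /eqP <-; elim/qtorus_ind: w => [c w w' ihw ihw'||k].
  - by rewrite proj_linear actPr; apply: U0D.
  - by rewrite /proj linear0 act0r.
  rewrite proj_xmon; case: ifP => Qk; last by rewrite act0r.
  rewrite act_xmon //.
  have [->|c0] := eqVneq (aco lam a kap B u (k + kap)) 0; first by rewrite scale0r.
  rewrite -[_ *: _]addr0; apply: U0D => //; apply: U0_xmon.
  by rewrite /Q1 addrAC; apply: closed12.
pose U := Submodule U0_closed U0_stable.
apply: (@subquotient_of_map _ _ V M psi U) => [v|].
  have [k0 Pk0] := exP.
  have [u uE] := lift_surjective coE irrV Pk0 v.
  pose t k : M := if P k then (S k)^-1 *: x (k - kap) else 0.
  exists (fglift t u).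
    rewrite inE; apply/eqP; move: u {uE}; apply: (linear_ext (hq := hq)).
    - by move=> c w w'; rewrite fglift_linear proj_linear.
    - by move=> c w w'; rewrite fglift_linear.
    move=> k; rewrite !qlift_xmon /t; case: ifP => Pk; last by rewrite /proj linear0.
    rewrite -[_ *: _]addr0 proj_linear proj_xmon /Q1 subrK Pk /=.
    by rewrite /proj linear0.
  rewrite uE; move: u {uE}; apply: (linear_ext (hq := hq)).
  - by move=> c w w'; rewrite fglift_linear linearP.
  - exact: lift_linear.
  move=> k; rewrite qlift_xmon lift_xmon /t; case: ifP => [Pk|/negbT].
    by rewrite psiZ psi_xmon /e subrK Pk scalerA mulVf ?scale1r.
  by rewrite negbK raddf0 => /eqP ->.
apply: der_ind => [c D E ihD ihE u uU|u vu w].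
  by rewrite !actPl linearP ihD // ihE.
rewrite inE => /eqP <-; elim/qtorus_ind: w => [c w w' ihw ihw'||k].
- by rewrite proj_linear actPr !linearP actPr ihw ihw'.
- by rewrite /proj linear0 !(act0r, raddf0).
rewrite proj_xmon; case: ifP => Qk; last by rewrite !(act0r, raddf0).
rewrite act_xmon // psiZ !psi_xmon /e.
rewrite [k + gdeg u + kap]addrAC.
move: Qk; rewrite /Q1; case: (boolP (P (k + kap))) => [Pk _|nP /= Q2k].
  rewrite actZr coE // scalerA; case: ifP => [Pk'|/negbT].
    by rewrite scalerA -inner // coG mulrC.
  by rewrite negbK => /eqP ->; rewrite !scaler0.
rewrite act0r; case: ifP => [Pk'|_]; last by rewrite scaler0.
have [->|c0] := eqVneq (aco lam a kap B u (k + kap)) 0; first by rewrite scale0r.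
by have := dis _ (closed2 _ _ vu Q2k c0); rewrite Pk'.
Qed.

End IntermediateSeries.

Theorem theorem2p3 (R : realType) (N : nat) (q : R[i])
    (hq : N.-primitive_root q) (hN : (1 < N)%N) (hq1 : q = -1)
    (V : derModule (qtorus hq)) :
  irreducible V -> intermediate_series V ->
  exists (a : bool) (alpha : R[i] * R[i]) (b : R[i])
    (A : derModule (qtorus hq)) (v : int * int -> A),
    is_A a alpha b v /\ isomorphic_to_subquotient V A.
Proof.
have N2 : N = 2%N.
  have : (N %| 2)%N by rewrite (prim_order_dvd hq) hq1 sqrrN expr1n.
  by move=> /(@dvdn_leq _ 2 isT) N2; apply/eqP; rewrite eqn_leq N2.
subst q; subst N; exact: intermediate_series_subquotient.
Qed.
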